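(* Let $d\ge 2$ and $\mu\in M_F(\mathbb{R}^d)$, and let $X=(X_t)_{t\ge 0}$ be the superprocess in a random environment with covariance function $g$ and $X_0=\mu$. Then with $\mathbb{P}_\mu$-probability one, $X_t$ is singular with respect to Lebesgue measure for Lebesgue-almost every $t>0$.
   Context: $M_F(\mathbb{R}^d)$ is the space of finite (Borel) measures on $\mathbb{R}^d$ with the topology of weak convergence, and $\nu(f)=\langle\nu,f\rangle=\int f\,d\nu$. $C_b^2(\mathbb{R}^d)$ is the space of bounded continuous functions with bounded continuous derivatives up to order 2. Fix a function $g:\mathbb{R}^d\times\mathbb{R}^d\to\mathbb{R}$ with $\|g\|_\infty=\sup_{x,y}|g(x,y)|<\infty$, which is the spatial covariance of a Gaussian noise $W$ white in time: $\mathbb{E}[W(t,x)W(s,y)]=g(x,y)(s\wedge t)$. The superprocess in a random environment with covariance function $g$ is an $M_F(\mathbb{R}^d)$-valued process $X=(X_t)_{t\ge0}$ on a complete filtered probability space $(\Omega,\mathcal{F},\mathcal{F}_t,\mathbb{P})$ such that for every $\phi\in C_b^2(\mathbb{R}^d)$, $$M_t(\phi)=X_t(\phi)-X_0(\phi)-\int_0^t X_s\big(\tfrac{\Delta}{2}\phi\big)\,ds$$ is a continuous $(\mathcal{F}_t)$-martingale with quadratic variation $$\langle M(\phi)\rangle_t=\int_0^t X_s(\phi^2)\,ds+\int_0^t ds\int_{\mathbb{R}^d}\int_{\mathbb{R}^d}g(u,v)\phi(u)\phi(v)\,X_s(du)X_s(dv).$$ It is known (Mytnik) that the solution of this martingale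 problem is unique in law; $\mathbb{P}_\mu$, $\mathbb{E}_\mu$ denote the law and expectation when $X_0=\mu$. *)

(* Defs.v *)
From HB Require Import structures.
From mathcomp Require Import all_boot all_order all_algebra.
From mathcomp Require Import all_classical all_reals all_analysis.
From mathcomp Require Import measurable_realfun.

Set Implicit Arguments.
Unset Strict Implicit.
Unset Printing Implicit Defensive.
Import Order.TTheory GRing.Theory Num.Theory.
Import numFieldNormedType.Exports.

Local Open Scope classical_set_scope.
Local Open Scope ring_scope.

(* The Borel sigma-algebra of matrices, hence of R^d = 'rV[R]_d. *)
HB.instance Definition _ (R : realType) m n :=
  @isMeasurable.Build (sigma_display (@open 'M[R]_(m, n))) 'M[R]_(m, n)
    <<s open >> (@sigma_algebra0 _ setT open)
    (@sigma_algebraC _ open) (@sigma_algebra_bigcup _ setT open).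

Lemma measurable_coord (R : realType) m n (i : 'I_m) (j : 'I_n) :
  measurable_fun setT (fun A : 'M[R]_(m, n) => A i j).
Proof.
apply: (@measurability _ _ _ _ setT _ (@RGenOpens.G R)).
  exact: (RGenOpens.measurableE R).
move=> _ [_ [x [y ->]] <-]; rewrite setTI; apply: sub_sigma_algebra.
by move: (`]x, y[%classic) (@interval_open R (BRight x) (BLeft y) isT isT); apply/continuousP; exact: coord_continuous.
Qed.

Lemma measurable_mxP d (T : measurableType d) (R : realType) m n
    (f : T -> 'M[R]_(m, n)) :
  (forall i j, measurable_fun setT (fun x => f x i j)) -> measurable_fun setT f.
Proof.
move=> mf; apply: (@measurability _ _ _ _ setT f (@open 'M[R]_(m, n))) => //.
move=> _ [U oU <-]; rewrite setTI.
pose box (q : 'M[rat]_(m, n) * rat) : set 'M[R]_(m, n) :=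
  [set v | forall i j, `|ratr (q.1 i j) - v i j| < ratr q.2].
have mbox q : measurable (f @^-1` box q).
  have -> : f @^-1` box q = \bigcap_(i in [set: 'I_m])
      \bigcap_(j in [set: 'I_n])
      (fun x => f x i j) @^-1` (ball (ratr (q.1 i j) : R) (ratr q.2)).
    apply/seteqP; split => [x xq i _ j _ | x xq i j]; first exact: xq.
    exact: xq.
  apply: fin_bigcap_measurable => // i _; apply: fin_bigcap_measurable => // j _.
  rewrite -[X in measurable X]setTI; apply: mf => //.
  by apply: open_measurable; exact: ball_open.
have -> : U = \bigcup_q (if `[< box q `<=` U >] then box q else set0).
  apply/seteqP; split => [v Uv|v [q _]]; last first.
    by case: asboolP => // + qv; exact.
  move: oU; rewrite openE => /(_ _ Uv)/nbhs_ballP[e /= e0 veU].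
  have /rat_in_itvoo[r] : 0 < e / 2 by rewrite divr_gt0.
  rewrite in_itv /= => /andP[r0 re].
  have /choice[p hp] (ij : 'I_m * 'I_n) :
      exists p : rat, `|ratr p - v ij.1 ij.2| < ratr r.
    have /rat_in_itvoo[p] : v ij.1 ij.2 - ratr r < v ij.1 ij.2 + ratr r.
      by rewrite ltrBlDr -addrA ltrDl addr_gt0.
    by rewrite in_itv /= => h; exists p; rewrite ltr_distl.
  exists (\matrix_(i, j) p (i, j), r) => //; case: asboolP => [_ i j /=|[]].
    by rewrite mxE; exact: (hp (i, j)).
  move=> w wq; apply: veU; split => // i j; rewrite /ball /=.
  have := wq i j; rewrite /= mxE => pw.
  rewrite [e]splitr.
  rewrite (le_lt_trans (ler_distD (ratr (p (i, j))) _ _))// ltrD//.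
    by rewrite distrC (lt_trans (hp (i, j))).
  exact: lt_trans pw _.
rewrite preimage_bigcup; apply: countable_bigcupT_measurable => [|q].
  exact: countableP.
by case: asboolP => // _; rewrite preimage_set0.
Qed.

Section lebesgue_step.
Context {R : realType} {n : nat}.
Implicit Type A : set 'rV[R]_n.+1.

Definition cons_rV (p : measurableTypeR R * 'rV[R]_n) : 'rV[R]_n.+1 :=
  \row_j (if unlift ord0 j is Some k then p.2 ord0 k else p.1).

Definition uncons_rV (v : 'rV[R]_n.+1) : measurableTypeR R * 'rV[R]_n :=
  (v ord0 ord0, \row_k v ord0 (lift ord0 k)).

Lemma uncons_rVK : cancel uncons_rV cons_rV.
Proof.
move=> v; apply/rowP => j; rewrite mxE /=.
by case: unliftP => [k ->|->]; rewrite ?mxE.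
Qed.

Lemma cons_rVK : cancel cons_rV uncons_rV.
Proof.
move=> [x v]; rewrite /uncons_rV; congr pair; first by rewrite mxE unlift_none.
by apply/rowP => k; rewrite !mxE liftK.
Qed.

Lemma measurable_cons_rV : measurable_fun setT cons_rV.
Proof.
apply: measurable_mxP => i j.
under eq_fun do rewrite mxE.
case: unliftP => [k _|_]; last exact: measurable_fst.
by apply: (measurableT_comp (measurable_coord ord0 k)); exact: measurable_snd.
Qed.

Lemma measurable_uncons_rV : measurable_fun setT uncons_rV.
Proof.
apply: measurable_fun_pair; first exact: measurable_coord.
apply: measurable_mxP => i j; under eq_fun do rewrite mxE.
exact: measurable_coord.
Qed.

Variable mu : {sigma_finite_measure set 'rV[R]_n -> \bar R}.

Definition lebesgue_rV_step : set 'rV[R]_n.+1 -> \bar R :=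
  pushforward (@lebesgue_measure R \x mu)%E cons_rV.

Let step0 : lebesgue_rV_step set0 = 0%E.
Proof. by rewrite /lebesgue_rV_step /pushforward preimage_set0 measure0. Qed.

Let step_ge0 A : (0 <= lebesgue_rV_step A)%E.
Proof. by rewrite /lebesgue_rV_step /pushforward; exact: measure_ge0. Qed.

Let step_sigma_additive : semi_sigma_additive lebesgue_rV_step.
Proof.
have mpre A : measurable A -> measurable (cons_rV @^-1` A).
  by move=> mA; rewrite -[X in measurable X]setTI; exact: measurable_cons_rV.
move=> F mF tF mUF; rewrite /lebesgue_rV_step /pushforward preimage_bigcup.
apply: measure_semi_sigma_additive => [k| |].
- exact: mpre.
- apply/trivIsetP => /= i j _ _ ij; rewrite -preimage_setI.
  by move/trivIsetP : tF => /(_ _ _ _ _ ij) ->//; rewrite preimage_set0.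
- by rewrite -preimage_bigcup; exact: mpre.
Qed.

HB.instance Definition _ := isMeasure.Build _ _ _ lebesgue_rV_step
  step0 step_ge0 step_sigma_additive.

Let lebesgue_rV_step_sigma_finite : sigma_finite setT lebesgue_rV_step.
Proof.
have /sigma_finiteP[F [FT ndF Foo]] := sigma_finiteT (@lebesgue_measure R).
have /sigma_finiteP[G [GT ndG Goo]] := sigma_finiteT mu.
exists (fun k => uncons_rV @^-1` (F k `*` G k)).
  apply/esym; rewrite -subTset => v _.
  have : [set: measurableTypeR R] (uncons_rV v).1 by [].
  have : [set: 'rV[R]_n] (uncons_rV v).2 by [].
  rewrite FT GT => -[k _ Gk] [l _ Fl]; exists (maxn k l) => //; split.
  - by move: Fl; exact/subsetPset/ndF/leq_maxr.
  - by move: Gk; exact/subsetPset/ndG/leq_maxl.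
move=> k; have [mF Fk] := Foo k; have [mG Gk] := Goo k; split.
  by rewrite -[X in measurable X]setTI; apply: measurable_uncons_rV => //;
    exact: measurableX.
rewrite /lebesgue_rV_step /pushforward -comp_preimage.
rewrite (_ : uncons_rV \o cons_rV = id); last first.
  by apply/funext => p; exact: cons_rVK.
by rewrite preimage_id product_measure1E// lte_mul_pinfty// ge0_fin_numE.
Qed.

HB.instance Definition _ := @Measure_isSigmaFinite.Build _ _ _ lebesgue_rV_step
  lebesgue_rV_step_sigma_finite.

End lebesgue_step.

(* Lebesgue measure on R^n, as the iterated product of n copies of Lebesgue
   measure on the line; R^0 is a point of mass one. *)
Fixpoint lebesgue_rV (R : realType) n :
    {sigma_finite_measure set 'rV[R]_n -> \bar R} :=
  match n with
  | 0 => dirac (0 : 'rV[R]_0)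
  | k.+1 => lebesgue_rV_step (lebesgue_rV R k)
  end.

Lemma lebesgue_rV_box (R : realType) n (A : 'I_n -> set (measurableTypeR R)) :
  (forall i, measurable (A i)) ->
  lebesgue_rV R n [set v | forall i, A i (v ord0 i)] =
  (\prod_i @lebesgue_measure R (A i))%E.
Proof.
elim: n A => [|n IHn] A mA.
  by rewrite big_ord0 /= diracE mem_set// => -[].
rewrite big_ord_recl -IHn// /= /lebesgue_rV_step /pushforward.
have mB : measurable [set v : 'rV[R]_n | forall i, A (lift ord0 i) (v ord0 i)].
  rewrite (_ : mkset _ = \bigcap_(i in [set: 'I_n])
      (fun v : 'rV[R]_n => v ord0 i) @^-1` A (lift ord0 i)); last first.
    by apply/seteqP; split => v Av i; [move=> _|]; apply: Av.
  apply: fin_bigcap_measurable => // i _.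
  by rewrite -[X in measurable X]setTI; apply: measurable_coord => //; exact: mA.
rewrite -product_measure1E//.
congr product_measure1; apply/seteqP; split => -[x v] /=.
  move=> Av; split; first by have := Av ord0; rewrite mxE unlift_none.
  by move=> i; have := Av (lift ord0 i); rewrite mxE liftK.
by move=> [Ax Av] i; rewrite mxE; case: unliftP => [j ->|->].
Qed.

Definition mutually_singular d (T : measurableType d) (R : realType)
    (mu nu : set T -> \bar R) : Prop :=
  exists A, [/\ measurable A, mu A = 0%E & nu (~` A) = 0%E].

Section test_functions.
Context {R : realType} {d : nat}.
Implicit Types f : 'rV[R]_d -> R.

Definition Cb f : Prop := continuous f /\ exists C, forall x, `|f x| <= C.

Definition partial (i : 'I_d) f : 'rV[R]_d -> R := 'D_('e_i) f.

Definition partially_derivable f : Prop :=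
  forall (i : 'I_d) x, derivable f x 'e_i.

Definition Cb2 f : Prop :=
  [/\ Cb f,
      partially_derivable f /\ (forall i, Cb (partial i f)) &
      forall i, partially_derivable (partial i f) /\
        forall j, Cb (partial j (partial i f))].

Definition laplacian f : 'rV[R]_d -> R :=
  fun x => \sum_i partial i (partial i f) x.

End test_functions.

Definition MF (R : realType) d := {finite_measure set 'rV[R]_d -> \bar R}.

HB.instance Definition _ (R : realType) d := gen_eqMixin (MF R d).
HB.instance Definition _ (R : realType) d := gen_choiceMixin (MF R d).
HB.instance Definition _ (R : realType) d := isPointed.Build (MF R d) mzero.

Definition MF_eval (R : realType) d (nu : MF R d) :
    {ptws {f : 'rV[R]_d -> R | Cb f} -> R} :=
  fun f => \int[nu]_x sval f x.

(* The topology of weak convergence, i.e. the coarsest one which makes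
   nu |-> nu(f) continuous for all f bounded continuous, and its Borel sets. *)
HB.instance Definition _ (R : realType) d :=
  Topological.copy (MF R d) (initial_topology (@MF_eval R d)).

HB.instance Definition _ (R : realType) d :=
  @isMeasurable.Build (sigma_display (@open (MF R d))) (MF R d)
    <<s open >> (@sigma_algebra0 _ setT open)
    (@sigma_algebraC _ open) (@sigma_algebra_bigcup _ setT open).

(* Processes are indexed by R; only their values at times t >= 0 are used. *)
Section processes.
Context {dO : measure_display} {Omega : measurableType dO} {R : realType}.
Variables (P : probability Omega R) (F : R -> set (set Omega)).

Record complete_filtration : Prop := {
  filtration_sigma_algebra : forall t : R, 0 <= t -> sigma_algebra setT (F t);
  filtration_measurable : forall t : R, 0 <= t -> F t `<=` measurable;
  filtration_nondecreasing : forall s t : R, 0 <= s -> s <= t -> F s `<=` F t;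
  filtration_complete : P.-negligible `<=` F 0 }.

Definition adapted d (T : measurableType d) (X : R -> Omega -> T) : Prop :=
  forall t : R, 0 <= t -> forall B, measurable B -> F t (X t @^-1` B).

Definition continuous_paths (M : R -> Omega -> R) : Prop :=
  \forall w \ae P, {within `[0, +oo[, continuous (fun t => M t w)}.

Definition martingale (M : R -> Omega -> R) : Prop :=
  [/\ adapted M,
      forall t : R, 0 <= t -> P.-integrable setT (fun w => (M t w)%:E) &
      forall s t : R, 0 <= s -> s <= t -> forall A, F s A ->
        (\int[P]_(w in A) (M t w)%:E = \int[P]_(w in A) (M s w)%:E)%E].

Definition stopping_time (tau : Omega -> \bar R) : Prop :=
  (forall w, 0 <= tau w)%E /\
  forall t : R, 0 <= t -> F t [set w | (tau w <= t%:E)%E].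

Definition stopped (M : R -> Omega -> R) (tau : Omega -> \bar R) :
    R -> Omega -> R :=
  fun t w => M (fine (mine t%:E (tau w))) w.

Definition local_martingale (M : R -> Omega -> R) : Prop :=
  adapted M /\
  exists tau : nat -> Omega -> \bar R,
    [/\ forall n, stopping_time (tau n),
        \forall w \ae P, forall n, (tau n w <= tau n.+1 w)%E,
        \forall w \ae P, (tau ^~ w) n @[n --> \oo] --> +oo%E &
        forall n, martingale (stopped M (tau n))].

(* A is the quadratic variation of the continuous martingale M, M_0 = 0:
   the continuous adapted nondecreasing process starting from 0 for which
   M^2 - A is a local martingale. *)
Definition quadratic_variation (M A : R -> Omega -> R) : Prop :=
  [/\ adapted A,
      continuous_paths A,
      \forall w \ae P, A 0 w = 0,
      \forall w \ae P, forall s t : R, 0 <= s -> s <= t -> A s w <= A t w &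
      local_martingale (fun t w => M t w ^+ 2 - A t w)].

(* The law N(0, 0) is a separate case since normal_prob 0 0 is not the Dirac
   mass at 0 (it is a uniform law by convention). *)
Definition centered_gaussian (Y : Omega -> R) : Prop :=
  measurable_fun setT Y /\
  ((\forall w \ae P, Y w = 0) \/
   exists2 sigma : R, 0 < sigma &
     forall B, measurable B -> P (Y @^-1` B) = normal_prob 0 sigma B).

Definition centered_gaussian_family (I : Type) (D : set I)
    (W : I -> Omega -> R) : Prop :=
  forall n (i : 'I_n -> I) (c : 'I_n -> R), (forall k, D (i k)) ->
    centered_gaussian (fun w => \sum_k c k * W (i k) w).

End processes.

(* g is the spatial covariance of a Gaussian noise which is white in time. *)
Definition noise_covariance (R : realType) d
    (g : 'rV[R]_d -> 'rV[R]_d -> R) : Prop :=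
  exists (dO : measure_display) (Omega : measurableType dO)
    (P : probability Omega R) (W : R * 'rV[R]_d -> Omega -> R),
    centered_gaussian_family P [set tx | 0 <= tx.1] W /\
    forall (t s : R) x y, 0 <= t -> 0 <= s ->
      ('E_P[(fun w => W (t, x) w * W (s, y) w)%R] =
        (g x y * Num.min s t)%:E)%E.

Section superprocess.
Context {dO : measure_display} {Omega : measurableType dO} {R : realType}.
Context {d : nat}.
Variables (P : probability Omega R) (F : R -> set (set Omega)).
Variables (g : 'rV[R]_d -> 'rV[R]_d -> R) (X : R -> Omega -> MF R d).

Definition M_phi (phi : 'rV[R]_d -> R) : R -> Omega -> R := fun t w =>
  \int[X t w]_x phi x - \int[X 0 w]_x phi x
  - \int[lebesgue_measure]_(s in `[0, t]) \int[X s w]_x (laplacian phi x / 2).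

Definition QV_phi (phi : 'rV[R]_d -> R) : R -> Omega -> R := fun t w =>
  \int[lebesgue_measure]_(s in `[0, t]) \int[X s w]_x (phi x ^+ 2)
  + \int[lebesgue_measure]_(s in `[0, t])
      \int[X s w]_v \int[X s w]_u (g u v * phi u * phi v).

Record superprocess_random_environment : Prop := {
  superprocess_filtration : complete_filtration P F;
  superprocess_measurable : measurable_fun [set tw : R * Omega | 0 <= tw.1]
    (fun tw => X tw.1 tw.2);
  superprocess_adapted : adapted F X;
  superprocess_martingale : forall phi, Cb2 phi -> martingale P F (M_phi phi);
  superprocess_continuous : forall phi, Cb2 phi ->
    continuous_paths P (M_phi phi);
  superprocess_quadratic_variation : forall phi, Cb2 phi ->
    quadratic_variation P F (M_phi phi) (QV_phi phi) }.

End superprocess.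

(* Main.v *)
Require Import Defs.
From HB Require Import structures.
From mathcomp Require Import all_boot all_order all_algebra.
From mathcomp Require Import all_classical all_reals all_analysis.
From mathcomp Require Import measurable_realfun.
From mathcomp Require Import ring lra.
Set Implicit Arguments.
Unset Strict Implicit.
Unset Printing Implicit Defensive.
Import Order.TTheory GRing.Theory Num.Theory.
Import numFieldNormedType.Exports.
Local Open Scope classical_set_scope.
Local Open Scope ring_scope.

(** Let V_s be nonnegative test functions on [0, t] with -dV/ds >= Lap V / 2 - V^2 / 2. Formally
    exp(- X_s(V_s)) is then a submartingale: its drift is exp(- X_s(V_s)) times the sum of
    X_s(-dV/ds - Lap V / 2 + V^2 / 2) and of half the environment part of the quadratic variation.
    The latter is nonnegative, because a covariance stays positive semidefinite when integrated
    against a measure ([psd_integral_ge0]). Hence exp(- mu(V_0)) <= E exp(- X_t(V_t))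
    ([log_laplace_le]), the one-sided bound known for super-Brownian motion.

    The supersolution is the planar heat kernel with perturbed exponents, c s^(-1-delta) exp(-
    (1-delta) |z|^2 / (2 s)), where z runs over two of the d coordinates. It works up to time T as
    soon as 4 delta <= c T^(-delta) exp(-2) ([super_ineq]), so c may be as small as one likes. At
    age eps = c^(1/delta) it is a bump of height 1/eps and width sqrt eps, while after a further
    time t bounded away from 0 its height is O(c). Therefore E(1 - exp(- X_t(bump))) = O(c),
    uniformly in the centre ([laplace_test]): at scale eps the planar density of X_t is small near a
    typical point.

    A box is then cut into tiles of planar side sqrt eps. Tiles of noticeable density have small
    total Lebesgue measure in expectation, and the others carry little mass of X_t ([score_le]). For
    each fixed t > 0, Markov's inequality and Borel-Cantelli over a sequence of scales show that
    almost surely the bad events happen finitely often; Tonelli exchanges t and the sample point,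
    and sets of tiny Lebesgue measure carrying almost all the mass give singularity
    ([singular_of_boxes]).

    The submartingale inequality is obtained without stochastic integrals. Over a step h = e^2 one
    expands exp(-x) to second order: the martingale increment has mean zero, its square is
    compensated by the quadratic variation, and a fourth moment bound ([fourth_moment]) makes the
    remainder O(e^3), so that the t / h steps cost O(e) in total ([one_step], [log_laplace_grid]).
    All quantities are kept bounded by stopping when the total mass passes a level K, which has
    probability at most mu(1) / K ([hit_prob_le]). *)

(** * Calculus of bounded measurable functions under a finite measure *)

Section bounded_measurable.
Context {d : measure_display} {T : measurableType d} {R : realType}.
Implicit Types f g : T -> R.

(** A class closed under the algebra used throughout and integrable for every finite measure, so
    that integrability side conditions reduce to closure lemmas. *)
Definition bm f : Prop := measurable_fun setT f /\ exists c, forall x, `|f x| <= c.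

Lemma bm_measurable f : bm f -> measurable_fun setT f.
Proof. by case. Qed.

Lemma bm_bound f : bm f -> exists2 c, 0 <= c & forall x, `|f x| <= c.
Proof.
move=> [_ [c fc]]; exists c => //.
by apply: le_trans (fc point).
Qed.

Lemma bm_cst (c : R) : bm (fun=> c).
Proof. by split => //; exists `|c|. Qed.

Lemma bm_id f c : measurable_fun setT f -> (forall x, `|f x| <= c) -> bm f.
Proof. by split=> //; exists c. Qed.

Lemma bmD f g : bm f -> bm g -> bm (fun x => f x + g x).
Proof.
move=> [mf [a fa]] [mg [b gb]]; split; first exact: measurable_funD.
by exists (a + b) => x; rewrite (le_trans (ler_normD _ _))// lerD.
Qed.

Lemma bmN f : bm f -> bm (fun x => - f x).
Proof.
move=> [mf [a fa]]; split; first exact: measurableT_comp.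
by exists a => x; rewrite normrN.
Qed.

Lemma bmB f g : bm f -> bm g -> bm (fun x => f x - g x).
Proof. by move=> bf bg; apply: bmD => //; exact: bmN. Qed.

Lemma bmM f g : bm f -> bm g -> bm (fun x => f x * g x).
Proof.
move=> [mf [a fa]] [mg [b gb]]; split; first exact: measurable_funM.
by exists (a * b) => x; rewrite normrM ler_pM.
Qed.

Lemma bmX n f : bm f -> bm (fun x => f x ^+ n).
Proof.
move=> bf; elim: n => [|n ih]; first exact: bm_cst.
by under eq_fun do rewrite exprS; exact: bmM.
Qed.

Lemma bm_sum (I : Type) (s : seq I) (h : I -> T -> R) :
  (forall i, bm (h i)) -> bm (fun x => \sum_(i <- s) h i x).
Proof.
move=> bh; elim: s => [|i s ih].
  by under eq_fun do rewrite big_nil; exact: bm_cst.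
by under eq_fun do rewrite big_cons; exact: bmD.
Qed.

Lemma bm_bigmax (I : Type) (s : seq I) (h : I -> T -> R) :
  (forall i, bm (h i)) -> bm (fun x => \big[Num.max/0]_(i <- s) h i x).
Proof.
move=> bh; elim: s => [|i s [ms [c ih]]].
  by under eq_fun do rewrite big_nil; exact: bm_cst.
under eq_fun do rewrite big_cons; have [mi [a ia]] := bh i.
split; first exact: measurable_maxr.
exists (Num.max a c) => x; rewrite le_max.
by case: (leP (h i x)) => _; rewrite ?ia ?ih ?orbT.
Qed.

Lemma bm_abs f : bm f -> bm (fun x => `|f x|).
Proof.
move=> [mf [a fa]]; split; first exact: measurableT_comp.
by exists a => x; rewrite normr_id.
Qed.

Lemma bm_indic (A : set T) : measurable A -> bm (\1_A : T -> R).
Proof.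
move=> mA; split; first exact/measurable_indicP.
by exists 1 => x; rewrite indicE; case: (x \in A); rewrite ?normr1 ?normr0.
Qed.

Lemma bm_expN f : bm f -> bm (fun x => expR (- f x)).
Proof.
move=> bf; have [c c0 fc] := bm_bound bf; split.
  by apply: measurableT_comp => //; apply: measurableT_comp => //; case: bf.
exists (expR c) => x; rewrite ger0_norm ?expR_ge0// ler_expR.
by rewrite (le_trans _ (fc x))// (le_trans (ler_norm _))// normrN.
Qed.

Variable mu : {finite_measure set T -> \bar R}.

Lemma bm_integrable f : bm f -> mu.-integrable setT (EFin \o f).
Proof.
move=> [mf [c fc]]; apply: measurable_bounded_integrable => //.
  exact: fin_num_fun_lty.
exists c; split; first by rewrite num_real.
by move=> y cy x _ /=; rewrite (le_trans (fc x))// ltW.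
Qed.

Lemma bm_intD f g : bm f -> bm g ->
  \int[mu]_x (f x + g x) = \int[mu]_x f x + \int[mu]_x g x.
Proof. by move=> bf bg; rewrite RintegralD//; exact: bm_integrable. Qed.

Lemma bm_intB f g : bm f -> bm g ->
  \int[mu]_x (f x - g x) = \int[mu]_x f x - \int[mu]_x g x.
Proof. by move=> bf bg; rewrite RintegralB//; exact: bm_integrable. Qed.

Lemma bm_intZ c f : bm f -> \int[mu]_x (c * f x) = c * \int[mu]_x f x.
Proof. by move=> bf; rewrite RintegralZl//; exact: bm_integrable. Qed.

Lemma bm_int_sum (I : Type) (s : seq I) (h : I -> T -> R) :
  (forall i, bm (h i)) ->
  \int[mu]_x (\sum_(i <- s) h i x) = \sum_(i <- s) \int[mu]_x h i x.
Proof.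
move=> bh; elim: s => [|i s ih].
  rewrite big_nil; under eq_Rintegral do rewrite big_nil.
  by rewrite Rintegral_cst// mul0r.
rewrite big_cons -ih -bm_intD//; last exact: bm_sum.
by under eq_Rintegral do rewrite big_cons.
Qed.

Lemma bm_le f g : bm f -> bm g -> (forall x, f x <= g x) ->
  \int[mu]_x f x <= \int[mu]_x g x.
Proof. by move=> bf bg fg; apply: le_Rintegral => //; exact: bm_integrable. Qed.

Lemma bm_int_ge0 f : (forall x, 0 <= f x) -> 0 <= \int[mu]_x f x.
Proof. by move=> f0; exact: Rintegral_ge0. Qed.

Lemma bm_int_le_cst f c : bm f -> (forall x, f x <= c) ->
  \int[mu]_x f x <= c * fine (mu setT).
Proof.
move=> bf fc; rewrite -Rintegral_cst//; apply: bm_le => //; exact: bm_cst.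
Qed.

Lemma bm_int_norm_le f c : bm f -> (forall x, `|f x| <= c) ->
  `|\int[mu]_x f x| <= c * fine (mu setT).
Proof.
move=> bf fc; apply: le_trans (le_normr_Rintegral _ _) _ => //.
  exact: bm_integrable.
by apply: bm_int_le_cst => //; exact: bm_abs.
Qed.

Lemma int_indicM (A : set T) f : measurable A ->
  \int[mu]_(x in A) f x = \int[mu]_x (\1_A x * f x).
Proof.
move=> mA; rewrite Rintegral_mkcond; apply: eq_Rintegral => x _.
by rewrite patchE indicE; case: ifP => _; rewrite ?mul1r ?mul0r.
Qed.

Lemma int_indic (A : set T) : measurable A ->
  \int[mu]_x \1_A x = fine (mu A).
Proof.
move=> mA; transitivity (\int[mu]_(x in A) (1 : R)).
  by rewrite (int_indicM (fun=> 1))//; apply: eq_Rintegral => x _; rewrite mulr1.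
by rewrite Rintegral_cst// mul1r.
Qed.

Lemma int_dominated (f_ : nat -> T -> R) f g :
  (forall n, measurable_fun setT (f_ n)) -> measurable_fun setT f ->
  (\forall x \ae mu, f_ ^~ x @ \oo --> f x) ->
  mu.-integrable setT (EFin \o g) ->
  (\forall x \ae mu, forall n, `|f_ n x| <= g x) ->
  \int[mu]_x f_ n x @[n --> \oo] --> \int[mu]_x f x.
Proof.
move=> mf_ mf ff ig fg.
have [] := @dominated_convergence _ T R mu setT measurableT
   (fun n => EFin \o f_ n) (EFin \o f) (EFin \o g).
- by move=> n; exact/measurable_EFinP/mf_.
- exact/measurable_EFinP.
- by apply: filterS ff => x fx _; apply/fine_cvgP; split; [exact: nearW|exact: fx].
- exact: ig.
- by apply: filterS fg => x fgx n _; rewrite /= lee_fin.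
move=> if_ _ h.
rewrite /Rintegral; apply: fine_cvg.
rewrite fineK//; exact: integrable_fin_num.
Qed.

Lemma bm_dominated (f_ : nat -> T -> R) f c :
  (forall n, measurable_fun setT (f_ n)) ->
  (forall x, f_ ^~ x @ \oo --> f x) ->
  (forall n x, `|f_ n x| <= c) ->
  \int[mu]_x f_ n x @[n --> \oo] --> \int[mu]_x f x.
Proof.
move=> mf_ ff fc; apply: (@int_dominated _ _ (fun=> c)) => //; last by apply: aeW => x n; exact: fc.
- by apply: (measurable_fun_cvg mf_) => x _; exact: ff.
- exact: aeW.
- by apply: bm_integrable; exact: bm_cst.
Qed.

End bounded_measurable.

Section integrable_calculus.
Context {d : measure_display} {T : measurableType d} {R : realType}.
Variable mu : {finite_measure set T -> \bar R}.
Implicit Types f g : T -> R.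

Local Notation ig f := (mu.-integrable setT (EFin \o f)).

Lemma bm_igM f g : bm f -> ig g -> ig (fun x => f x * g x).
Proof.
move=> bf gi; have [c c0 fc] := bm_bound bf.
apply: (@le_integrable _ _ _ mu _ measurableT _ (fun x => (c * g x)%:E)).
- apply/measurable_EFinP; apply: measurable_funM; first by case: bf.
  exact/measurable_EFinP/(measurable_int mu).
- move=> x _; rewrite /= lee_fin !normrM (ger0_norm c0).
  exact: ler_wpM2r.
- under eq_fun do rewrite EFinM; exact: integrableZl.
Qed.

Lemma ig_D f g : ig f -> ig g -> ig (fun x => f x + g x).
Proof. by move=> fi gi; exact: (integrableD measurableT fi gi). Qed.

Lemma ig_B f g : ig f -> ig g -> ig (fun x => f x - g x).
Proof. by move=> fi gi; exact: (integrableB measurableT fi gi). Qed.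

Lemma ig_abs f : ig f -> ig (fun x => `|f x|).
Proof. by move=> fi; exact: integrable_norm. Qed.

Lemma ae_bm_integrable f c : measurable_fun setT f ->
  (\forall x \ae mu, `|f x| <= c) -> ig f.
Proof.
move=> mf fc; apply/integrableP; split; first exact/measurable_EFinP.
apply: (@le_lt_trans _ _ (\int[mu]_x (`|c|%:E))%E); last first.
  by rewrite integral_cst// lte_mul_pinfty// ?lee_fin// fin_num_fun_lty.
apply: ae_ge0_le_integral => //.
  by apply: measurableT_comp => //; exact/measurable_EFinP.
by apply: filterS fc => x fxc _; rewrite lee_fin (le_trans fxc)// ler_norm.
Qed.

Lemma ig_sum (I : Type) (s : seq I) (h : I -> T -> R) :
  (forall i, ig (h i)) -> ig (fun x => \sum_(i <- s) h i x).
Proof.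
move=> hi; elim: s => [|i s ih].
  under eq_fun do rewrite big_nil; exact/bm_integrable/bm_cst.
by under eq_fun do rewrite big_cons; exact: ig_D.
Qed.

Lemma ig_int_sum (I : Type) (s : seq I) (h : I -> T -> R) :
  (forall i, ig (h i)) ->
  \int[mu]_x (\sum_(i <- s) h i x) = \sum_(i <- s) \int[mu]_x h i x.
Proof.
move=> hi; elim: s => [|i s ih].
  rewrite big_nil; under eq_Rintegral do rewrite big_nil.
  by rewrite Rintegral_cst// mul0r.
rewrite big_cons -ih -RintegralD//; last exact: ig_sum.
by under eq_Rintegral do rewrite big_cons.
Qed.

End integrable_calculus.

(** With the next lemma: a nonnegative real exceeds the number of positive integers below it by at
    most one. After rescaling, this approximates a bounded function uniformly by indicators of its
    level sets. *)
Lemma sum_indic_le (R : realType) (y : R) (N : nat) : 0 <= y ->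
  \sum_(k < N) ((k.+1%:R <= y)%R)%:R <= y.
Proof.
move=> y0; elim: N => [|N ih]; first by rewrite big_ord0.
rewrite big_ord_recr /=; have [Ny|Ny] := leP N.+1%:R y; last by rewrite addr0.
apply: le_trans Ny; rewrite -natr1 lerD2r.
have <- : \sum_(k < N) (1 : R) = N%:R by rewrite sumr_const card_ord.
by apply: ler_sum => i _; rewrite lern1 leq_b1.
Qed.

Lemma sum_indic_ge (R : realType) (y : R) (N : nat) : y <= N%:R ->
  y <= \sum_(k < N) ((k.+1%:R <= y)%R)%:R + 1.
Proof.
elim: N => [|N ih] yN; first by rewrite big_ord0 add0r (le_trans yN).
rewrite big_ord_recr /=; have [yN'|Ny] := leP y N%:R.
  by rewrite (le_trans (ih yN'))// lerD2r lerDl.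
apply: (le_trans yN); rewrite -natr1 lerD2r.
rewrite -[leLHS]addr0 lerD//.
have <- : \sum_(k < N) (1 : R) = N%:R by rewrite sumr_const card_ord.
apply: ler_sum => i _. have -> // : i.+1%:R <= y.
by apply: le_trans (ltW Ny); rewrite ler_nat.
Qed.

(** * Functions measurable at time t, and testing with bounded weights *)

Section filtered.
Context {dO : measure_display} {Omega : measurableType dO} {R : realType}.
Variables (P : probability Omega R) (F : R -> set (set Omega)).
Hypothesis hF : complete_filtration P F.

Local Notation ig f := (P.-integrable setT (EFin \o f)).

(** [Omega] is retyped with the sigma-algebra generated by [F t], which is [F t] itself for t >= 0,
    so that the general lemmas on measurable functions apply to adapted ones. *)
Definition fm (t : R) (f : Omega -> R) : Prop :=
  measurable_fun setT (f : g_sigma_algebraType (F t) -> R).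

Definition fb (t : R) (f : Omega -> R) : Prop :=
  bm (f : g_sigma_algebraType (F t) -> R).

Lemma FE t : 0 <= t ->
  @measurable _ (g_sigma_algebraType (F t)) = F t.
Proof.
by move=> t0; apply: measurable_g_measurableTypeE; exact: (filtration_sigma_algebra hF).
Qed.

Lemma fmP t f : 0 <= t ->
  fm t f <-> (forall B : set R, measurable B -> F t (f @^-1` B)).
Proof.
move=> t0; split=> [ft B mB|ft _ B mB].
  by rewrite -(FE t0) -[X in measurable X]setTI; exact: ft.
by rewrite setTI FE//; exact: ft.
Qed.

Lemma fm_measurable t f : 0 <= t -> fm t f -> measurable_fun setT f.
Proof.
move=> t0 /(fmP _ t0) ft _ B mB; rewrite setTI.
by apply: (filtration_measurable hF t0); exact: ft.
Qed.

Lemma fm_mono s t f : 0 <= s -> s <= t -> fm s f -> fm t f.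
Proof.
move=> s0 st /(fmP _ s0) fs; apply/fmP; first exact: le_trans st.
by move=> B mB; apply: (filtration_nondecreasing hF s0 st); exact: fs.
Qed.

Lemma fb_bm t f : 0 <= t -> fb t f -> bm f.
Proof. by move=> t0 [ft fc]; split => //; exact: fm_measurable ft. Qed.

Lemma fb_mono s t f : 0 <= s -> s <= t -> fb s f -> fb t f.
Proof. by move=> s0 st [fs fc]; split => //; exact: fm_mono fs. Qed.

Lemma fb_indic t (A : set Omega) : 0 <= t -> F t A -> fb t (\1_A).
Proof. by move=> t0 FA; apply: bm_indic; rewrite FE. Qed.

Lemma F_measurable t A : 0 <= t -> F t A -> measurable A.
Proof. by move=> t0 FA; apply: (filtration_measurable hF t0). Qed.

Lemma F_setI t A B : 0 <= t -> F t A -> F t B -> F t (A `&` B).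
Proof. by move=> t0; rewrite -(FE t0); exact: measurableI. Qed.

Lemma F_setC t A : 0 <= t -> F t A -> F t (~` A).
Proof. by move=> t0; rewrite -(FE t0); exact: measurableC. Qed.

Lemma F_setU t A B : 0 <= t -> F t A -> F t B -> F t (A `|` B).
Proof. by move=> t0; rewrite -(FE t0); exact: measurableU. Qed.

Lemma F_negligible t A : 0 <= t -> P.-negligible A -> F t A.
Proof.
move=> t0 PA; apply: (filtration_nondecreasing hF (lexx 0) t0).
by apply: (filtration_complete hF).
Qed.

(** Completeness of the filtration: the exceptional null set and all its subsets lie in [F t]. *)
Lemma fm_ae t f g : 0 <= t -> fm t f -> (\forall w \ae P, f w = g w) -> fm t g.
Proof.
move=> t0 /(fmP _ t0) ft fg; apply/fmP => // B mB.
have -> : g @^-1` B = (f @^-1` B `&` [set w | f w = g w]) `|`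
    (g @^-1` B `&` ~` [set w | f w = g w]).
  apply/seteqP; split => [w Bw|w [[/= Bw <-//]|[]//]].
  by have [e|e] := pselect (f w = g w); [left|right]; rewrite /= ?e.
apply: F_setU => //.
  apply: F_setI => //; first exact: ft.
  by rewrite -[X in F t X]setCK; apply: F_setC => //; exact: F_negligible.
by apply: F_negligible => //; apply: negligibleS fg; exact: subIsetr.
Qed.

Let weight_ext01 s (xi Z : Omega -> R) c : 0 <= s -> ig Z ->
  (forall A, F s A -> \int[P]_(w in A) Z w = 0) ->
  fm s xi -> (forall w, 0 <= xi w <= c) -> \int[P]_w (xi w * Z w) = 0.
Proof.
move=> s0 iZ hZ sxi xic.
have bxi : fb s xi.
  by split => //; exists c => w; have /andP[? ?] := xic w; rewrite ger0_norm.
have c0 : 0 <= c by have /andP[x0] := xic point; apply: le_trans.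
(* Level-set approximation of [xi] at mesh 1 / (n + 1). The number of levels reaches past (n + 1) c,
   so the error is at most the mesh everywhere. *)
pose a n w := n.+1%:R^-1 *
  \sum_(k < n.+1 * (Num.truncn c).+1) (\1_[set w | k.+1%:R <= n.+1%:R * xi w] w : R).
have Fk (n k : nat) : F s [set w | (k.+1%:R <= n.+1%:R * xi w)%R].
  have -> : [set w | (k.+1%:R <= n.+1%:R * xi w)%R] =
      xi @^-1` `[n.+1%:R^-1 * k.+1%:R, +oo[.
    by apply/seteqP; split => w /=; rewrite in_itv /= andbT ler_pdivrMl.
  by move/(fmP _ s0): sxi; apply.
have ba n : bm (a n).
  apply: bmM; first exact: bm_cst.
  by apply: bm_sum => k; apply: bm_indic; apply: F_measurable (Fk n k).
have da n w : `|xi w - a n w| <= n.+1%:R^-1.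
  have /andP[x0 xc] := xic w.
  have -> : xi w - a n w = n.+1%:R^-1 * (n.+1%:R * xi w -
     \sum_(k < n.+1 * (Num.truncn c).+1) (k.+1%:R <= n.+1%:R * xi w)%R%:R).
    rewrite mulrBr mulKf ?pnatr_eq0//; congr (_ - _ * _).
    by apply: eq_bigr => k _; rewrite indicE; congr ((nat_of_bool _)%:R); apply/idP/idP; rewrite inE.
  rewrite normrM ger0_norm ?invr_ge0// ler_piMr ?invr_ge0//.
  rewrite ler_norml; apply/andP; split.
    rewrite (le_trans (lerN10 _))// subr_ge0; apply: sum_indic_le.
    by rewrite mulr_ge0.
  rewrite lerBlDr addrC; apply: sum_indic_ge.
  rewrite natrM ler_pM2l// (le_trans xc)// ltW// truncnS_gt//.
have a0 n : \int[P]_w (a n w * Z w) = 0.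
  under eq_Rintegral do rewrite -mulrA mulr_suml.
  rewrite RintegralZl//; last first.
    apply: ig_sum => k; apply: bm_igM => //; apply: bm_indic.
    exact: F_measurable (Fk n k).
  rewrite ig_int_sum; last first.
    by move=> k; apply: bm_igM => //; apply: bm_indic; exact: F_measurable (Fk n k).
  rewrite big1 ?mulr0// => k _.
  by rewrite -int_indicM ?hZ//; exact: F_measurable (Fk n k).
have iZa := ig_abs iZ.
have le n : `|\int[P]_w (xi w * Z w)| <= n.+1%:R^-1 * \int[P]_w `|Z w|.
  have -> : \int[P]_w (xi w * Z w) = \int[P]_w ((xi w - a n w) * Z w).
    under [RHS]eq_Rintegral do rewrite mulrBl.
    rewrite RintegralB ?a0 ?subr0//; apply: bm_igM => //; exact: fb_bm bxi.
  have ixa : ig (fun w => (xi w - a n w) * Z w).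
    by apply: bm_igM => //; apply: bmB => //; exact: fb_bm bxi.
  apply: (le_trans (le_normr_Rintegral _ ixa)) => //.
  rewrite -RintegralZl//; apply: le_Rintegral => //.
  - exact: ig_abs ixa.
  - by apply: (bm_igM (bm_cst _)).
  - by move=> w _; rewrite normrM ler_wpM2r.
apply/eqP; rewrite -normr_eq0 eq_le normr_ge0 andbT.
apply/ler_addgt0Pr => e e0; rewrite add0r.
set I := \int[P]_w `|Z w| in le.
have I0 : 0 <= I by exact: Rintegral_ge0.
apply: (le_trans (le (Num.truncn (I / e)))).
rewrite ler_pdivrMl// mulrC -ler_pdivrMl// mulrC ltW// truncnS_gt//.
Qed.

(** Martingales are defined through events; this passes from events of [F s] to bounded
    [F s]-measurable weights, such as Laplace functionals of the past. *)
Lemma weight_ext s (xi Z : Omega -> R) : 0 <= s -> ig Z ->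
  (forall A, F s A -> \int[P]_(w in A) Z w = 0) ->
  fb s xi -> \int[P]_w (xi w * Z w) = 0.
Proof.
move=> s0 iZ hZ bxi; have [c c0 xc] := bm_bound bxi.
(* A constant shift makes the weight nonnegative and costs nothing, since [Z] itself has mean
   zero. *)
have e1 : \int[P]_w ((xi w + c) * Z w) = 0.
  apply: (@weight_ext01 s _ _ (c + c)) => //.
    by apply: bm_measurable; apply: bmD => //; exact: bm_cst.
  by move=> w; have := xc w; rewrite ler_norml => /andP[? ?]; apply/andP; split; lra.
have e2 : \int[P]_w (c * Z w) = 0.
  rewrite RintegralZl// hZ ?mulr0//.
  by rewrite -(FE s0); exact: measurableT.
rewrite -[RHS](subr0 0) -{1}e1 -e2 -RintegralB//.
- by apply: eq_Rintegral => w _; ring.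
- by apply: bm_igM => //; apply: bmD; [exact: fb_bm bxi|exact: bm_cst].
- by apply: bm_igM => //; exact: bm_cst.
Qed.

End filtered.

(** Sequential continuity on the half line, the form consumed by dominated convergence. *)
Definition cpath (R : realType) (y : R -> R) : Prop :=
  forall (u_ : R^nat) (u : R), (forall n, 0 <= u_ n) ->
    u_ @ \oo --> u -> y (u_ n) @[n --> \oo] --> y u.

Lemma cpath_within (R : realType) (y : R -> R) :
  {within `[0, +oo[, continuous y} -> cpath y.
Proof.
move=> /subspace_continuousP yc u_ u u0 uu.
have u0' : 0 <= u.
  have := @closed_cvg _ _ \oo _ u_ _ (@closed_ge R 0).
  by apply => //; exact: nearW.
apply: cvg_trans (yc u _); last by rewrite /= in_itv /= u0'.
apply: (@cvg_app _ _ (u_ @ \oo) (within `[0, +oo[%classic (nbhs u)) y); move=> A [e /= e0 eA].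
suff : \forall n \near \oo, A (u_ n) by [].
near=> n; apply: eA; last by rewrite /= in_itv /= u0.
by near: n; exact: (cvgrPdist_lt _ _).1 uu _ e0.
Unshelve. all: by end_near. Qed.

(** * Optional stopping at an optional time *)

Section stopping.
Context {dO : measure_display} {Omega : measurableType dO} {R : realType}.
Variables (P : probability Omega R) (F : R -> set (set Omega)).
Hypothesis hF : complete_filtration P F.
Variable rho : Omega -> R.
Hypothesis rho0 : forall w, 0 <= rho w.
Hypothesis rhoF : forall t, 0 <= t -> F t [set w | rho w < t].

(** Approximation of [Num.min t (rho w)] from above on a grid of mesh t / (n + 1). When rho < t it
    is the first node strictly after rho, so knowing {rho < u} in [F u] is enough to decide at a
    node that the node has been selected. *)
Definition kappa (t : R) (n : nat) (w : Omega) : R :=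
  if t <= rho w then t
  else (Num.truncn (rho w * n.+1%:R / t)).+1%:R * t / n.+1%:R.

Definition stop (Y : R -> Omega -> R) : R -> Omega -> R :=
  fun t w => Y (Num.min t (rho w)) w.

Let node (t : R) (n : nat) (j : nat) : R := j%:R * t / n.+1%:R.

Let D t n (j : nat) : set Omega :=
  [set w | node t n j <= rho w < node t n j.+1].

Let node_ge0 t n j : 0 <= t -> 0 <= node t n j.
Proof. by move=> t0; rewrite /node divr_ge0// mulr_ge0. Qed.

Let node_le t n j : 0 <= t -> (j <= n.+1)%N -> node t n j <= t.
Proof.
by move=> t0 jn; rewrite /node ler_pdivrMr// mulrC ler_wpM2l// ler_nat.
Qed.

Let DF t n j u : 0 <= t -> node t n j.+1 <= u -> F u (D t n j).
Proof.
move=> t0 ju.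
have -> : D t n j = ~` [set w | rho w < node t n j] `&` [set w | rho w < node t n j.+1].
  apply/seteqP; split => w /=; rewrite /D /=.
    by move=> /andP[a b]; split => //; apply/negP; rewrite -leNgt.
  by move=> [/negP]; rewrite -leNgt => -> ->.
have u0 : 0 <= u by exact: le_trans (node_ge0 _ _ t0) ju.
have nn : node t n j <= node t n j.+1.
  by rewrite /node ler_pM2r ?invr_gt0// ler_wpM2r// ler_nat.
apply: (F_setI hF) => //; first apply: (F_setC hF) => //.
  apply: (filtration_nondecreasing hF (node_ge0 n j t0)); first exact: le_trans ju.
  exact/rhoF/node_ge0.
apply: (filtration_nondecreasing hF (node_ge0 n j.+1 t0)) => //.
exact/rhoF/node_ge0.
Qed.

Let kappa_node t n w : 0 < t -> rho w < t ->
  exists2 j, (j < n.+1)%N & [/\ D t n j w & kappa t n w = node t n j.+1].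
Proof.
move=> t0 rt; exists (Num.truncn (rho w * n.+1%:R / t)).
  have y0 : 0 <= rho w * n.+1%:R / t by rewrite divr_ge0// ?mulr_ge0// ltW.
  rewrite -(@ltr_nat R); have /andP[+ _] := truncn_itv y0.
  move=> /le_lt_trans; apply.
  by rewrite ltr_pdivrMr// mulrC ltr_pM2l// ltr0n.
split; last by rewrite /kappa leNgt rt.
have y0 : 0 <= rho w * n.+1%:R / t by rewrite divr_ge0// ?mulr_ge0// ltW.
have /andP[ge lt] := truncn_itv y0.
rewrite /D /= /node ler_pdivrMr// ltr_pdivlMr//.
by rewrite -ler_pdivlMr// -ltr_pdivrMr// ge.
Qed.

Lemma kappa_itv t n w : 0 < t -> 0 <= kappa t n w <= t.
Proof.
move=> t0; have [tr|rt] := leP t (rho w).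
  by rewrite /kappa tr lexx ltW.
have [j jn [_ ->]] := kappa_node n t0 rt.
by rewrite node_ge0 ?node_le// ltW.
Qed.

Lemma kappa_dist t n w : 0 < t ->
  `|kappa t n w - Num.min t (rho w)| <= t / n.+1%:R.
Proof.
move=> t0; have [tr|rt] := leP t (rho w).
  by rewrite /kappa tr subrr normr0 divr_ge0// ltW.
have [j jn [/andP[ge lt] ->]] := kappa_node n t0 rt.
have e : node t n j.+1 = node t n j + t / n.+1%:R.
  by rewrite /node -natr1; ring.
rewrite ger0_norm; last by rewrite subr_ge0 ltW.
by rewrite lerBlDl e lerD2r.
Qed.

Lemma cvg_kappa t w : 0 < t ->
  kappa t n w @[n --> \oo] --> Num.min t (rho w).
Proof.
move=> t0; apply/cvgrPdist_le => e e0.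
near=> n; rewrite distrC (le_trans (kappa_dist _ _ t0))//.
rewrite ler_pdivrMr// -ler_pdivrMl//.
apply: (@le_trans _ _ n%:R); last by rewrite ler_nat.
near: n; exact: nbhs_infty_ger.
Unshelve. all: by end_near. Qed.

Let kappa_sum t n w (h : R -> R) : 0 < t ->
  h (kappa t n w) = \sum_(j < n.+1) \1_(D t n j) w * h (node t n j.+1)
     + \1_(~` [set w | rho w < t]) w * h t.
Proof.
move=> t0; have [tr|rt] := leP t (rho w).
  rewrite /kappa tr big1 ?add0r; last first.
    move=> j _; rewrite indicE memNset ?mul0r// => /andP[_].
    by apply/negP; rewrite -leNgt (le_trans _ tr)// node_le// ltW.
  by rewrite indicE mem_set ?mul1r//=; apply/negP; rewrite -leNgt.
have [j jn [Dj ->]] := kappa_node n t0 rt.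
rewrite (bigD1 (Ordinal jn))//= [X in _ + X + _]big1 ?addr0; last first.
  move=> i ij; rewrite indicE memNset ?mul0r//.
  move: Dj; rewrite /D /= => /andP[a b] /andP[c d]; move/eqP: ij; apply.
  apply/val_inj => /=; apply/eqP; rewrite eqn_leq.
  have H (k l : nat) : node t n k <= rho w -> rho w < node t n l.+1 -> (k <= l)%N.
    move=> kr rl; have := le_lt_trans kr rl.
    by rewrite /node ltr_pM2r ?invr_gt0// ltr_pM2r// ltr_nat.
  by rewrite !H.
by rewrite !indicE (mem_set Dj) memNset/= ?mul1r ?mul0r ?addr0//; exact.
Qed.

Let kappa_fm t n Y : 0 < t -> adapted F Y -> fm F t (fun w => Y (kappa t n w) w).
Proof.
move=> t0 aY; have t0' := ltW t0.
under eq_fun do rewrite (kappa_sum n _ (Y ^~ _) t0).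
apply: measurable_funD.
  apply: measurable_sum => j; apply: measurable_funM.
    apply/measurable_indicP; rewrite (FE hF)//; apply: DF => //.
    exact: node_le.
  apply: (@fm_mono _ _ _ _ _ hF (node t n j.+1)); rewrite ?node_ge0 ?node_le//.
  by apply/(fmP hF); rewrite ?node_ge0//; apply: aY; exact: node_ge0.
apply: measurable_funM.
  by apply/measurable_indicP; rewrite (FE hF)//; apply: (F_setC hF) => //; exact: rhoF.
by apply/(fmP hF) => //; exact: aY.
Qed.

(** The stopped value is a limit of the values at [kappa], each a finite sum over nodes. The limit
    is taken on the full-measure set of continuous paths, which belongs to [F t] by completeness. *)
Lemma stop_fm t Y : 0 <= t -> adapted F Y ->
  (\forall w \ae P, cpath (Y ^~ w)) -> fm F t (stop Y t).
Proof.
rewrite le_eqVlt => /predU1P[<-|t0] aY cY.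
  have -> : stop Y 0 = Y 0.
    by apply/funext => w; rewrite /stop; congr Y; apply/min_idPl.
  by apply/(fmP hF) => //; exact: aY.
have t0' := ltW t0.
pose O := [set w | cpath (Y ^~ w)].
have FO : F t O.
  by rewrite -(setCK O); apply: (F_setC hF) => //; exact: (F_negligible hF).
apply: (@fm_ae _ _ _ _ _ hF _ (fun w => \1_O w * stop Y t w)) => //; last first.
  by apply: filterS cY => w cYw; rewrite indicE mem_set ?mul1r.
apply: (@measurable_fun_cvg _ (g_sigma_algebraType (F t)) R setT
   (fun n w => \1_O w * Y (kappa t n w) w)).
  move=> n; apply: measurable_funM; last exact: kappa_fm.
  by apply/measurable_indicP; rewrite (FE hF).
move=> w _; have [Ow|Ow] := pselect (O w); last first.
  rewrite indicE memNset// mul0r; under eq_cvg do rewrite mul0r; exact: cvg_cst.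
rewrite indicE mem_set// mul1r; under eq_cvg do rewrite mul1r.
apply: Ow; last exact: cvg_kappa.
by move=> n; have /andP[] := kappa_itv n w t0.
Qed.

(** Optional stopping where only the stopped value at time t is bounded, and only on [G]. The
    increments from [kappa] to t vanish in mean cell by cell; truncating them at |Y| <= B + 1, which
    is decided at the node, gives the dominating function |Y t| + B + 1, and continuity makes the
    truncation inactive in the limit. *)
Lemma optional_stopping Y s t B (G : set Omega) : 0 <= s -> s <= t -> 0 <= B ->
  martingale P F Y -> (\forall w \ae P, cpath (Y ^~ w)) ->
  (\forall w \ae P, G w -> `|stop Y t w| <= B) ->
  F s G -> (forall w, G w -> s <= rho w) ->
  \int[P]_(w in G) stop Y t w = \int[P]_(w in G) Y s w.
Proof.
move=> s0 + B0; rewrite le_eqVlt => /predU1P[<-|st].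
  move=> _ _ _ _ Gs; apply: eq_Rintegral => w /set_mem/Gs sr.
  by rewrite /stop; congr Y; apply/min_idPl.
have t0 : 0 < t by exact: le_lt_trans st.
have t0' := ltW t0.
move=> [aY iY mY] cY YB FG Gs.
have mG := F_measurable hF s0 FG.
have -> : \int[P]_(w in G) Y s w = \int[P]_(w in G) Y t w.
  by rewrite /Rintegral (mY s t s0 (ltW st) G FG).
have afm u : 0 <= u -> fm F u (Y u) by move=> u0; apply/(fmP hF) => //; exact: aY.
have B1 : measurable [set y : R | (`|y| <= B + 1)%R].
  have -> : [set y : R | (`|y| <= B + 1)%R] = (fun y : R => `|y|) @^-1` `]-oo, B + 1].
    by apply/seteqP; split => y /=; rewrite in_itv.
  by rewrite -[X in measurable X]setTI; exact: normr_measurable.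
have igY u : 0 <= u -> P.-integrable setT (EFin \o Y u) by move=> /iY.
pose b u w : R := \1_[set w | (`|Y u w| <= B + 1)%R] w.
pose h w u := \1_G w * (b u w * (Y t w - Y u w)).
have mb u : 0 <= u -> F u [set w | (`|Y u w| <= B + 1)%R].
  by move=> u0; exact: (aY u u0 _ B1).
have hE n w : h w (kappa t n w) =
    \sum_(j < n.+1) \1_(D t n j) w * h w (node t n j.+1).
  rewrite (kappa_sum n w (h w) t0) [in X in _ + X]/h subrr !mulr0 addr0//.
have DjF n (j : 'I_n.+1) : F t (D t n j) by apply: DF => //; exact: node_le.
have ih n (j : 'I_n.+1) : P.-integrable setT
    (EFin \o (fun w => \1_(D t n j) w * h w (node t n j.+1))).
  have u0 := node_ge0 n j.+1 t0'.
  apply: bm_igM; first by apply: bm_indic; exact: (F_measurable hF t0').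
  apply: bm_igM; first exact: bm_indic.
  apply: bm_igM; first by apply: bm_indic; apply: (F_measurable hF u0); exact: mb.
  by apply: ig_B; exact: igY.
have h0 n : \int[P]_w (h w (kappa t n w)) = 0.
  under eq_Rintegral do rewrite hE.
  rewrite ig_int_sum// big1// => j _.
  set u := node t n j.+1.
  have u0 : 0 <= u := node_ge0 n j.+1 t0'.
  have ut : u <= t by exact: node_le.
  (* A cell ending before s does not meet [G], because rho >= s there. *)
  have [us|su] := ltP u s.
    rewrite (_ : (fun w => _) = (fun=> 0)); first by rewrite Rintegral_cst// mul0r.
    apply/funext => w; rewrite /h !indicE.
    have [Gw|Gw] := pselect (G w); last by rewrite (memNset Gw) mul0r mulr0.
    rewrite [w \in D t n j]memNset ?mul0r// => /andP[_ /lt_trans/(_ us)].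
    by apply/negP; rewrite -leNgt Gs.
  pose A := D t n j `&` G `&` [set w | (`|Y u w| <= B + 1)%R].
  have FA : F u A.
    apply: (F_setI hF) => //; last exact: mb.
    apply: (F_setI hF) => //; first exact: DF.
    exact: (filtration_nondecreasing hF s0 su).
  have mA := F_measurable hF u0 FA.
  transitivity (\int[P]_(w in A) (Y t w - Y u w)).
    rewrite [RHS]int_indicM//; apply: eq_Rintegral => w _.
    by rewrite /h /b /A !indicI /= !mulrA.
  rewrite RintegralB//; [|by apply: integrableS (igY t t0')|by apply: integrableS (igY u u0)].
  by rewrite /Rintegral (mY u t u0 ut A FA) subrr.
have sfm := stop_fm t0' aY cY.
have mst := fm_measurable hF t0' sfm.
have mY' u (u0 : 0 <= u) := fm_measurable hF u0 (afm u u0).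
have lim : \int[P]_w (h w (kappa t n w)) @[n --> \oo] -->
    \int[P]_w (\1_G w * (Y t w - stop Y t w)).
  apply: (@int_dominated _ _ _ _ _ _ (fun w => `|Y t w| + (B + 1))).
  - move=> n; under eq_fun do rewrite hE.
    by apply: measurable_sum => j; exact/measurable_EFinP/(measurable_int P).
  - apply: measurable_funM; first exact/measurable_indicP.
    by apply: measurable_funB => //; exact: mY'.
  - apply: filterS2 cY YB => w cYw YBw.
    have [Gw|Gw] := pselect (G w); last first.
      rewrite indicE memNset// mul0r; apply: cvg_near_cst; apply: nearW => n.
      by rewrite /h indicE memNset// mul0r.
    have ck : Y (kappa t n w) w @[n --> \oo] --> stop Y t w.
      apply: cYw; last exact: cvg_kappa.
      by move=> n; have /andP[] := kappa_itv n w t0.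
    apply: cvgM; first exact: cvg_cst.
    rewrite -[X in _ --> X]mul1r.
    apply: cvgM; last by apply: cvgB => //; exact: cvg_cst.
    apply: cvg_near_cst; near=> n.
    rewrite /b indicE mem_set//=.
    rewrite -[Y _ _](subrK (stop Y t w)) (le_trans (ler_normD _ _))// addrC lerD//.
      exact: YBw.
    by near: n; move/cvgr_distC_le : ck; apply.
  - apply: ig_D; first exact/ig_abs/igY.
    exact/bm_integrable/bm_cst.
  - apply: aeW => w n; rewrite /h /b !indicE.
    have [_|_] := boolP (w \in G); rewrite ?mul0r ?mul1r ?normr0 ?addr_ge0 ?addr_ge0//.
    have [/set_mem/= Yk|_] := boolP (w \in _); last first.
      by rewrite mul0r normr0 ?addr_ge0 ?addr_ge0.
    by rewrite mul1r (le_trans (ler_normB _ _))// lerD2l.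
move: lim; under eq_fun do rewrite h0; move=> /cvg_lim; rewrite lim_cst// => /(_ (@Rhausdorff _)) e.
have igs : P.-integrable setT (EFin \o (fun w => \1_G w * stop Y t w)).
  apply: (@ae_bm_integrable _ _ _ _ _ B).
    by apply: measurable_funM => //; exact/measurable_indicP.
  apply: filterS YB => w YBw; rewrite indicE.
  by have [/set_mem/YBw|_] := boolP (w \in G); rewrite ?mul1r// mul0r normr0.
rewrite (@int_indicM _ _ _ P G (stop Y t))// (@int_indicM _ _ _ P G (Y t))//; apply/eqP; rewrite eq_sym -subr_eq0 -RintegralB//.
  by rewrite e; apply/eqP/eq_Rintegral => w _; rewrite mulrBr.
by apply: bm_igM; [exact: bm_indic|exact: igY].
Unshelve. all: by end_near. Qed.

End stopping.

(** Heine's theorem by contradiction: pairs of points at distance 1 / (n + 1) violating the bound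
    would accumulate at a common limit. *)
Lemma cpath_unif (R : realType) (y : R -> R) (T e : R) : cpath y -> 0 < e ->
  exists2 delta, 0 < delta & forall a b, 0 <= a <= T -> 0 <= b <= T ->
    `|a - b| <= delta -> `|y a - y b| <= e.
Proof.
move=> cy e0; apply: contrapT => nH.
have H n : exists ab : R * R, [/\ 0 <= ab.1 <= T, 0 <= ab.2 <= T,
    `|ab.1 - ab.2| <= n.+1%:R^-1 & e < `|y ab.1 - y ab.2|].
  apply: contrapT => nab; apply: nH; exists n.+1%:R^-1; first by rewrite invr_gt0.
  move=> a b aT bT ab; rewrite leNgt; apply/negP => eab.
  by apply: nab; exists (a, b).
have [ab hab] := choice H.
have [|f fi /cvg_ex[l fl]] := @bolzano_weierstrass R (fun n => (ab n).1).
  exists T; split; first by rewrite num_real.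
  move=> M TM n _ /=; have [/andP[a0 aT] _ _ _] := hab n.
  by rewrite ger0_norm// (le_trans aT)// ltW.
have fn n : (n <= f n)%N.
  elim: n => // n ih; apply: leq_ltn_trans ih _.
  by rewrite ltnNge; apply/negP => h; have := fi n.+1 n; rewrite !leEnat h ltnn.
have gl : (ab (f n)).2 @[n --> \oo] --> l.
  rewrite -[l]subr0.
  have -> : (fun n => (ab (f n)).2) =
      (fun n => (ab (f n)).1 - ((ab (f n)).1 - (ab (f n)).2)).
    by apply/funext => n; ring.
  apply: cvgB => //; apply/cvgrPdist_le => d d0; near=> n.
  rewrite sub0r normrN; have [_ _ le _] := hab (f n); apply: le_trans le _.
  rewrite invf_ple ?posrE//; apply: (@le_trans _ _ n%:R); last first.
    by rewrite ler_nat (leq_trans (fn n)).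
  by near: n; exact: nbhs_infty_ger.
have ya : y (ab (f n)).1 @[n --> \oo] --> y l.
  by apply: cy => // n; have [/andP[]] := hab (f n).
have yb : y (ab (f n)).2 @[n --> \oo] --> y l.
  by apply: cy => // n; have [_ /andP[]] := hab (f n).
have h : y (ab (f n)).1 - y (ab (f n)).2 @[n --> \oo] --> (0 : R).
  by rewrite -(subrr (y l)); exact: cvgB.
have [n _ /(_ n (leqnn n))] := (cvgrPdist_lt _ _).1 h _ e0.
rewrite sub0r normrN /=; have [_ _ _ ge] := hab (f n).
by rewrite ltNge (ltW ge).
Unshelve. all: by end_near. Qed.

(** * Second and fourth moments of increments of a bounded continuous martingale *)

Section bounded_martingale.
Context {dO : measure_display} {Omega : measurableType dO} {R : realType}.
Variables (P : probability Omega R) (F : R -> set (set Omega)).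
Hypothesis hF : complete_filtration P F.

(** The martingale property up to T, stated directly for bounded weights from the past. *)
Definition weak_martingale (T : R) (m : R -> Omega -> R) : Prop :=
  forall s t xi, 0 <= s -> s <= t -> t <= T -> fb F s xi ->
    \int[P]_w (xi w * m t w) = \int[P]_w (xi w * m s w).

Variables (T B L : R) (m q : R -> Omega -> R).
Hypothesis m_fb : forall t, 0 <= t -> t <= T -> fb F t (m t).
Hypothesis q_fb : forall t, 0 <= t -> t <= T -> fb F t (q t).
Hypothesis mB : forall t w, 0 <= t -> t <= T -> `|m t w| <= B.
Hypothesis m_mart : weak_martingale T m.
Hypothesis mq_mart : weak_martingale T (fun t w => m t w ^+ 2 - q t w).
Hypothesis q_lip : forall s t w, 0 <= s -> s <= t -> t <= T ->
  q t w - q s w <= L * (t - s).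
Hypothesis L0 : 0 <= L.
Hypothesis m_path : forall w, cpath (m ^~ w).

Local Notation E f := (\int[P]_w f w).

Let mbm t : 0 <= t -> t <= T -> bm (m t).
Proof. by move=> t0 tT; apply: (fb_bm hF t0); exact: m_fb. Qed.

Let qbm t : 0 <= t -> t <= T -> bm (q t).
Proof. by move=> t0 tT; apply: (fb_bm hF t0); exact: q_fb. Qed.

Lemma weak_martingale_incr s t xi : 0 <= s -> s <= t -> t <= T -> fb F s xi ->
  \int[P]_w (xi w * (m t w - m s w)) = 0.
Proof.
move=> s0 st tT bxi; have t0 := le_trans s0 st; have sT := le_trans st tT.
have bxi' := fb_bm hF s0 bxi.
under eq_Rintegral do rewrite mulrBr.
rewrite bm_intB; [|by apply: bmM => //; exact: mbm..].
by rewrite (m_mart s0 st tT bxi) subrr.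
Qed.

Lemma weak_martingale_incr2 s t xi : 0 <= s -> s <= t -> t <= T -> fb F s xi ->
  \int[P]_w (xi w * (m t w - m s w) ^+ 2) =
  \int[P]_w (xi w * (q t w - q s w)).
Proof.
move=> s0 st tT bxi; have t0 := le_trans s0 st; have sT := le_trans st tT.
have bxi' := fb_bm hF s0 bxi.
have bms := mbm s0 sT; have bmt := mbm t0 tT.
have bqs := qbm s0 sT; have bqt := qbm t0 tT.
have e0 := mq_mart s0 st tT bxi.
have e1 : \int[P]_w (xi w * m s w * (m t w - m s w)) = 0.
  by apply: weak_martingale_incr => //; apply: bmM => //; exact: m_fb.
apply/eqP; rewrite -subr_eq0 -bm_intB; last 2 first.
- by apply: bmM => //; apply: bmX; exact: bmB.
- by apply: bmM => //; exact: bmB.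
have -> : 0 = \int[P]_w (xi w * (m t w ^+ 2 - q t w)) -
   \int[P]_w (xi w * (m s w ^+ 2 - q s w)) -
   2 * \int[P]_w (xi w * m s w * (m t w - m s w)).
  by rewrite e0 e1 subrr mulr0 subrr.
have b1 : bm (fun w => xi w * (m t w ^+ 2 - q t w)).
  by apply: bmM => //; apply: bmB => //; exact: bmX.
have b2 : bm (fun w => xi w * (m s w ^+ 2 - q s w)).
  by apply: bmM => //; apply: bmB => //; exact: bmX.
have b3 : bm (fun w => xi w * m s w * (m t w - m s w)).
  by apply: bmM; [exact: bmM|exact: bmB].
rewrite -bm_intB// -bm_intZ// -bm_intB; [|exact: bmB|by apply: bmM => //; exact: bm_cst].
by apply/eqP/eq_Rintegral => w _; ring.
Qed.

Lemma weak_martingale_incr2_le s t xi : 0 <= s -> s <= t -> t <= T ->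
  fb F s xi -> (forall w, 0 <= xi w) ->
  \int[P]_w (xi w * (m t w - m s w) ^+ 2) <= L * (t - s) * \int[P]_w xi w.
Proof.
move=> s0 st tT bxi xi0; have t0 := le_trans s0 st; have sT := le_trans st tT.
have bxi' := fb_bm hF s0 bxi.
rewrite weak_martingale_incr2// -bm_intZ//; apply: bm_le.
- by apply: bmM => //; apply: bmB; exact: qbm.
- by apply: bmM => //; exact: bm_cst.
- by move=> w; rewrite mulrC ler_wpM2r// q_lip.
Qed.

Section fourth_moment.
Variables (s t : R).
Hypotheses (s0 : 0 <= s) (st : s <= t) (tT : t <= T).

Let node n j : R := s + j%:R * ((t - s) / n.+1%:R).
Let eta n : R := (t - s) / n.+1%:R.

Let eta0 n : 0 <= eta n. Proof. by rewrite divr_ge0// subr_ge0. Qed.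

Let node_ge n j : s <= node n j.
Proof. by rewrite /node lerDl mulr_ge0//; exact: eta0. Qed.

Let node_le n j : (j <= n.+1)%N -> node n j <= t.
Proof.
move=> jn; rewrite /node -lerBrDl mulrA ler_pdivrMr// mulrC.
by apply: ler_wpM2l; rewrite ?subr_ge0// ler_nat.
Qed.

Let nodeS n j : node n j.+1 = node n j + eta n.
Proof. by rewrite /node /eta -natr1; ring. Qed.

Let node0 n j : 0 <= node n j. Proof. exact: le_trans (node_ge n j). Qed.
Let nodeT n j : (j <= n.+1)%N -> node n j <= T.
Proof. by move=> jn; apply: le_trans tT; exact: node_le. Qed.

Let dd n j w := m (node n j.+1) w - m (node n j) w.
Let W n j w := \sum_(i < j) dd n i w ^+ 2.

Let B0 : 0 <= B.
Proof. by apply: le_trans (mB point s0 (le_trans st tT)). Qed.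

Let bdd n j : (j < n.+1)%N -> bm (dd n j).
Proof. by move=> jn; apply: bmB; apply: mbm => //; apply: nodeT => //; exact: ltnW. Qed.

Let dd2B n j w : (j < n.+1)%N -> dd n j w ^+ 2 <= 4 * B ^+ 2.
Proof.
move=> jn; have : `|dd n j w| <= 2 * B.
  rewrite (le_trans (ler_normB _ _))// mulr_natl mulr2n lerD// mB//.
    exact: nodeT.
  by apply: nodeT; exact: ltnW.
have := B0.
by rewrite ler_norml => B0' /andP[h1 h2]; nra.
Qed.

Let fdd n j : (j < n.+1)%N -> fb F (node n j.+1) (dd n j).
Proof.
move=> jn; apply: bmB; first by apply: m_fb => //; exact: nodeT.
apply: (@fb_mono _ _ _ _ _ hF (node n j)) => //.
  by rewrite nodeS lerDl.
by apply: m_fb => //; apply: nodeT; exact: ltnW.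
Qed.

Let fW n j : (j <= n.+1)%N -> fb F (node n j) (W n j).
Proof.
elim: j => [|j ih] jn.
  rewrite (_ : W n 0 = fun=> 0); first exact: bm_cst.
  by apply/funext => w; rewrite /W big_ord0.
rewrite (_ : W n j.+1 = fun w => W n j w + dd n j w ^+ 2); last first.
  by apply/funext => w; rewrite /W big_ord_recr.
apply: bmD; last by apply: bmX; exact: fdd.
apply: (@fb_mono _ _ _ _ _ hF (node n j)) => //; last exact/ih/ltnW.
by rewrite nodeS lerDl.
Qed.

Let bW n j : (j <= n.+1)%N -> bm (W n j).
Proof. by move=> jn; apply: (fb_bm hF (node0 n j)); exact: fW. Qed.

Let W0 n j w : 0 <= W n j w.
Proof. by apply: sumr_ge0 => i _; exact: sqr_ge0. Qed.

Let step n j xi : (j < n.+1)%N -> fb F (node n j) xi -> (forall w, 0 <= xi w) ->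
  \int[P]_w (xi w * dd n j w ^+ 2) <= L * eta n * \int[P]_w xi w.
Proof.
move=> jn bxi xi0; have -> : eta n = node n j.+1 - node n j.
  by rewrite nodeS; ring.
apply: weak_martingale_incr2_le => //; last exact: nodeT.
by rewrite nodeS lerDl.
Qed.

Let P1 : fine (P setT) = 1.
Proof. by rewrite probability_setT. Qed.

Let Ed2 n j : (j < n.+1)%N -> \int[P]_w (dd n j w ^+ 2) <= L * eta n.
Proof.
move=> jn; have := @step n j (fun=> 1) jn (bm_cst 1) (fun=> ler01).
rewrite Rintegral_cst// P1 !mulr1.
by under eq_Rintegral do rewrite mul1r.
Qed.

Let neta n j : (j <= n.+1)%N -> j%:R * eta n <= t - s.
Proof.
by move=> jn; have := node_le jn; rewrite /node -lerBrDl.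
Qed.

Let Lam := L * (t - s).

Let Lam0 : 0 <= Lam. Proof. by rewrite mulr_ge0// subr_ge0. Qed.

Let jeta n j : (j <= n.+1)%N -> j%:R * (L * eta n) <= Lam.
Proof. by move=> jn; rewrite mulrCA ler_wpM2l// neta. Qed.

Let EW n j : (j <= n.+1)%N -> \int[P]_w W n j w <= j%:R * (L * eta n).
Proof.
elim: j => [|j ih] jn.
  rewrite mul0r /W; under eq_Rintegral do rewrite big_ord0.
  by rewrite Rintegral_cst// mul0r.
rewrite /W; under eq_Rintegral do rewrite big_ord_recr /=.
rewrite bm_intD; [|exact/bW/ltnW|by apply: bmX; exact: bdd].
by rewrite -natr1 mulrDl mul1r lerD// ?Ed2// ih// ltnW.
Qed.

(** The second moment of the sum of squared increments is bounded independently of the mesh: each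
    new square has conditional mean at most [L * eta n] and is at most 4 B^2. *)
Let EW2 n j : (j <= n.+1)%N ->
  \int[P]_w (W n j w ^+ 2) <= j%:R * (L * eta n) * (2 * Lam + 4 * B ^+ 2).
Proof.
elim: j => [|j ih] jn.
  rewrite !mul0r /W; under eq_Rintegral do rewrite big_ord0 expr0n.
  by rewrite Rintegral_cst// mul0r.
have jn' := ltnW jn.
have b1 : bm (W n j) by exact: bW.
have b2 := bdd jn.
apply: (@le_trans _ _ (\int[P]_w (W n j w ^+ 2 + 2 * (W n j w * dd n j w ^+ 2)
   + 4 * B ^+ 2 * (dd n j w ^+ 2)))).
  apply: bm_le.
  - by apply: bmX; exact: bW.
  - apply: bmD; last by apply: bmM; [exact: bm_cst|exact: bmX].
    apply: bmD; first exact: bmX.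
    by apply: bmM; [exact: bm_cst|apply: bmM => //; exact: bmX].
  move=> w; rewrite /W big_ord_recr /= -/(W n j w).
  have := dd2B w jn; have := sqr_ge0 (dd n j w).
  set x := dd n j w ^+ 2; set y := W n j w => x0 xB.
  have h : x * x <= 4 * B ^+ 2 * x by exact: ler_wpM2r.
  rewrite -/y -subr_ge0; rewrite -subr_ge0 in h; apply: le_trans h _.
  by rewrite le_eqVlt; apply/orP; left; apply/eqP; ring.
rewrite bm_intD; last 2 first.
- apply: bmD; first exact: bmX.
  by apply: bmM; [exact: bm_cst|apply: bmM => //; exact: bmX].
- by apply: bmM; [exact: bm_cst|exact: bmX].
rewrite bm_intD; last 2 first.
- exact: bmX.
- by apply: bmM; [exact: bm_cst|apply: bmM => //; exact: bmX].
rewrite bm_intZ; last by apply: bmM => //; exact: bmX.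
rewrite bm_intZ; last exact: bmX.
have h1 := ih jn'.
have h2 := step jn (fW jn') (W0 n j).
have h3 := Ed2 jn.
have h4 : \int[P]_w W n j w <= Lam by apply: le_trans (EW jn') (jeta jn').
have h5 : L * eta n * \int[P]_w W n j w <= L * eta n * Lam.
  by apply: ler_wpM2l => //; rewrite mulr_ge0.
have h6 : 4 * B ^+ 2 * \int[P]_w (dd n j w ^+ 2) <= 4 * B ^+ 2 * (L * eta n).
  by apply: ler_wpM2l => //; rewrite mulr_ge0// sqr_ge0.
rewrite -natr1; lra.
Qed.

Let C2 := Lam * (2 * Lam + 4 * B ^+ 2).

Let EWn n : \int[P]_w (W n n.+1 w ^+ 2) <= C2.
Proof.
apply: le_trans (EW2 (leqnn _)) _; rewrite ler_wpM2r ?jeta//.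
by apply: addr_ge0; apply: mulr_ge0; rewrite ?sqr_ge0//; exact: Lam0.
Qed.

Let mx n w : R := \big[Num.max/0]_(j < n.+1) (dd n j w ^+ 2).

Let bmx n : bm (mx n).
Proof. by apply: bm_bigmax => j; apply: bmX; exact: bdd. Qed.

Let mx0 n w : 0 <= mx n w.
Proof. exact: bigmax_ge_id. Qed.

Let mx_le n w e : 0 <= e -> (forall j, (j < n.+1)%N -> dd n j w ^+ 2 <= e) ->
  mx n w <= e.
Proof. by move=> e0 h; apply: bigmax_le => // j _; exact: h. Qed.

(** Paths are uniformly continuous on [0, T] and the increments are uniformly bounded, so dominated
    convergence applies. *)
Let mx_cvg : \int[P]_w (mx n w ^+ 2) @[n --> \oo] --> 0.
Proof.
have -> : (0 : R) = \int[P]_w (0 : R) by rewrite Rintegral_cst// mul0r.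
apply: (@bm_dominated _ _ _ _ _ _ ((4 * B ^+ 2) ^+ 2)).
- by move=> n; apply: bm_measurable; exact: bmX.
- move=> w; apply/cvgrPdist_le => e e0.
  (* Capping at 1 gives e1^4 <= e1 <= e. *)
  pose e1 := Num.min 1 e.
  have e10 : 0 < e1 by rewrite lt_min ltr01.
  have [dl dl0 hd] := @cpath_unif _ _ T _ (@m_path w) e10.
  near=> n; rewrite sub0r normrN ger0_norm ?sqr_ge0//.
  have e1e : e1 <= e by rewrite ge_min lexx orbT.
  have e11 : e1 <= 1 by rewrite ge_min lexx.
  apply: (@le_trans _ _ ((e1 ^+ 2) ^+ 2)).
    rewrite ler_pXn2r ?nnegrE ?sqr_ge0//; apply: mx_le; rewrite ?sqr_ge0// => j jn.
    rewrite -real_normK ?num_real// ler_pXn2r ?nnegrE ?(ltW e10)//.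
    apply: hd; rewrite ?node0/= ?nodeT//; first exact: ltnW.
    rewrite nodeS addrAC subrr add0r ger0_norm; last exact: eta0.
    rewrite /eta ler_pdivrMr// -ler_pdivrMl//.
    apply: (@le_trans _ _ n%:R); last by rewrite ler_nat.
    by near: n; exact: nbhs_infty_ger.
  have : e1 ^+ 2 <= e1 by rewrite expr2 ler_piMr// ltW.
  have : 0 <= e1 ^+ 2 by rewrite sqr_ge0.
  move: (e1 ^+ 2) => x x0 xe; rewrite expr2; nra.
- move=> n w; rewrite ger0_norm ?sqr_ge0// ler_pXn2r ?nnegrE ?mulr_ge0 ?sqr_ge0//.
  by apply: mx_le; rewrite ?mulr_ge0 ?sqr_ge0// => j; exact: dd2B.
Unshelve. all: by end_near. Qed.

Let d4 n w : \sum_(j < n.+1) dd n j w ^+ 4 <= mx n w * W n n.+1 w.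
Proof.
rewrite /W mulr_sumr; apply: ler_sum => j _.
rewrite (_ : 4 = 2 + 2)%N// exprD ler_wpM2r ?sqr_ge0//.
exact: (le_bigmax _ (fun j : 'I_n.+1 => dd n j w ^+ 2)).
Qed.

(** The sum of fourth powers is at most [mx] times [W]. Young's inequality with a free parameter l
    separates the bounded factor from the vanishing one. *)
Let Ed4 n l : 0 < l -> \sum_(j < n.+1) \int[P]_w (dd n j w ^+ 4) <=
  l * C2 + l^-1 * \int[P]_w (mx n w ^+ 2).
Proof.
move=> l0; have b4 (j : 'I_n.+1) : bm (fun w => dd n j w ^+ 4) by apply: bmX; exact: bdd.
have bWn : bm (W n n.+1) by exact: bW.
rewrite -bm_int_sum//.
apply: (@le_trans _ _ (\int[P]_w (l * W n n.+1 w ^+ 2 + l^-1 * mx n w ^+ 2))).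
  apply: bm_le; first exact: bm_sum.
    by apply: bmD; apply: bmM; [exact: bm_cst|exact: bmX|exact: bm_cst|exact: bmX].
  move=> w; apply: le_trans (d4 n w) _.
  have := mx0 n w; have := W0 n n.+1 w.
  move: (mx n w) (W n n.+1 w) => x y y0 x0.
  rewrite -subr_ge0.
  have -> : l * y ^+ 2 + l^-1 * x ^+ 2 - x * y =
      l * (y - l^-1 * x / 2) ^+ 2 + 3 / 4 * l^-1 * x ^+ 2.
    by field; rewrite gt_eqF.
  by rewrite addr_ge0// mulr_ge0 ?sqr_ge0 ?mulr_ge0 ?invr_ge0 ?(ltW l0).
rewrite bm_intD; last 2 first.
- by apply: bmM; [exact: bm_cst|exact: bmX].
- by apply: bmM; [exact: bm_cst|exact: bmX].
rewrite !bm_intZ; [|exact: bmX..].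
by rewrite lerD2r ler_wpM2l ?(ltW l0)// EWn.
Qed.

(** Expand the fourth power one increment at a time. The term linear in the new increment has mean
    zero, the quadratic one brings the main contribution, and the fourth powers disappear with the
    mesh. *)
Let D4 n j : (j <= n.+1)%N -> \int[P]_w ((m (node n j) w - m s w) ^+ 4) <=
  j%:R * (8 * (L * eta n) * Lam) + 3 * \sum_(i < j) \int[P]_w (dd n i w ^+ 4).
Proof.
elim: j => [|j ih] jn.
  rewrite /node !mul0r addr0 big_ord0 mulr0 addr0.
  under eq_Rintegral do rewrite subrr expr0n/=.
  by rewrite Rintegral_cst// mul0r.
have jn' := ltnW jn; have u0 := node0 n j; have uT := nodeT jn'.
have fD : fb F (node n j) (fun w => m (node n j) w - m s w).
  apply: bmB; first exact: m_fb.
  apply: (@fb_mono _ _ _ _ _ hF s) => //.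
  by apply: m_fb => //; exact: le_trans uT.
have bD : bm (fun w => m (node n j) w - m s w) by exact: (fb_bm hF u0).
have bd := bdd jn.
have fc c : fb F (node n j) (fun=> c) by exact: bm_cst.
set D := fun w => m (node n j) w - m s w in fD bD *.
have uu : node n j <= node n j.+1 by rewrite nodeS lerDl.
have bA1 : bm (fun w => D w ^+ 4) by exact: bmX.
have bA2 : bm (fun w => 4 * D w ^+ 3 * dd n j w).
  by apply: bmM => //; apply: bmM; [exact: bm_cst|exact: bmX].
have bA3 : bm (fun w => 8 * D w ^+ 2 * dd n j w ^+ 2).
  by apply: bmM; [apply: bmM; [exact: bm_cst|exact: bmX]|exact: bmX].
have bA4 : bm (fun w => 3 * dd n j w ^+ 4).
  by apply: bmM; [exact: bm_cst|exact: bmX].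
apply: (@le_trans _ _ (\int[P]_w (D w ^+ 4 + 4 * D w ^+ 3 * dd n j w +
    8 * D w ^+ 2 * dd n j w ^+ 2 + 3 * dd n j w ^+ 4))).
  apply: bm_le.
  - apply: bmX; apply: bmB; apply: mbm => //; [exact: nodeT|exact: le_trans uT].
  - by do 3 (apply: bmD => //).
  move=> w; have -> : m (node n j.+1) w - m s w = D w + dd n j w.
    by rewrite /D /dd; ring.
  move: (D w) (dd n j w) => x y; rewrite -subr_ge0.
  (* The cross term 4 x y^3 of the expansion is absorbed by raising the coefficients 6 and 1 of the
     binomial formula to 8 and 3; the difference is twice a square. *)
  have -> : x ^+ 4 + 4 * x ^+ 3 * y + 8 * x ^+ 2 * y ^+ 2 + 3 * y ^+ 4 -
    (x + y) ^+ 4 = 2 * (y * (x - y)) ^+ 2 by ring.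
  by rewrite mulr_ge0// sqr_ge0.
rewrite bm_intD//; last by do 2 (apply: bmD => //).
rewrite bm_intD//; last by apply: bmD.
rewrite bm_intD//.
have -> : \int[P]_w (4 * D w ^+ 3 * dd n j w) = 0.
  apply: weak_martingale_incr => //; first exact: nodeT.
  by apply: bmM; [exact: bm_cst|exact: bmX].
have ED2 : \int[P]_w (D w ^+ 2) <= Lam.
  have := @weak_martingale_incr2_le s (node n j) (fun=> 1) s0 (node_ge n j) uT (bm_cst 1) (fun=> ler01).
  rewrite Rintegral_cst// P1 !mulr1; under eq_Rintegral do rewrite mul1r.
  move=> h; apply: le_trans h _; apply: ler_wpM2l => //.
  by rewrite lerD2r node_le.
have h3 : \int[P]_w (8 * D w ^+ 2 * dd n j w ^+ 2) <= 8 * (L * eta n) * Lam.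
  apply: (@le_trans _ _ (L * eta n * \int[P]_w (8 * D w ^+ 2))).
    apply: step => //; first by apply: bmM; [exact: bm_cst|exact: bmX].
    by move=> w; rewrite mulr_ge0// sqr_ge0.
  rewrite bm_intZ; last exact: bmX.
  have := ler_wpM2l (mulr_ge0 (ler0n R 8) (mulr_ge0 L0 (eta0 n))) ED2.
  by apply: le_trans; rewrite le_eqVlt; apply/orP; left; apply/eqP; ring.
rewrite bm_intZ; last exact: bmX.
have ih' : \int[P]_w (D w ^+ 4) <= j%:R * (8 * (L * eta n) * Lam) +
    3 * \sum_(i < j) \int[P]_w (dd n i w ^+ 4) := ih jn'.
have ej : j.+1%:R = j%:R + 1 :> R by rewrite natr1.
rewrite big_ord_recr /= ej.
lra.
Qed.

(** A Burkholder-type bound of order (t - s)^2, which makes the Taylor remainder of one time step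
    summable. It follows from [D4] at the last node as the mesh tends to zero. *)
Lemma fourth_moment :
  \int[P]_w ((m t w - m s w) ^+ 4) <= 8 * (L * (t - s)) ^+ 2.
Proof.
have key n l : 0 < l -> \int[P]_w ((m t w - m s w) ^+ 4) <=
    8 * Lam ^+ 2 + 3 * (l * C2 + l^-1 * \int[P]_w (mx n w ^+ 2)).
  move=> l0; have := D4 (leqnn n.+1).
  have -> : node n n.+1 = t by rewrite /node mulrC divfK// addrC subrK.
  have -> : n.+1%:R * (8 * (L * eta n) * Lam) = 8 * Lam ^+ 2.
    by rewrite /eta /Lam; field.
  by move=> /le_trans; apply; rewrite lerD2l ler_wpM2l// Ed4.
have C20 : 0 <= C2.
  apply: mulr_ge0; first exact: Lam0.
  by apply: addr_ge0; apply: mulr_ge0; rewrite ?sqr_ge0//; exact: Lam0.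
rewrite -/Lam; apply/ler_addgt0Pr => e e0.
(* First l makes l C2 at most e / 6, then the mesh makes the [mx] term at most e / 6; [D4]
   multiplies their sum by 3. *)
pose l := e / (6 * (C2 + 1)).
have l0 : 0 < l by rewrite divr_gt0// mulr_gt0// ltr_wpDl.
have lC : l * C2 <= e / 6.
  rewrite /l mulrAC ler_pdivrMr; last by rewrite mulr_gt0// ltr_wpDl.
  have -> : e / 6 * (6 * (C2 + 1)) = e * C2 + e by field.
  by rewrite lerDl ltW.
have el : 0 < l * (e / 6) by rewrite mulr_gt0// divr_gt0.
have [n _ /(_ n (leqnn n)) /=] := (cvgrPdist_lt _ _).1 mx_cvg _ el.
rewrite sub0r normrN => /(le_lt_trans (ler_norm _)) hn.
apply: (le_trans (key n l l0)); rewrite lerD2l.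
have : l^-1 * \int[P]_w (mx n w ^+ 2) <= e / 6.
  by rewrite ler_pdivrMl// ltW.
lra.
Qed.

End fourth_moment.
End bounded_martingale.

(** * Positive semidefiniteness of the covariance, for point sequences and for measures *)

Lemma noise_covariance_psd (R : realType) (d : nat)
    (g : 'rV[R]_d -> 'rV[R]_d -> R) : noise_covariance g ->
  (forall x y, g x y = g y x) /\
  forall (c : 'rV[R]_d -> R) (s : seq 'rV[R]_d),
    0 <= \sum_(x <- s) \sum_(y <- s) g x y * c x * c y.
Proof.
case=> dO [Om [P [W [gW covW]]]].
(* At time one the covariance of the field is [g] itself, so the quadratic form is the second moment
   of a linear combination of its values. *)
pose V x w := W (1, x) w.
have mV x : measurable_fun setT (V x).
  have h : forall k : 'I_1, [set tx : R * 'rV[R]_d | 0 <= tx.1] (1, x) by move=> _ /=.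
  have [+ _] := gW 1%N (fun=> (1, x)) (fun=> 1) h.
  by under eq_fun do rewrite big_ord1 mul1r.
have EV x y : (\int[P]_w (V x w * V y w)%:E = (g x y)%:E)%E.
  have := @covW 1 1 x y ler01 ler01.
  by rewrite unlock /expectation minxx mulr1.
have iV2 x : P.-integrable setT (EFin \o (fun w => V x w * V x w)).
  apply/integrableP; split; first exact/measurable_EFinP/measurable_funM.
  under eq_integral do rewrite /= ger0_norm -?expr2 ?sqr_ge0// expr2.
  by rewrite EV ltry.
have iV x y : P.-integrable setT (EFin \o (fun w => V x w * V y w)).
  apply: (@le_integrable _ _ _ _ _ measurableT _
    (EFin \o (fun w => V x w * V x w + V y w * V y w))).
  - exact/measurable_EFinP/measurable_funM.
  - move=> w _; rewrite /= lee_fin normrM.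
    rewrite [leRHS]ger0_norm; last by rewrite -!expr2 addr_ge0 ?sqr_ge0.
    rewrite -!expr2 -[V x w ^+ 2]real_normK ?num_real//.
    rewrite -[V y w ^+ 2]real_normK ?num_real//.
    have := normr_ge0 (V x w); have := normr_ge0 (V y w).
    by move: `|V x w| `|V y w| => a b a0 b0; nra.
  - by apply: ig_D.
have gE x y : g x y = \int[P]_w (V x w * V y w) by rewrite /Rintegral EV.
split=> [x y|c s].
  by rewrite !gE; apply: eq_Rintegral => w _; rewrite mulrC.
have -> : \sum_(x <- s) \sum_(y <- s) g x y * c x * c y =
    \int[P]_w (\sum_(x <- s) \sum_(y <- s) c x * c y * (V x w * V y w)).
  have iG x y : P.-integrable setT (EFin \o (fun w => c x * c y * (V x w * V y w))).
    by apply: bm_igM => //; exact: bm_cst.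
  rewrite ig_int_sum; last by move=> x; exact: ig_sum.
  apply: eq_bigr => x _; rewrite ig_int_sum//; apply: eq_bigr => y _.
  by rewrite RintegralZl// gE; ring.
apply: Rintegral_ge0 => w _.
rewrite (_ : \sum_(_ <- _) _ = (\sum_(x <- s) c x * V x w) ^+ 2) ?sqr_ge0//.
rewrite expr2 mulr_suml; apply: eq_bigr => x _.
by rewrite mulr_sumr; apply: eq_bigr => y _; ring.
Qed.

Section psd_integral.
Context {d : measure_display} {T : measurableType d} {R : realType}.
Variables (nu : {finite_measure set T -> \bar R}) (G : T -> T -> R) (C : R).
Hypothesis mG : measurable_fun setT (fun xy : T * T => G xy.1 xy.2).
Hypothesis GC : forall x y, `|G x y| <= C.
Hypothesis Gsym : forall x y, G x y = G y x.

Let M := fine (nu setT).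
Let J v := \int[nu]_u G u v.

Let C0 : 0 <= C. Proof. exact: le_trans (GC point point). Qed.

Let bG v : bm (fun u => G u v).
Proof.
split; last by exists C.
apply: (measurableT_comp (f := fun xy : T * T => G xy.1 xy.2)
   (g := fun u => (u, v))) => //.
Qed.

Lemma bm_int_section : bm J.
Proof.
split; last first.
  by exists (C * M) => v; exact: bm_int_norm_le.
(* Adding the bound [C] makes the kernel nonnegative, so Tonelli gives measurability of its
   sections' integrals. *)
have mf : measurable_fun setT (fun xy : T * T => (G xy.2 xy.1 + C)%:E).
  apply/measurable_EFinP; apply: measurable_funD => //.
  by under eq_fun do rewrite Gsym.
have f0 (xy : T * T) : (0 <= (G xy.2 xy.1 + C)%:E)%E.
  by rewrite lee_fin -lerBlDr sub0r; have := GC xy.2 xy.1; rewrite ler_norml => /andP[].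
have mF : measurable_fun setT (fun v => \int[nu]_u (G u v + C)%:E)%E.
  exact: (@measurable_fun_fubini_tonelli_F _ _ _ _ _ nu _ mf f0).
have -> : J = fun v => fine (\int[nu]_u (G u v + C)%:E)%E - C * M.
  apply/funext => v; rewrite -[fine _]/(\int[nu]_u (G u v + C)).
  rewrite bm_intD//; last exact: bm_cst.
  by rewrite Rintegral_cst// addrK.
apply: measurable_funB => //.
by apply: (measurableT_comp (f := fine)) mF; exact: fine_measurable.
Qed.

Hypothesis psd : forall s : seq T, 0 <= \sum_(x <- s) \sum_(y <- s) G x y.

Let I := \int[nu]_v J v.
Let Delta := \int[nu]_y G y y.
Let S (s : seq T) := \sum_(x <- s) \sum_(y <- s) G x y.

Let bdiag : bm (fun y => G y y).
Proof.
split; last by exists C.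
apply: (measurableT_comp (f := fun xy : T * T => G xy.1 xy.2)
   (g := fun u => (u, u))) => //.
exact: measurable_fun_pair.
Qed.

(* [M^(1-k) * mean s k] is the value of the integral of [M^2 * S] over
   the last [k] points of [s ++ [:: y_1; ..; y_k]]. *)
Let mean (k : nat) (s : seq T) : R :=
  M ^+ 2 * S s + 2 * k%:R * M * (\sum_(x <- s) J x)
  + k%:R * (k%:R - 1) * I + k%:R * M * Delta.

(** Turns one fixed point into an integrated one. By symmetry the new row and column contribute
    equally. *)
Let mean_step k s : \int[nu]_y mean k (y :: s) = M * mean k.+1 s.
Proof.
pose c := M ^+ 2 * S s + 2 * k%:R * M * (\sum_(x <- s) J x)
  + k%:R * (k%:R - 1) * I + k%:R * M * Delta.
have e y : mean k (y :: s) = c + (M ^+ 2 * (2 * (\sum_(x <- s) G y x))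
   + (M ^+ 2 * G y y + 2 * k%:R * M * J y)).
  rewrite /mean /c /S !big_cons.
  have -> : \sum_(j <- s) \sum_(y0 <- (y :: s)) G j y0 =
      \sum_(j <- s) G y j + \sum_(j <- s) \sum_(y0 <- s) G j y0.
    rewrite -big_split/=; apply: eq_bigr => x _; by rewrite big_cons Gsym.
  ring.
have bs : bm (fun y => \sum_(x <- s) G y x) by apply: bm_sum => x; exact: bG.
under eq_Rintegral do rewrite e.
have b1 : bm (fun y => M ^+ 2 * (2 * (\sum_(x <- s) G y x))).
  by apply: bmM; [exact: bm_cst|apply: bmM => //; exact: bm_cst].
have b2 : bm (fun y => M ^+ 2 * G y y) by apply: bmM; [exact: bm_cst|exact: bdiag].
have b3 : bm (fun y => 2 * k%:R * M * J y).
  by apply: bmM; [exact: bm_cst|exact: bm_int_section].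
rewrite bm_intD; [|exact: bm_cst|by apply: bmD => //; exact: bmD].
rewrite Rintegral_cst// bm_intD//; last exact: bmD.
rewrite bm_intD//.
rewrite bm_intZ; last by apply: bmM => //; exact: bm_cst.
rewrite bm_intZ// bm_intZ// bm_intZ; last exact: bm_int_section.
rewrite bm_int_sum; last by move=> x; exact: bG.
rewrite -/Delta -/I -/M /mean /c.
rewrite (eq_bigr J)// -natr1; ring.
Qed.

(** Monte Carlo argument: averaging the nonnegative form over k points sampled from [nu] leaves k (k
    - 1) times the double integral plus k times a bounded diagonal term; dividing by k^2 and letting
    k grow discards the diagonal. Neither continuity of the kernel nor a spectral decomposition
    enters. *)
Lemma psd_integral_ge0 : 0 <= \int[nu]_v \int[nu]_u G u v.
Proof.
rewrite -/I; have M0 : 0 <= M by rewrite fine_ge0.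
(* [mean_step] is used by dividing by the total mass, so the null measure is treated apart. *)
move: M0; rewrite le_eqVlt => /predU1P[M0|M0].
  have [c c0 Jc] := bm_bound bm_int_section.
  have := bm_int_norm_le nu bm_int_section Jc.
  by rewrite -/M -M0 mulr0 normr_le0 => /eqP; rewrite -/I => ->.
have mean0 k s : 0 <= mean k s.
  elim: k s => [|k ih] s.
    by rewrite /mean !(mulr0, mul0r) !addr0 mulr_ge0 ?sqr_ge0// psd.
  rewrite -(pmulr_rge0 _ M0) -mean_step; apply: Rintegral_ge0 => y _; exact: ih.
have DC : Delta <= C * M.
  by apply: bm_int_le_cst => // y; apply: le_trans (GC y y); exact: ler_norm.
rewrite leNgt; apply/negP => I0.
(* With I < 0 this k satisfies (k - 1) (- I) > C M^2 >= M Delta, which makes [mean k [::]]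
   negative. *)
pose k := (Num.truncn (C * M ^+ 2 / - I)).+2.
have := mean0 k [::]; rewrite /mean /S !big_nil !mulr0 !add0r.
apply/negP; rewrite -ltNge.
have k0 : (0 : R) < k%:R by rewrite ltr0n.
rewrite -mulrA -[_ * M * _]mulrA -mulrDr pmulr_rlt0//.
have : C * M ^+ 2 / - I < k%:R - 1.
  by rewrite /k -natr1 addrK; exact: truncnS_gt.
rewrite ltr_pdivrMr ?oppr_gt0//.
have : M * Delta <= C * M ^+ 2.
  by rewrite expr2 mulrA mulrC ler_wpM2r// ltW.
lra.
Qed.

End psd_integral.

(** * Test functions and planar Gaussians *)

Section test_function_algebra.
Context {R : realType} {d : nat}.
Implicit Types f g : 'rV[R]_d -> R.

Lemma Cb_measurable f : Cb f -> measurable_fun setT f.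
Proof.
move=> [cf _]; apply: (@measurability _ _ _ _ setT _ (@RGenOpens.G R)).
  exact: (RGenOpens.measurableE R).
move=> _ [_ [x [y ->]] <-]; rewrite setTI; apply: sub_sigma_algebra.
move: (`]x, y[%classic) (@interval_open R (BRight x) (BLeft y) isT isT).
by apply/continuousP.
Qed.

Lemma Cb_bm f : Cb f -> bm f.
Proof. by move=> Cf; split; [exact: Cb_measurable|case: Cf]. Qed.

Lemma Cb_cst (c : R) : Cb (fun _ : 'rV[R]_d => c).
Proof. by split; [exact: cst_continuous|exists `|c|]. Qed.

Lemma CbB f g : Cb f -> Cb g -> Cb (fun x => f x - g x).
Proof.
move=> [cf [a fa]] [cg [b gb]]; split.
  by move=> x; apply: continuousB; [exact: cf|exact: cg].
by exists (a + b) => x; rewrite (le_trans (ler_normB _ _))// lerD.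
Qed.

Lemma CbM f g : Cb f -> Cb g -> Cb (fun x => f x * g x).
Proof.
move=> [cf [a fa]] [cg [b gb]]; split.
  by move=> x; apply: continuousM; [exact: cf|exact: cg].
by exists (a * b) => x; rewrite normrM ler_pM.
Qed.

Lemma CbD f g : Cb f -> Cb g -> Cb (fun x => f x + g x).
Proof.
move=> [cf [a fa]] [cg [b gb]]; split.
  by move=> x; apply: continuousD; [exact: cf|exact: cg].
by exists (a + b) => x; rewrite (le_trans (ler_normD _ _))// lerD.
Qed.

Lemma Cb_sum (I : Type) (s : seq I) (h : I -> 'rV[R]_d -> R) :
  (forall i, Cb (h i)) -> Cb (fun x => \sum_(i <- s) h i x).
Proof.
move=> Ch; elim: s => [|i s ih].
  by under eq_fun do rewrite big_nil; exact: Cb_cst.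
by under eq_fun do rewrite big_cons; exact: CbD.
Qed.

Lemma partialB i f g : partially_derivable f -> partially_derivable g ->
  partial i (fun x => f x - g x) = fun x => partial i f x - partial i g x.
Proof.
by move=> df dg; apply/funext => x; rewrite /partial; exact: deriveB.
Qed.

Lemma partially_derivableB f g : partially_derivable f ->
  partially_derivable g -> partially_derivable (fun x => f x - g x).
Proof. by move=> df dg i x; exact: derivableB. Qed.

Lemma Cb2B f g : Cb2 f -> Cb2 g -> Cb2 (fun x => f x - g x).
Proof.
move=> [Cf [df pf] ppf] [Cg [dg pg] ppg]; split; first exact: CbB.
  split; first exact: partially_derivableB.
  by move=> i; rewrite partialB//; exact: CbB.
move=> i; have [d1 c1] := ppf i; have [d2 c2] := ppg i.
rewrite partialB//; split; first exact: partially_derivableB.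
by move=> j; rewrite partialB//; exact: CbB.
Qed.

Lemma laplacianB f g x : Cb2 f -> Cb2 g ->
  laplacian (fun x => f x - g x) x = laplacian f x - laplacian g x.
Proof.
move=> [_ [df _] ppf] [_ [dg _] ppg]; rewrite /laplacian -sumrB.
apply: eq_bigr => i _; rewrite partialB//.
by rewrite partialB//; [have [] := ppf i|have [] := ppg i].
Qed.

Lemma Cb_laplacian f : Cb2 f -> Cb (laplacian f).
Proof. by move=> [_ _ pp]; apply: Cb_sum => i; have [] := pp i. Qed.

Lemma partial_cst i (c : R) : partial i (fun _ : 'rV[R]_d => c) = fun=> 0.
Proof. by apply/funext => x; exact: derive_cst. Qed.

Lemma Cb2_cst (c : R) : Cb2 (fun _ : 'rV[R]_d => c).
Proof.
have dc (c' : R) : partially_derivable (fun _ : 'rV[R]_d => c').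
  by move=> i x; exact: derivable_cst.
split; first exact: Cb_cst.
  by split=> // i; rewrite partial_cst; exact: Cb_cst.
by move=> i; rewrite partial_cst; split => // j; rewrite partial_cst; exact: Cb_cst.
Qed.

Lemma laplacian_cst (c : R) x : laplacian (fun _ : 'rV[R]_d => c) x = 0.
Proof. by rewrite /laplacian big1// => i _; rewrite !partial_cst. Qed.

(** Reduces directional derivatives to derivatives of one real variable, where automatic
    differentiation is available. *)
Lemma is_derive_line f (x v : 'rV[R]_d) (l : R) :
  is_derive (0 : R) (1 : R) (fun h => f (h *: v + x)) l -> is_derive x v f l.
Proof.
have e : (fun h : R => h^-1 *: ((f \o shift x) (h *: v) - f x)) =
    (fun h : R => h^-1 *: (((fun h => f (h *: v + x)) \o shift 0) (h *: (1 : R)) -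
      f (0 *: v + x))).
  apply/funext => h /=; rewrite scale0r add0r addr0; congr (_ *: (f (_ *: _ + _) - _)).
  by rewrite /GRing.scale /= mulr1.
move=> [d1 e1]; split; first by rewrite /derivable e.
by rewrite -e1 /derive e.
Qed.

Lemma Cb2_of_derivatives f (f1 : 'I_d -> 'rV[R]_d -> R)
    (f2 : 'I_d -> 'I_d -> 'rV[R]_d -> R) :
  Cb f -> (forall i, Cb (f1 i)) -> (forall i j, Cb (f2 i j)) ->
  (forall i x, is_derive x 'e_i f (f1 i x)) ->
  (forall i j x, is_derive x 'e_j (f1 i) (f2 i j x)) ->
  Cb2 f /\ forall x, laplacian f x = \sum_i f2 i i x.
Proof.
move=> Cf C1 C2 d1 d2.
have e1 i : partial i f = f1 i by apply/funext => x; have [_ <-] := d1 i x.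
have e2 i j : partial j (f1 i) = f2 i j by apply/funext => x; have [_ <-] := d2 i j x.
split; last by move=> x; apply: eq_bigr => i _; rewrite e1 e2.
split => //.
  split; last by move=> i; rewrite e1.
  by move=> i x; have [] := d1 i x.
move=> i; rewrite e1; split; last by move=> j; rewrite e2.
by move=> j x; have [] := d2 i j x.
Qed.

End test_function_algebra.

Section gaussian.
Context {R : realType} {d : nat}.
Variables (i0 i1 : 'I_d) (p : R * R).
Hypothesis i01 : i0 != i1.
Implicit Types (x : 'rV[R]_d) (a A : R).

(** Only two coordinates enter, so the test functions see X through its projection to a plane.
    Dimension two is critical for the quadratic equation, and small planar density already forces
    singularity in all dimensions d >= 2. *)
Definition sqdist x : R := (x 0 i0 - p.1) ^+ 2 + (x 0 i1 - p.2) ^+ 2.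

Definition gauss A a x : R := A * expR (- (a * sqdist x)).

(** Half of the i-th partial derivative of [sqdist]; [k i j] below is in turn the j-th partial
    derivative of [y i]. *)
Let y (i : 'I_d) x : R :=
  (i == i0)%:R * (x 0 i0 - p.1) + (i == i1)%:R * (x 0 i1 - p.2).

Let k (i j : 'I_d) : R :=
  (i == i0)%:R * (j == i0)%:R + (i == i1)%:R * (j == i1)%:R.

Lemma sqdist_ge0 x : 0 <= sqdist x.
Proof. by rewrite addr_ge0 ?sqr_ge0. Qed.

Lemma gauss_ge0 A a x : 0 <= A -> 0 <= gauss A a x.
Proof. by move=> A0; rewrite mulr_ge0 ?expR_ge0. Qed.

Lemma gauss_le A a x : 0 <= A -> 0 <= a -> gauss A a x <= A.
Proof.
move=> A0 a0; rewrite ler_piMr// -expR0 ler_expR oppr_le0.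
by rewrite mulr_ge0// sqdist_ge0.
Qed.

Lemma sqdist_gauss_le A a x : 0 <= A -> 0 < a ->
  sqdist x * gauss A a x <= A / a.
Proof.
move=> A0 a0; rewrite /gauss mulrCA ler_wpM2l//.
rewrite -[leRHS]mulr1 ler_pdivlMl// mulrA -ler_pdivlMr ?expR_gt0// mul1r -expRN opprK.
by apply: le_trans (expR_ge1Dx _); rewrite lerDr.
Qed.

Let coordc (i : 'I_d) (c : R) : continuous (fun x => x 0 i - c).
Proof.
move=> x; apply: continuousB; first exact: coord_continuous.
exact: cst_continuous.
Qed.

Let yc i : continuous (y i).
Proof.
move=> x; rewrite /y; apply: (@continuousD _ _ _ (fun x => (i == i0)%:R * (x 0 i0 - p.1))
   (fun x => (i == i1)%:R * (x 0 i1 - p.2))).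
  by apply: continuousM; [exact: cst_continuous|exact: coordc].
by apply: continuousM; [exact: cst_continuous|exact: coordc].
Qed.

Let gaussc A a : continuous (gauss A a).
Proof.
move=> x; rewrite /gauss; apply: (@continuousM _ _ (fun=> A) (fun x => expR (- (a * sqdist x)))); first exact: cst_continuous.
apply: (@continuous_comp _ _ _ (fun x => - (a * sqdist x)) expR).
  apply: continuousN; apply: continuousM; first exact: cst_continuous.
  apply: continuousD; apply: (@continuous_comp _ _ _ _ (fun z : R => z ^+ 2));
    [exact: coordc|exact: exprn_continuous|exact: coordc|exact: exprn_continuous].
exact: continuous_expR.
Qed.

Let bool01 (b : bool) : (b%:R : R) = 0 \/ (b%:R : R) = 1.
Proof. by case: b; [right|left]. Qed.

Let y_le i x : `|y i x| <= 1 + sqdist x.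
Proof.
rewrite /y /sqdist; have [e|e] := eqVneq i i0.
  rewrite e (negbTE i01) mul1r mul0r addr0.
  have := sqr_ge0 (x 0 i1 - p.2); move: (_ ^+ 2) => v v0.
  move: (x 0 i0 - p.1) => u; rewrite ler_norml; apply/andP; split; nra.
rewrite mul0r add0r; have := sqr_ge0 (x 0 i0 - p.1); move: (_ ^+ 2) => v v0.
move: (x 0 i1 - p.2) => u; case: (i == i1); rewrite ?mul1r ?mul0r ?normr0.
  by rewrite ler_norml; apply/andP; split; nra.
by have := sqr_ge0 u; lra.
Qed.

Let yy_le i j x : `|y i x * y j x| <= 2 * sqdist x.
Proof.
have h l : y l x ^+ 2 <= sqdist x.
  rewrite /y /sqdist; have [->|e] := eqVneq l i0.
    by rewrite (negbTE i01) mul1r mul0r addr0 lerDl sqr_ge0.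
  rewrite mul0r add0r; case: (l == i1); rewrite ?mul1r ?mul0r ?lerDr ?sqr_ge0//.
  by rewrite expr0n addr_ge0 ?sqr_ge0.
have := h i; have := h j; move: (y i x) (y j x) (sqdist x) => u v s hv hu.
by rewrite ler_norml; apply/andP; split; nra.
Qed.

(** Growth linear in [sqdist] is killed by the Gaussian; this covers the prefactors of all first and
    second derivatives. *)
Let bounded_gauss A a (h : 'rV[R]_d -> R) C : 0 < a -> continuous h ->
  (forall x, `|h x| <= C * (1 + sqdist x)) -> Cb (fun x => h x * gauss A a x).
Proof.
move=> a0 hc hC; split.
  by move=> x; apply: continuousM; [exact: hc|exact: gaussc].
exists (`|C| * (`|A| + `|A| / a)) => x.
have ge : `|gauss A a x| = gauss `|A| a x.
  by rewrite /gauss normrM [X in _ * X]ger0_norm ?expR_ge0.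
rewrite normrM ge; apply: (@le_trans _ _ (`|C| * (1 + sqdist x) * gauss `|A| a x)).
  apply: ler_wpM2r; first exact: gauss_ge0.
  apply: le_trans (hC x) _; apply: ler_wpM2r; last exact: ler_norm.
  by rewrite addr_ge0// sqdist_ge0.
rewrite -mulrA ler_wpM2l// mulrDl mul1r lerD//.
  by apply: gauss_le => //; exact: ltW.
exact: sqdist_gauss_le.
Qed.

Lemma gauss_Cb A a : 0 < a -> Cb (gauss A a).
Proof.
move=> a0; have -> : gauss A a = fun x => 1 * gauss A a x.
  by apply/funext => x; rewrite mul1r.
apply: (@bounded_gauss _ _ _ 1) => //; first exact: cst_continuous.
by move=> x; rewrite mul1r normr1 lerDl sqdist_ge0.
Qed.

Let line x i (h : R) (j : 'I_d) : (h *: 'e_i + x) 0 j = x 0 j + h * (i == j)%:R.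
Proof. by rewrite !mxE eqxx /= addrC eq_sym. Qed.

Let gauss1 A a i x : is_derive x 'e_i (gauss A a) (- (2 * a) * y i x * gauss A a x).
Proof.
apply: is_derive_line; rewrite /gauss /sqdist; under eq_fun do rewrite !line.
apply: is_derive_eq; rewrite /y /GRing.scale /= !mul0r !addr0.
ring.
Qed.

Let gauss2 A a i j x :
  is_derive x 'e_j (fun x => - (2 * a) * y i x * gauss A a x)
    ((4 * a ^+ 2 * (y i x * y j x) - 2 * a * k i j) * gauss A a x).
Proof.
apply: is_derive_line; rewrite /gauss /sqdist /y; under eq_fun do rewrite !line.
apply: is_derive_eq; rewrite /k /GRing.scale /= !mul0r !addr0.
ring.
Qed.

Let gaussC A a : 0 < a -> Cb2 (gauss A a) /\
  forall x, laplacian (gauss A a) x =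
    \sum_i ((4 * a ^+ 2 * (y i x * y i x) - 2 * a * k i i) * gauss A a x).
Proof.
move=> a0.
apply: (@Cb2_of_derivatives _ _ _ (fun i x => - (2 * a) * y i x * gauss A a x)
   (fun i j x => (4 * a ^+ 2 * (y i x * y j x) - 2 * a * k i j) * gauss A a x)).
- exact: gauss_Cb.
- move=> i; apply: (@bounded_gauss _ _ _ (2 * a)) => //.
    by move=> x; apply: (@continuousM _ _ (fun=> - (2 * a)) (y i)); [exact: cst_continuous|exact: yc].
  move=> x; have a2 : 0 <= 2 * a by rewrite mulr_ge0// ltW.
  by rewrite normrM normrN (ger0_norm a2); exact: ler_wpM2l.
- move=> i j; apply: (@bounded_gauss _ _ _ (8 * a ^+ 2 + 4 * a)) => //.
    move=> x; apply: (@continuousB _ _ _ (fun x => 4 * a ^+ 2 * (y i x * y j x))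
      (fun=> 2 * a * k i j)); last exact: cst_continuous.
    apply: (@continuousM _ _ (fun=> 4 * a ^+ 2) (fun x => y i x * y j x)).
      exact: cst_continuous.
    by apply: (@continuousM _ _ (y i) (y j)); exact: yc.
  move=> x; rewrite (le_trans (ler_normB _ _))// !normrM.
  have k2 : `|k i j| <= 2.
    have : 0 <= k i j <= 2.
      rewrite /k; case: (i == i0); case: (j == i0); case: (i == i1);
      case: (j == i1); rewrite /= ?(mul1r, mul0r, mulr1, mulr0, addr0, add0r);
      by apply/andP; split; lra.
    by move=> /andP[k0 k2]; rewrite ger0_norm.
  have := yy_le i j x; rewrite normrM => yy.
  rewrite (ger0_norm (ltW a0)) (@ger0_norm _ 4)// (@ger0_norm _ 2)//.
  rewrite -[a * a]expr2.
  have h1 : 4 * a ^+ 2 * (`|y i x| * `|y j x|) <= 4 * a ^+ 2 * (2 * sqdist x).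
    by apply: ler_wpM2l => //; apply: mulr_ge0 => //; exact: sqr_ge0.
  have h2 : 2 * a * `|k i j| <= 2 * a * 2.
    by apply: ler_wpM2l => //; apply: mulr_ge0 => //; exact: ltW.
  have h3 : 0 <= a * sqdist x by apply: mulr_ge0; [exact: ltW|exact: sqdist_ge0].
  have h4 : 0 <= a ^+ 2 * sqdist x by apply: mulr_ge0; [exact: sqr_ge0|exact: sqdist_ge0].
  have := sqr_ge0 a; lra.
- by move=> i x; exact: gauss1.
- by move=> i j x; exact: gauss2.
Qed.

Lemma gauss_Cb2 A a : 0 < a -> Cb2 (gauss A a).
Proof. by move=> a0; have [] := gaussC A a0. Qed.

Lemma laplacian_gauss A a x : 0 < a ->
  laplacian (gauss A a) x = (4 * a ^+ 2 * sqdist x - 4 * a) * gauss A a x.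
Proof.
move=> a0; have [_ ->] := gaussC A a0; rewrite -mulr_suml; congr (_ * _).
rewrite (bigD1 i0)//= (bigD1 i1) 1?eq_sym//= big1 ?addr0.
  have e10 : (i1 == i0) = false by rewrite eq_sym; exact: negbTE.
  by rewrite /y /k !eqxx e10 (negbTE i01) /sqdist /=; ring.
by move=> i /andP[/negbTE e0 /negbTE e1]; rewrite /y /k e0 e1 /=; ring.
Qed.

End gaussian.

Lemma is_derive_MVT (R : realType) (f df : R -> R) (a b : R) : a <= b ->
  (forall x, a <= x <= b -> is_derive x 1 f (df x)) ->
  exists2 x, a <= x <= b & f b - f a = df x * (b - a).
Proof.
move=> ab d.
have [||x] := @MVT_segment R f df a b ab.
- by move=> x; rewrite in_itv/= => /andP[/ltW ax /ltW xb]; apply: d; rewrite ax.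
- apply: derivable_within_continuous => x; rewrite in_itv/= => axb.
  by have [] := d x axb.
by rewrite in_itv/= => axb e; exists x.
Qed.

(** * An explicit supersolution of v' = Lap v / 2 - v^2 / 2 in the plane *)

Section supersolution.
Context {R : realType}.
Variables (c delta T eps : R).
Hypothesis c0 : 0 < c.
Hypotheses (delta0 : 0 < delta) (delta1 : delta < 1).
Hypotheses (eps0 : 0 < eps).
Hypothesis hc : 4 * delta <= c * expR (- (delta * ln T) - 2).

Let kap : R := 1 - delta.
Let k0 : 0 < kap. Proof. by rewrite /kap subr_gt0. Qed.
Let k1 : kap <= 1. Proof. by rewrite /kap gerBl ltW. Qed.

(** This is c s^(-1-delta). The planar heat kernel has delta = 0 here and in [super_rate]; a
    positive delta makes the kernel decay slightly too fast in time but also slightly wider, and the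
    quadratic term repairs the loss near the centre. *)
Definition super_amp (s : R) : R := c * expR (- ((1 + delta) * ln s)).
Definition super_rate (s : R) : R := (1 - delta) / (2 * s).
Definition super (s z : R) : R := super_amp s * expR (- (super_rate s * z)).
(** The Laplacian of the planar Gaussian as a function of the squared distance z, see
    [laplacian_gauss]. *)
Definition super_lap (s z : R) : R :=
  (4 * super_rate s ^+ 2 * z - 4 * super_rate s) * super s z.

Let r : R := eps^-1.
Let r0 : 0 < r. Proof. by rewrite invr_gt0. Qed.

Let super' s z : R := super s z * (- (1 + delta) / s + kap * z / (2 * s ^+ 2)).
Let super_lap' s z : R := super s z *
  ((- (1 + delta) / s + kap * z / (2 * s ^+ 2)) * (kap ^+ 2 * z / s ^+ 2 - 2 * kap / s)
  + (- 2 * kap ^+ 2 * z / s ^+ 3 + 2 * kap / s ^+ 2)).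

Lemma super_rate_gt0 s : 0 < s -> 0 < super_rate s.
Proof. by move=> s0; rewrite divr_gt0// ?mulr_gt0. Qed.

Lemma super_amp_gt0 s : 0 < super_amp s.
Proof. by rewrite mulr_gt0// expR_gt0. Qed.

Lemma super_gt0 s z : 0 < super s z.
Proof. by rewrite mulr_gt0 ?super_amp_gt0// expR_gt0. Qed.

Let rate_is_derive (s : R) : 0 < s -> is_derive s 1 super_rate (- kap / (2 * s ^+ 2)).
Proof.
move=> s0; have sN : s != 0 by rewrite gt_eqF.
have s2 : 2 * s != 0 by rewrite mulf_neq0.
have dv : is_derive s 1 (fun x : R => x^-1) (- s ^- 2 *: (1 : R)).
  exact: (@is_deriveV R id s 1 1 sN).
have -> : super_rate = fun x => kap / 2 * x^-1.
  by apply/funext => x; rewrite /super_rate invfM mulrA.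
by apply: is_derive_eq; rewrite /GRing.scale /= mulr1; field.
Qed.

Let super_is_derive (z s : R) : 0 < s -> is_derive s 1 (super ^~ z) (super' s z).
Proof.
move=> s0; have dl := is_derive1_ln s0; have dr := rate_is_derive s0.
have sN : s != 0 by rewrite gt_eqF.
rewrite /super /super_amp; apply: is_derive_eq.
by rewrite /super' /super /super_amp /GRing.scale /= /kap; field.
Qed.

Let super_lap_is_derive (z s : R) : 0 < s ->
  is_derive s 1 (super_lap ^~ z) (super_lap' s z).
Proof.
move=> s0; have ds := super_is_derive z s0; have dr := rate_is_derive s0.
have sN : s != 0 by rewrite gt_eqF.
rewrite /super_lap; apply: is_derive_eq.
by rewrite /super_lap' /super' /GRing.scale /= /super_rate /kap; field.
Qed.

Let A : R := c * expR (- ((1 + delta) * ln eps)).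
Let alpha : R := kap / (2 * T).
(** Bounds [super] times (1 + z)^2; the weight is needed because the time derivative of the
    Laplacian carries a polynomial of degree two in z. *)
Definition super_bound : R := A * (1 + 2 / alpha) ^+ 2.
Let D : R := super_bound.

Hypothesis epsT : eps <= T.
Let T0 : 0 < T. Proof. exact: lt_le_trans epsT. Qed.

Let super_le s z : eps <= s -> s <= T -> 0 <= z ->
  super s z * (1 + z) ^+ 2 <= D.
Proof.
move=> es sT z0; have s0 : 0 < s := lt_le_trans eps0 es.
have al0 : 0 < alpha by rewrite divr_gt0// mulr_gt0.
have A0 : 0 < A by rewrite mulr_gt0// expR_gt0.
have h1 : super s z <= A * expR (- (alpha * z)).
  apply: ler_pM; rewrite ?expR_ge0 ?(ltW (super_amp_gt0 s))//.
    have d1 : 0 < 1 + delta by rewrite addr_gt0.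
    by rewrite ler_pM2l// ler_expR lerN2 (ler_pM2l d1) ler_ln ?posrE.
  rewrite ler_expR lerN2 ler_wpM2r// /alpha /super_rate -/kap ler_pM2l//.
  by rewrite lef_pV2 ?posrE ?mulr_gt0// ler_pM2l.
have a2 : 0 <= 2 / alpha by rewrite divr_ge0// ltW.
(* The exponential is split into two halves, each absorbing one factor 1 + z. *)
have h2 : (1 + z) * expR (- (alpha / 2 * z)) <= 1 + 2 / alpha.
  rewrite expRN ler_pdivrMr ?expR_gt0//.
  apply: (@le_trans _ _ ((1 + 2 / alpha) * (1 + alpha / 2 * z))); last first.
    by apply: ler_wpM2l (expR_ge1Dx _); rewrite addr_ge0.
  have -> : (1 + 2 / alpha) * (1 + alpha / 2 * z) =
     1 + z + (2 / alpha + alpha / 2 * z) by field; rewrite gt_eqF.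
  by rewrite lerDl; apply: addr_ge0 => //; apply: mulr_ge0 => //; rewrite divr_ge0// ltW.
have h3 : A * expR (- (alpha * z)) * (1 + z) ^+ 2 =
    A * ((1 + z) * expR (- (alpha / 2 * z))) ^+ 2.
  have -> : - (alpha * z) = - (alpha / 2 * z) + - (alpha / 2 * z) by field.
  by rewrite expRD; ring.
apply: le_trans (_ : A * expR (- (alpha * z)) * (1 + z) ^+ 2 <= _).
  by apply: ler_wpM2r h1; exact: sqr_ge0.
rewrite h3 /D /super_bound ler_pM2l// ler_pXn2r ?nnegrE//; last by rewrite addr_ge0.
by apply: mulr_ge0; [rewrite addr_ge0|exact: expR_ge0].
Qed.

Let D0 : 0 <= D.
Proof. by rewrite mulr_ge0 ?sqr_ge0// ltW// mulr_gt0// expR_gt0. Qed.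

Lemma super_bounded s z : eps <= s -> s <= T -> 0 <= z -> super s z <= D.
Proof.
move=> es sT z0; apply: le_trans (super_le es sT z0).
by rewrite ler_peMr ?(ltW (super_gt0 _ _))// expr_ge1// ?lerDl// addr_ge0.
Qed.

Let rs s : eps <= s -> 0 < s^-1 <= r.
Proof.
move=> es; have s0 : 0 < s := lt_le_trans eps0 es.
by rewrite invr_gt0 s0/= lef_pV2 ?posrE.
Qed.

Let norm_le (a b a' b' : R) : 0 <= a <= a' -> 0 <= b <= b' -> `|b - a| <= a' + b'.
Proof.
by move=> /andP[? ?] /andP[? ?]; rewrite ler_norml; apply/andP; split; lra.
Qed.

Let coef1 s z : eps <= s -> 0 <= z ->
  `|- (1 + delta) / s + kap * z / (2 * s ^+ 2)| <= (2 * r + r ^+ 2) * (1 + z).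
Proof.
move=> es z0; have d0 := delta0; have d1 := delta1.
have /andP[u0 ur] := rs es; have s0 : 0 < s := lt_le_trans eps0 es.
have -> : - (1 + delta) / s + kap * z / (2 * s ^+ 2) =
    kap * (z * (s^-1 ^+ 2)) / 2 - (1 + delta) * s^-1 by field; rewrite gt_eqF.
move: {es} (s^-1 : R) u0 ur => u u0 ur.
have u2 : u ^+ 2 <= r ^+ 2 by apply: lerXn2r; rewrite ?nnegrE ?(ltW u0) ?(ltW r0).
have zu : z * u ^+ 2 <= z * r ^+ 2 by exact: ler_wpM2l.
have zu0 : 0 <= z * u ^+ 2 by rewrite mulr_ge0 ?sqr_ge0.
have kzu : kap * (z * u ^+ 2) <= z * u ^+ 2 by rewrite ler_piMl.
have kzu0 : 0 <= kap * (z * u ^+ 2) by rewrite mulr_ge0// ltW.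
have du : (1 + delta) * u <= 2 * r by apply: ler_pM; lra.
have du0 : 0 <= (1 + delta) * u by apply: mulr_ge0; lra.
have rz : 0 <= r * z by rewrite mulr_ge0// ltW.
have r2 := sqr_ge0 r.
apply: le_trans (norm_le (a' := 2 * r) (b' := z * r ^+ 2) _ _) _.
- by apply/andP; split.
- by apply/andP; split; lra.
- lra.
Qed.

Let coef2 s z : eps <= s -> 0 <= z ->
  `|kap ^+ 2 * z / s ^+ 2 - 2 * kap / s| <= (2 * r + r ^+ 2) * (1 + z).
Proof.
move=> es z0; have d0 := delta0; have d1 := delta1.
have /andP[u0 ur] := rs es; have s0 : 0 < s := lt_le_trans eps0 es.
have -> : kap ^+ 2 * z / s ^+ 2 - 2 * kap / s =
    kap ^+ 2 * (z * s^-1 ^+ 2) - 2 * (kap * s^-1) by field; rewrite gt_eqF.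
move: {es} (s^-1 : R) u0 ur => u u0 ur.
have u2 : u ^+ 2 <= r ^+ 2 by apply: lerXn2r; rewrite ?nnegrE ?(ltW u0) ?(ltW r0).
have zu : z * u ^+ 2 <= z * r ^+ 2 by exact: ler_wpM2l.
have zu0 : 0 <= z * u ^+ 2 by rewrite mulr_ge0 ?sqr_ge0.
have kk : kap ^+ 2 <= 1 by rewrite expr_le1// ltW.
have kzu : kap ^+ 2 * (z * u ^+ 2) <= z * u ^+ 2 by rewrite ler_piMl.
have kzu0 : 0 <= kap ^+ 2 * (z * u ^+ 2) by rewrite mulr_ge0 ?sqr_ge0.
have du : kap * u <= u by rewrite ler_piMl// ltW.
have du0 : 0 <= kap * u by apply: mulr_ge0; exact: ltW.
have rz : 0 <= r * z by rewrite mulr_ge0// ltW.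
have r2 := sqr_ge0 r.
apply: le_trans (norm_le (a' := 2 * r) (b' := z * r ^+ 2) _ _) _.
- by apply/andP; split; lra.
- by apply/andP; split; lra.
- lra.
Qed.

Let coef3 s z : eps <= s -> 0 <= z ->
  `|- 2 * kap ^+ 2 * z / s ^+ 3 + 2 * kap / s ^+ 2| <= (2 * r ^+ 3 + 2 * r ^+ 2) * (1 + z).
Proof.
move=> es z0; have d0 := delta0; have d1 := delta1.
have /andP[u0 ur] := rs es; have s0 : 0 < s := lt_le_trans eps0 es.
have -> : - 2 * kap ^+ 2 * z / s ^+ 3 + 2 * kap / s ^+ 2 =
    2 * (kap * s^-1 ^+ 2) - 2 * (kap ^+ 2 * (z * s^-1 ^+ 3)) by field; rewrite gt_eqF.
move: {es} (s^-1 : R) u0 ur => u u0 ur.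
have u2 : u ^+ 2 <= r ^+ 2 by apply: lerXn2r; rewrite ?nnegrE ?(ltW u0) ?(ltW r0).
have u3 : u ^+ 3 <= r ^+ 3 by apply: lerXn2r; rewrite ?nnegrE ?(ltW u0) ?(ltW r0).
have zu : z * u ^+ 3 <= z * r ^+ 3 by exact: ler_wpM2l.
have zu0 : 0 <= z * u ^+ 3 by rewrite mulr_ge0 ?exprn_ge0// ltW.
have kk : kap ^+ 2 <= 1 by rewrite expr_le1// ltW.
have kzu : kap ^+ 2 * (z * u ^+ 3) <= z * u ^+ 3 by rewrite ler_piMl.
have kzu0 : 0 <= kap ^+ 2 * (z * u ^+ 3) by rewrite mulr_ge0 ?sqr_ge0.
have du : kap * u ^+ 2 <= u ^+ 2 by rewrite ler_piMl ?sqr_ge0.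
have du0 : 0 <= kap * u ^+ 2 by rewrite mulr_ge0 ?sqr_ge0// ltW.
have rz : 0 <= r ^+ 2 * z by rewrite mulr_ge0 ?sqr_ge0.
have r2 : 0 <= r ^+ 3 by rewrite exprn_ge0// ltW.
apply: le_trans (norm_le (a' := 2 * (z * r ^+ 3)) (b' := 2 * r ^+ 2) _ _) _.
- by apply/andP; split; lra.
- by apply/andP; split; lra.
- lra.
Qed.

(** A common Lipschitz constant in time for the supersolution and its Laplacian. It blows up as eps
    tends to 0, which is harmless since eps is fixed while the time step tends to 0. *)
Definition super_lipschitz : R :=
  D * ((2 * r + r ^+ 2) ^+ 2 + (2 * r ^+ 3 + 2 * r ^+ 2) + (2 * r + r ^+ 2)).

Let c1 : R := 2 * r + r ^+ 2.
Let c3 : R := 2 * r ^+ 3 + 2 * r ^+ 2.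
Let c10 : 0 <= c1. Proof. by rewrite addr_ge0 ?sqr_ge0// mulr_ge0// ltW. Qed.
Let c30 : 0 <= c3.
Proof. by rewrite addr_ge0// mulr_ge0 ?sqr_ge0// exprn_ge0// ltW. Qed.

Lemma super_lipschitz_ge0 : 0 <= super_lipschitz.
Proof.
rewrite /super_lipschitz -/c1 -/c3; apply: mulr_ge0 => //.
by rewrite addr_ge0// addr_ge0// sqr_ge0.
Qed.

Let amp_le s z (x C : R) : eps <= s -> s <= T -> 0 <= z -> 0 <= C ->
  `|x| <= C * (1 + z) ^+ 2 -> `|super s z * x| <= D * C.
Proof.
move=> es sT z0 C0 xC; rewrite normrM ger0_norm ?(ltW (super_gt0 _ _))//.
apply: (@le_trans _ _ (super s z * (1 + z) ^+ 2 * C)).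
  by rewrite -mulrA [_ ^+ 2 * _]mulrC ler_wpM2l// ltW// super_gt0.
by rewrite ler_wpM2r// super_le.
Qed.

Let one_le (z : R) : 0 <= z -> 1 + z <= (1 + z) ^+ 2.
Proof. by move=> z0; rewrite expr2; nra. Qed.

Let super'_le s z : eps <= s -> s <= T -> 0 <= z -> `|super' s z| <= super_lipschitz.
Proof.
move=> es sT z0; apply: (@le_trans _ _ (D * c1)).
  apply: amp_le => //; apply: le_trans (coef1 es z0) _.
  by rewrite -/c1 ler_wpM2l// one_le.
rewrite /super_lipschitz -/c1 -/c3 ler_wpM2l// lerDr addr_ge0//.
exact: sqr_ge0.
Qed.

Let super_lap'_le s z : eps <= s -> s <= T -> 0 <= z ->
  `|super_lap' s z| <= super_lipschitz.
Proof.
move=> es sT z0; apply: (@le_trans _ _ (D * (c1 ^+ 2 + c3))).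
  apply: amp_le => //; first by rewrite addr_ge0 ?sqr_ge0.
  rewrite (le_trans (ler_normD _ _))// normrM [X in _ <= X]mulrDl; apply: lerD; last first.
    apply: le_trans (coef3 es z0) _; rewrite -/c3 ler_wpM2l// one_le//.
  have -> : c1 ^+ 2 * (1 + z) ^+ 2 = c1 * (1 + z) * (c1 * (1 + z)) by ring.
  by apply: ler_pM => //; [exact: coef1|exact: coef2].
by rewrite /super_lipschitz -/c1 -/c3 ler_wpM2l// lerDl.
Qed.

(** Divided by [super s z / s], the defect is - 2 delta + delta y / 2 + s [super s z] / 2 with y =
    (1 - delta) z / s. For y >= 4 the second term wins. For y < 4 the Gaussian factor is at least
    exp(-2), and the hypothesis [hc] gives s [super s z] >= 4 delta. *)
Let super_ineq s z : eps <= s -> s <= T -> 0 <= z ->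
  super_lap s z / 2 - super s z ^+ 2 / 2 <= super' s z.
Proof.
move=> es sT z0; have s0 : 0 < s := lt_le_trans eps0 es.
have sN : s != 0 by rewrite gt_eqF.
rewrite -subr_ge0.
have -> : super' s z - (super_lap s z / 2 - super s z ^+ 2 / 2) =
    super s z / s * (- (2 * delta) + delta * (kap * z / s) / 2 + s * super s z / 2).
  by rewrite /super' /super_lap /super_rate /kap; field.
rewrite mulr_ge0 ?divr_ge0 ?(ltW (super_gt0 _ _)) ?(ltW s0)//.
have d0 := delta0; have W0 : 0 <= s * super s z by rewrite mulr_ge0 ?(ltW s0)// ltW// super_gt0.
have [y4|y4] := leP 4 (kap * z / s).
  have : delta * 4 <= delta * (kap * z / s) by rewrite ler_wpM2l// ltW.
  lra.
have y0 : 0 <= delta * (kap * z / s).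
  by rewrite mulr_ge0 ?(ltW delta0)// divr_ge0 ?(ltW s0)// mulr_ge0// ltW.
suff : 4 * delta <= s * super s z by lra.
apply: le_trans hc _.
have -> : s * super s z = c * (s * expR (- ((1 + delta) * ln s) - super_rate s * z)).
  by rewrite /super /super_amp expRD; ring.
rewrite ler_pM2l// -{1}(lnK (x := s)) ?posrE// -expRD ler_expR.
have ls : delta * ln s <= delta * ln T by rewrite ler_pM2l// ler_ln ?posrE.
have -> : super_rate s * z = kap * z / s / 2.
  by rewrite /super_rate /kap; field.
lra.
Qed.

Lemma super_lip s s' z : eps <= s -> s <= s' -> s' <= T -> 0 <= z ->
  `|super s' z - super s z| <= super_lipschitz * (s' - s).
Proof.
move=> es ss sT z0.
have [x xss|x /andP[sx xs] ->] := is_derive_MVT (f := super ^~ z) (df := super' ^~ z) ss.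
  by apply: super_is_derive; move: xss => /andP[+ _]; exact/lt_le_trans/(lt_le_trans eps0).
rewrite normrM [X in _ * X]ger0_norm ?subr_ge0// ler_wpM2r ?subr_ge0//.
by apply: super'_le => //; [exact: le_trans sx|exact: le_trans xs sT].
Qed.

Lemma super_lap_lip s s' z : eps <= s -> s <= s' -> s' <= T -> 0 <= z ->
  `|super_lap s' z - super_lap s z| <= super_lipschitz * (s' - s).
Proof.
move=> es ss sT z0.
have [x xss|x /andP[sx xs] ->] := is_derive_MVT (f := super_lap ^~ z) (df := super_lap' ^~ z) ss.
  by apply: super_lap_is_derive; move: xss => /andP[+ _]; exact/lt_le_trans/(lt_le_trans eps0).
rewrite normrM [X in _ * X]ger0_norm ?subr_ge0// ler_wpM2r ?subr_ge0//.
by apply: super_lap'_le => //; [exact: le_trans sx|exact: le_trans xs sT].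
Qed.

(** Finite-increment form used by the time discretisation: the differential inequality at an
    intermediate point is transported to the left end, at an error quadratic in the step. *)
Lemma super_step s s' z : eps <= s -> s <= s' -> s' <= T -> 0 <= z ->
  (s' - s) * (super_lap s z / 2 - super s z ^+ 2 / 2) -
    super_lipschitz * (1 + D) * (s' - s) ^+ 2 <= super s' z - super s z.
Proof.
move=> es ss sT z0; have sT' := le_trans ss sT.
have [x xss|x /andP[sx xs] ->] := is_derive_MVT (f := super ^~ z) (df := super' ^~ z) ss.
  by apply: super_is_derive; move: xss => /andP[+ _]; exact/lt_le_trans/(lt_le_trans eps0).
have ex := le_trans es sx; have xT := le_trans xs sT.
rewrite [X in _ <= X]mulrC.
have -> : (s' - s) * (super_lap s z / 2 - super s z ^+ 2 / 2) -
    super_lipschitz * (1 + D) * (s' - s) ^+ 2 = (s' - s) *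
   (super_lap s z / 2 - super s z ^+ 2 / 2 - super_lipschitz * (1 + D) * (s' - s)) by ring.
rewrite ler_wpM2l ?subr_ge0//; apply: le_trans (super_ineq ex xT z0).
have l0 := super_lipschitz_ge0; have D0' := D0.
have h0 : super_lipschitz * (x - s) <= super_lipschitz * (s' - s).
  by rewrite ler_wpM2l// lerD2r.
have /ler_normlP[h1 _] := super_lap_lip es sx xT z0.
have /ler_normlP[_ h2] := super_lip es sx xT z0.
have b1 := super_bounded es sT' z0; have b2 := super_bounded ex xT z0.
have p1 := super_gt0 s z; have p2 := super_gt0 x z.
have h4 : 0 <= super_lipschitz * (s' - s) by rewrite mulr_ge0// subr_ge0.
have h3 : super x z ^+ 2 - super s z ^+ 2 <= 2 * D * (super_lipschitz * (s' - s)).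
  have -> : super x z ^+ 2 - super s z ^+ 2 = (super x z + super s z) * (super x z - super s z) by ring.
  have [n|p] := leP (super x z - super s z) 0.
    apply: (@le_trans _ _ 0); last by rewrite mulr_ge0// mulr_ge0.
    by rewrite mulr_ge0_le0// addr_ge0// ltW.
  by apply: ler_pM; rewrite ?(ltW p) ?addr_ge0 ?(ltW p1) ?(ltW p2)//; lra.
lra.
Qed.

End supersolution.

(** * Measurability of evaluations, Taylor bounds for the exponential, lower integrals *)

Section MF_measurability.
Context {R : realType} {d : nat}.

Lemma MF_eval_continuous (f : 'rV[R]_d -> R) : Cb f ->
  continuous (fun nu : MF R d => \int[nu]_x f x).
Proof.
move=> Cf.
pose I : eqType := HB.pack {f : 'rV[R]_d -> R | Cb f}
  (gen_eqMixin {f : 'rV[R]_d -> R | Cb f}).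
move=> nu.
apply: (@continuous_comp _ _ _ (@MF_eval R d)
  (@proj I (fun=> R) (exist _ f Cf))).
  exact: (@initial_continuous _ _ (@MF_eval R d)).
exact: (@proj_continuous I (fun=> R) (exist _ f Cf)).
Qed.

Lemma MF_eval_measurable (f : 'rV[R]_d -> R) : Cb f ->
  measurable_fun setT (fun nu : MF R d => \int[nu]_x f x).
Proof.
move=> Cf; apply: (@measurability _ _ _ _ setT _ (@RGenOpens.G R)).
  exact: (RGenOpens.measurableE R).
move=> _ [_ [x [y ->]] <-]; rewrite setTI; apply: sub_sigma_algebra.
move: (`]x, y[%classic) (@interval_open R (BRight x) (BLeft y) isT isT).
by apply/continuousP; exact: MF_eval_continuous.
Qed.

End MF_measurability.

(** The cubic polynomial times exp(x) has derivative - x^3 exp(x) / 6, so it is maximal at 0, where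
    it equals 1. Valid for both signs of z. *)
Lemma expRN_ge (R : realType) (z : R) :
  1 - z + z ^+ 2 / 2 - z ^+ 3 / 6 <= expR (- z).
Proof.
pose g (x : R) := (1 - x + x ^+ 2 / 2 - x ^+ 3 / 6) * expR x.
have dg (x : R) : is_derive x 1 g (- (x ^+ 3 / 6) * expR x).
  by rewrite /g; apply: is_derive_eq; rewrite /GRing.scale /=; field.
suff : g z <= 1 by rewrite /g expRN -ler_pdivlMr ?expR_gt0// mul1r.
have g0 : g 0 = 1 by rewrite /g expR0; field.
rewrite -subr_ge0 -{1}g0.
have [z0|/ltW z0] := leP 0 z.
  have [x /andP[x0 _] e] := is_derive_MVT z0 (fun x _ => dg x).
  rewrite -opprB e subr0 -mulNr mulr_ge0// -mulNr opprK mulr_ge0 ?expR_ge0//.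
  by rewrite divr_ge0// exprn_ge0.
have [x /andP[_ x0] ->] := is_derive_MVT z0 (fun x _ => dg x).
rewrite sub0r mulr_ge0 ?oppr_ge0// mulr_ge0 ?expR_ge0// oppr_ge0.
by rewrite mulr_le0_ge0// exprS mulr_le0_ge0// sqr_ge0.
Qed.

(* Taylor expansion for a small drift [V] and a martingale increment [D] of
   typical size [e], the square root of the time step. *)
Lemma expRN_drift (R : realType) (D V e V0 : R) : 0 < e -> e <= 1 -> 0 <= V0 ->
  `|V| <= V0 * e ^+ 2 ->
  1 - (D + V) + D ^+ 2 / 2 -
    (V0 * (e ^+ 3 + e * D ^+ 2) + e * D ^+ 2 + D ^+ 4 / e + V0 ^+ 3 * e ^+ 3)
  <= expR (- (D + V)).
Proof.
move=> e0 e1 V00 hV; apply: le_trans (expRN_ge _).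
set a := `|D|; set v := `|V| in hV.
have a0 : 0 <= a by exact: normr_ge0.
have v0 : 0 <= v by exact: normr_ge0.
have DV : - (a * v) <= D * V.
  by have := ler_norm (- (D * V)); rewrite normrN normrM -/a -/v; lra.
have D2 : D ^+ 2 = a ^+ 2 by rewrite /a real_normK ?num_real.
have D4 : D ^+ 4 = a ^+ 4 by rewrite (_ : 4 = 2 * 2)%N// !exprM D2.
have z3 : (D + V) ^+ 3 <= (a + v) ^+ 3.
  apply: le_trans (ler_norm _) _; rewrite normrX lerXn2r ?nnegrE ?addr_ge0//.
  exact: ler_normD.
have av3 : (a + v) ^+ 3 <= 4 * (a ^+ 3 + v ^+ 3).
  rewrite -subr_ge0.
  have -> : 4 * (a ^+ 3 + v ^+ 3) - (a + v) ^+ 3 = 3 * ((a + v) * (a - v) ^+ 2) by ring.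
  by rewrite mulr_ge0// mulr_ge0 ?sqr_ge0// addr_ge0.
have v3 : v ^+ 3 <= V0 ^+ 3 * e ^+ 3.
  apply: (@le_trans _ _ ((V0 * e ^+ 2) ^+ 3)).
    by rewrite lerXn2r ?nnegrE// mulr_ge0 ?sqr_ge0.
  rewrite exprMn ler_wpM2l ?exprn_ge0// -exprM.
  by apply: ler_wiXn2l => //; exact: ltW.
have v20 : 0 <= V ^+ 2 by exact: sqr_ge0.
(* Here and for [a3], the arithmetic-geometric inequality at scale e trades odd powers of the
   increment for its second and fourth powers, whose moments are controlled. *)
have ea : a * v <= V0 * (e ^+ 3 + e * a ^+ 2) / 2.
  apply: (@le_trans _ _ (a * (V0 * e ^+ 2))); first exact: ler_wpM2l.
  rewrite -subr_ge0.
  have -> : V0 * (e ^+ 3 + e * a ^+ 2) / 2 - a * (V0 * e ^+ 2) =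
    V0 * e * (e - a) ^+ 2 / 2 by field.
  by rewrite divr_ge0// mulr_ge0 ?sqr_ge0// mulr_ge0// ltW.
have a3 : a ^+ 3 <= (e * a ^+ 2 + a ^+ 4 / e) / 2.
  rewrite -subr_ge0.
  have -> : (e * a ^+ 2 + a ^+ 4 / e) / 2 - a ^+ 3 = a ^+ 2 * (e - a) ^+ 2 / e / 2.
    by field; rewrite gt_eqF.
  by rewrite !divr_ge0 ?(ltW e0)// mulr_ge0 ?sqr_ge0.
have p1 : 0 <= V0 * (e ^+ 3 + e * a ^+ 2).
  by rewrite mulr_ge0// addr_ge0 ?exprn_ge0 ?(ltW e0)// mulr_ge0 ?sqr_ge0// ltW.
have p2 : 0 <= e * a ^+ 2 by rewrite mulr_ge0 ?sqr_ge0// ltW.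
have p3 : 0 <= a ^+ 4 / e by rewrite divr_ge0 ?exprn_ge0 ?(ltW e0).
have p4 : 0 <= V0 ^+ 3 * e ^+ 3 by rewrite mulr_ge0 ?exprn_ge0 ?(ltW e0).
rewrite D4 D2.
have -> : (D + V) ^+ 2 = a ^+ 2 + 2 * (D * V) + V ^+ 2 by rewrite -D2; ring.
lra.
Qed.

Section lower_integral.
Context {d : measure_display} {T : measurableType d} {R : realType}.
Variable mu : {measure set T -> \bar R}.
Local Open Scope ereal_scope.
Import HBNNSimple.

(* No measurability is assumed: for nonnegative functions the library's
   integral is a lower integral, which is what makes these bounds hold. *)
Lemma lower_integral_mono (A B : set T) (f : T -> \bar R) : A `<=` B ->
  (forall x, B x -> 0 <= f x) -> \int[mu]_(x in A) f x <= \int[mu]_(x in B) f x.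
Proof.
move=> AB f0; rewrite !ge0_integralE//; last by move=> x /AB; exact: f0.
apply: le_ereal_sup => _ [h hf <-]; exists h => // x; apply: le_trans (hf x) _.
rewrite !patchE; case: ifPn => [/set_mem/AB Bx|_]; first by rewrite mem_set.
by case: ifPn => // /set_mem; exact: f0.
Qed.

Lemma lower_integral_setU (A B : set T) (f : T -> \bar R) (c : R) :
  measurable A -> measurable B -> A `<=` B -> (0 <= c)%R ->
  (forall x, B x -> 0 <= f x <= c%:E) ->
  \int[mu]_(x in B) f x <= \int[mu]_(x in A) f x + c%:E * mu (B `\` A).
Proof.
move=> mA mB AB c0 fc.
have f0 x : B x -> 0 <= f x by move=> /fc /andP[].
rewrite [leLHS]ge0_integralE//; apply: ge_ereal_sup => _ [h hf <-].
have h0 x : 0 <= (h x)%:E by rewrite lee_fin; exact: fun_ge0.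
have mh (D : set T) : measurable_fun D (EFin \o h).
  by apply/measurable_EFinP; exact: measurable_funTS.
have -> : sintegral mu h = \int[mu]_(x in A) (h x)%:E + \int[mu]_(x in ~` A) (h x)%:E.
  rewrite -ge0_integral_setU//; last first.
  - by apply/disj_setPS; rewrite setICr.
  - exact: measurableC.
  by rewrite setUv integral_nnsfun// patch_setT.
apply: leeD.
  rewrite integral_nnsfun// [leRHS]ge0_integralE; last by move=> x /AB/f0.
  apply: ereal_sup_ubound => /=; rewrite mrestrict.
  exists (proj_nnsfun h mA) => // x; rewrite -(mrestrict h mA) !patchE.
  case: ifPn => [/set_mem Ax|//].
  by apply: le_trans (hf x) _; rewrite patchE mem_set//; exact: AB.
have mBA : measurable (B `\` A) by exact: measurableD.
apply: (@le_trans _ _ (\int[mu]_(x in ~` A) (c%:E * (\1_(B `\` A) x)%:E))).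
  apply: ge0_le_integral => //.
  - exact: measurableC.
  - by apply: measurable_funeM; apply/measurable_EFinP; apply: measurable_funTS; exact/measurable_indicP.
  - move=> x Ax; apply: le_trans (hf x) _; rewrite patchE indicE; case: ifPn => [/set_mem Bx|_].
      rewrite mem_set//= mule1; by have /andP[] := fc x Bx.
    by rewrite mule_ge0// lee_fin.
rewrite ge0_integralZl_EFin//; [|exact: measurableC|]; last first.
  by apply/measurable_EFinP; apply: measurable_funTS; exact/measurable_indicP.
apply: lee_wpmul2l; first by rewrite lee_fin.
rewrite integral_indic//; last exact: measurableC.
rewrite (_ : _ `&` _ = B `\` A)//.
by apply/seteqP; split => x [].
Qed.
End lower_integral.

(** * Stopping local martingales and making paths regular everywhere *)

Lemma cpath_comp (R : realType) (y z : R -> R) : cpath y -> continuous z ->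
  (forall u, 0 <= u -> 0 <= z u) -> cpath (y \o z).
Proof.
move=> cy cz z0 u_ u u0 uu; apply: cy; first by move=> n; exact: z0.
by apply: continuous_cvg => //; exact: cz.
Qed.

Lemma minr_continuous (R : realType) (r : R) : continuous (fun u : R => Num.min u r).
Proof.
move=> u; apply: (@continuous_min R R (fun u => u) (fun=> r) u).
  exact: cvg_id.
exact: cst_continuous.
Qed.

Section stopped_martingales.
Context {dO : measure_display} {Omega : measurableType dO} {R : realType}.
Variables (P : probability Omega R) (F : R -> set (set Omega)).
Hypothesis hF : complete_filtration P F.
Variable rho : Omega -> R.
Hypothesis rho0 : forall w, 0 <= rho w.
Hypothesis rhoF : forall t, 0 <= t -> F t [set w | rho w < t].

Lemma stop_cpath Y w : cpath (Y ^~ w) -> cpath (stop rho Y ^~ w).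
Proof.
move=> cY; apply: (@cpath_comp _ (Y ^~ w) (fun u => Num.min u (rho w))) => //.
  exact: minr_continuous.
by move=> u u0; rewrite le_min u0 rho0.
Qed.

Section local_martingale.
Variables (N : R -> Omega -> R) (B : R).
Hypothesis B0 : 0 <= B.
Hypothesis lN : local_martingale P F N.
Hypothesis cN : \forall w \ae P, cpath (N ^~ w).

(** Optional stopping for each localised martingale, then bounded convergence. The bound is asked at
    all times up to t because localisation moves the evaluation time. *)
Lemma local_optional_stopping s t (G : set Omega) : 0 <= s -> s <= t ->
  (\forall w \ae P, forall u, 0 <= u -> u <= t -> `|stop rho N u w| <= B) ->
  F s G -> (forall w, G w -> s <= rho w) ->
  \int[P]_(w in G) stop rho N t w = \int[P]_(w in G) N s w.
Proof.
move=> s0 st NB FG Gs; have t0 := le_trans s0 st.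
have mG := F_measurable hF s0 FG.
have [aN [tau [sttau _ tauoo mtau]]] := lN.
have tau0 n w : (0 <= tau n w)%E by have [] := sttau n.
(* The localised clock as a real number; it is u itself when tau is infinite. It commutes with
   stopping at rho, see [cmin]. *)
pose fm1 n w u := fine (mine u%:E (tau n w)).
have fm1E n w u : fm1 n w u = u \/ exists2 r, 0 <= r & forall v, fm1 n w v = Num.min v r.
  have := tau0 n w; rewrite /fm1; case: (tau n w) => [r r0||//].
    by right; exists r => // v; rewrite -EFin_min.
  by move=> _; left; rewrite (min_idPl _)// leey.
have fmc n w : continuous (fm1 n w).
  have := tau0 n w; rewrite /fm1; case: (tau n w) => [r r0||//].
    under [X in continuous X]eq_fun do rewrite -EFin_min /=.
    exact: minr_continuous.
  move=> _; have -> : (fun u : R => fine (mine u%:E +oo%E)) = id.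
    by apply/funext => u; rewrite (min_idPl _)// leey.
  by move=> u; exact: cvg_id.
have fm0 n w u : 0 <= u -> 0 <= fm1 n w u <= u.
  move=> u0; have := tau0 n w; rewrite /fm1; case: (tau n w) => [r r0||//].
    by rewrite lee_fin in r0; rewrite -EFin_min /= le_min u0 r0/= ge_min lexx.
  by move=> _; rewrite (min_idPl _) ?leey//= u0 lexx.
have cmin n w u : 0 <= u -> Num.min (fm1 n w u) (rho w) = fm1 n w (Num.min u (rho w)).
  move=> u0; have := tau0 n w; rewrite /fm1; case: (tau n w) => [r r0||//].
    by rewrite -!EFin_min /= minAC.
  by move=> _; rewrite !(min_idPl (leey _)).
have cNn n : \forall w \ae P, cpath (stopped N (tau n) ^~ w).
  apply: filterS cN => w cNw; apply: (@cpath_comp _ (N ^~ w) (fm1 n w)) => //.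
  by move=> u u0; have /andP[] := fm0 n w u u0.
have eqn n : \int[P]_(w in G) stop rho (stopped N (tau n)) t w =
    \int[P]_(w in G) stop rho (stopped N (tau n)) s w.
  have -> : \int[P]_(w in G) stop rho (stopped N (tau n)) s w =
      \int[P]_(w in G) stopped N (tau n) s w.
    apply: eq_Rintegral => w /set_mem/Gs sr.
    by rewrite /stop; congr stopped; apply/min_idPl.
  apply: (optional_stopping hF rho0 rhoF s0 st B0 (mtau n) (cNn n)) => //.
  apply: filterS NB => w NBw _; rewrite /stop /stopped -/(fm1 n w _) -cmin//.
  by have /andP[f0 ft] := fm0 n w t t0; exact: NBw.
have lim u : 0 <= u -> u <= t -> \int[P]_(w in G) stop rho (stopped N (tau n)) u w
     @[n --> \oo] --> \int[P]_(w in G) stop rho N u w.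
  move=> u0 ut.
  rewrite int_indicM//; under eq_cvg do rewrite int_indicM//.
  have mstop M : adapted F M -> (\forall w \ae P, cpath (M ^~ w)) ->
      measurable_fun setT (fun w => \1_G w * stop rho M u w).
    move=> aM cM; apply: measurable_funM; first exact/measurable_indicP.
    exact: (fm_measurable hF u0 (stop_fm hF rho0 rhoF u0 aM cM)).
  have stE n w : stop rho (stopped N (tau n)) u w = N (fm1 n w (Num.min u (rho w))) w.
    by [].
  apply: (@int_dominated _ _ _ _ _ _ (fun=> B)).
  - by move=> n; have [aM _ _] := mtau n; apply: mstop => //; exact: cNn.
  - exact: mstop.
  - apply: filterS tauoo => w /cvgeyPge/(_ u) tw; apply: cvg_near_cst.
    near=> n; rewrite stE /stop; congr (_ * N _ _).
    rewrite /fm1 (min_idPl _)//; apply: (@le_trans _ _ u%:E).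
      by rewrite lee_fin ge_min lexx.
    by near: n.
  - exact/bm_integrable/bm_cst.
  - apply: filterS NB => w NBw n; rewrite indicE; case: (w \in G); rewrite ?mul0r ?normr0 ?mul1r//.
    have /andP[f0 ft] := fm0 n w u u0.
    by rewrite stE -cmin//; apply: NBw => //; exact: le_trans ut.
have := lim t t0 (lexx t); under eq_cvg do rewrite eqn.
move=> /cvg_unique/(_ (lim s s0 st)) => ->//.
apply: eq_Rintegral => w /set_mem/Gs sr.
by rewrite /stop; congr N; apply/min_idPl.
Unshelve. all: by end_near. Qed.

End local_martingale.

Variables (T : R) (O : set Omega).
Hypothesis nO : P.-negligible (~` O).

Let FO t : 0 <= t -> F t O.
Proof.
by move=> t0; rewrite -(setCK O); apply: (F_setC hF) => //; exact: (F_negligible hF).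
Qed.

(** Killing the process off a full-measure set turns almost sure path properties into properties of
    every path; completeness keeps it adapted. *)
Definition stop_on (Y : R -> Omega -> R) : R -> Omega -> R :=
  fun t w => \1_O w * stop rho Y t w.

Lemma stop_onE Y t w : O w -> stop_on Y t w = stop rho Y t w.
Proof. by move=> Ow; rewrite /stop_on indicE mem_set// mul1r. Qed.

Lemma stop_on_out Y t w : ~ O w -> stop_on Y t w = 0.
Proof. by move=> Ow; rewrite /stop_on indicE memNset// mul0r. Qed.

Variables (Y : R -> Omega -> R) (B : R).
Hypothesis B0 : 0 <= B.
Hypothesis aY : adapted F Y.
Hypothesis cY : forall w, O w -> cpath (Y ^~ w).
Hypothesis YB : forall w, O w -> forall t, 0 <= t -> t <= T -> `|stop rho Y t w| <= B.

Lemma stop_on_bound t w : 0 <= t -> t <= T -> `|stop_on Y t w| <= B.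
Proof.
move=> t0 tT; have [Ow|Ow] := pselect (O w); first by rewrite stop_onE// YB.
by rewrite stop_on_out// normr0.
Qed.

Lemma stop_on_fb t : 0 <= t -> t <= T -> fb F t (stop_on Y t).
Proof.
move=> t0 tT; split; last by exists B => w; exact: stop_on_bound.
apply: measurable_funM.
  by apply/measurable_indicP; rewrite (FE hF)//; exact: FO.
apply: (stop_fm hF rho0 rhoF) => //.
by apply: negligibleS nO; apply: subsetC => w; exact: cY.
Qed.

Lemma stop_on_cpath w : cpath (stop_on Y ^~ w).
Proof.
have [Ow|Ow] := pselect (O w).
  have -> : stop_on Y ^~ w = stop rho Y ^~ w by apply/funext => u; exact: stop_onE.
  by apply: stop_cpath; exact: cY.
have -> : stop_on Y ^~ w = fun=> 0 by apply/funext => u; exact: stop_on_out.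
by move=> u_ u _ _; exact: cvg_cst.
Qed.

Lemma stop_on_weak_martingale :
  (forall s t (G : set Omega), 0 <= s -> s <= t -> t <= T -> F s G ->
    (forall w, G w -> s <= rho w) ->
    \int[P]_(w in G) stop rho Y t w = \int[P]_(w in G) Y s w) ->
  weak_martingale P F T (stop_on Y).
Proof.
move=> hY s t xi s0 st tT bxi.
have t0 := le_trans s0 st; have sT := le_trans st tT.
have bt := fb_bm hF t0 (stop_on_fb t0 tT); have bs := fb_bm hF s0 (stop_on_fb s0 sT).
have bxi' := fb_bm hF s0 bxi.
apply/eqP; rewrite -subr_eq0 -bm_intB; [|exact: bmM..].
under eq_Rintegral do rewrite -mulrBr.
apply/eqP; apply: (weight_ext hF s0) => //; first by apply: bm_integrable; exact: bmB.
move=> G FG; have mG := F_measurable hF s0 FG.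
(* If rho < s the stopped increment is zero, so only the part of [G] with s <= rho matters, where
   the stopping theorems apply. *)
pose G1 := G `&` ~` [set w | rho w < s] `&` O.
have FG1 : F s G1.
  apply: (F_setI hF) => //; last exact: FO.
  by apply: (F_setI hF) => //; apply: (F_setC hF) => //; exact: rhoF.
have mG1 := F_measurable hF s0 FG1.
have G1r w : G1 w -> s <= rho w.
  by move=> [[_ /negP +] _]; rewrite -leNgt.
have -> : \int[P]_(w in G) (stop_on Y t w - stop_on Y s w) =
    \int[P]_(w in G1) (stop_on Y t w - stop_on Y s w).
  rewrite [LHS]int_indicM// [RHS]int_indicM//; apply: eq_Rintegral => w _.
  rewrite /G1 !indicI /=; have [Ow|Ow] := pselect (O w); last first.
    by rewrite !stop_on_out// subrr !mulr0.
  have [rs|sr] := pselect (rho w < s).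
    rewrite !stop_onE// /stop (min_idPr _) ?(le_trans (ltW rs) st)//.
    by rewrite (min_idPr (ltW rs)) subrr !mulr0.
  by rewrite [\1_O w]indicE (mem_set Ow) [\1_(~` _) w]indicE mem_set ?mulr1.
rewrite RintegralB//; [|apply: integrableS (bm_integrable P bt) => //|apply: integrableS (bm_integrable P bs) => //].
have e u : \int[P]_(w in G1) stop_on Y u w = \int[P]_(w in G1) stop rho Y u w.
  by apply: eq_Rintegral => w /set_mem[_ Ow]; exact: stop_onE.
rewrite !e (hY s t G1)//; apply/eqP; rewrite subr_eq0; apply/eqP/eq_Rintegral => w /set_mem/G1r sr.
by rewrite /stop; congr Y; apply/esym/min_idPl.
Qed.

End stopped_martingales.

(** * Hitting time of a level by a continuous adapted path *)

Section hitting_time.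
Context {dO : measure_display} {Omega : measurableType dO} {R : realType}.
Variables (P : probability Omega R) (F : R -> set (set Omega)).
Hypothesis hF : complete_filtration P F.
Variables (x : R -> Omega -> R) (K T : R).
Hypothesis ax : adapted F x.
Hypothesis T0 : 0 <= T.

Let hits w : set R :=
  [set ratr q | q in [set q : rat | 0 <= q /\ K < x (ratr q) w]] `|` [set T + 1].

(* The rational times make [hit] an optional time without any path regularity,
   and the extra point [T + 1] makes it finite. *)
Definition hit w : R := inf (hits w).

Let hits_ge0 w : lbound (hits w) 0.
Proof.
move=> _ [[q [q0 _] <-]|->]; first by rewrite ler0q.
by rewrite addr_ge0.
Qed.

Let hits_neq0 w : hits w !=set0. Proof. by exists (T + 1); right. Qed.

Lemma hit_ge0 w : 0 <= hit w.
Proof. by apply: lb_le_inf; [exact: hits_neq0|exact: hits_ge0]. Qed.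

Let hit_le w u : hits w u -> hit w <= u.
Proof. by move=> hu; apply: ge_inf hu; exists 0; exact: hits_ge0. Qed.

Lemma hit_optional t : 0 <= t -> F t [set w | hit w < t].
Proof.
move=> t0.
have -> : [set w | hit w < t] = (\bigcup_(q in [set: rat])
    (if (0 <= q) && (ratr q < t) then [set w | K < x (ratr q) w] else set0)) `|`
    (if T + 1 < t then setT else set0).
  apply/seteqP; split => w /=.
    move=> /(inf_lt (hits_neq0 w))[_ [[q [q0 qK] <-] qt|-> Tt]].
      by left; exists q => //; rewrite q0 qt.
    by right; rewrite Tt.
  case=> [[q _]|].
    case: ifPn => // /andP[q0 qt] qK.
    by apply: le_lt_trans qt; apply: hit_le; left; exists q.
  by case: ifPn => // Tt _; apply: le_lt_trans Tt; apply: hit_le; right.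
apply: (F_setU hF) => //.
  rewrite -(FE hF t0); apply: countable_bigcupT_measurable; first exact: countableP.
  move=> q; case: ifPn => [/andP[q0 qt]|_]; last exact: measurable0.
  rewrite (FE hF t0); apply: (filtration_nondecreasing hF _ (ltW qt)).
    by rewrite ler0q.
  have -> : [set w | K < x (ratr q) w] = x (ratr q) @^-1` `]K, +oo[.
    by apply/seteqP; split => w /=; rewrite in_itv /= andbT.
  by apply: ax; rewrite ?ler0q//; exact: measurable_itv.
rewrite -(FE hF t0); case: ifPn => _; first exact: measurableT.
exact: measurable0.
Qed.

Variable w : Omega.
Hypothesis cx : cpath (x ^~ w).
Hypothesis x0K : x 0 w <= K.

(** Rational times approaching [u] from below come strictly before the hitting time, so the level is
    not exceeded there; continuity carries this to [u]. *)
Lemma hit_path_le u : 0 <= u -> u <= hit w -> x u w <= K.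
Proof.
rewrite le_eqVlt => /predU1P[<-//|u0] uh.
have /choice[q hq] (n : nat) : exists q : rat,
    Num.max 0 (u - n.+1%:R^-1) < ratr q < u.
  have /rat_in_itvoo[q] : Num.max 0 (u - n.+1%:R^-1) < u.
    by rewrite gt_max u0 /= ltrBlDr ltrDl invr_gt0 ltr0n.
  by rewrite in_itv /= => hq; exists q.
have q0 n : 0 <= ratr (q n) :> R.
  by have /andP[+ _] := hq n; rewrite gt_max => /andP[/ltW].
have qu : ratr (q n) @[n --> \oo] --> u.
  apply/cvgrPdist_le => e e0; near=> n.
  have /andP[] := hq n; rewrite gt_max => /andP[_ h1] h2.
  rewrite ger0_norm ?subr_ge0 ?(ltW h2)//.
  apply: (@le_trans _ _ n.+1%:R^-1).
    by rewrite lerBlDr addrC -lerBlDr ltW.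
  rewrite invf_ple ?posrE//; apply: (@le_trans _ _ n%:R); last by rewrite ler_nat.
  by near: n; exact: nbhs_infty_ger.
have xq : x (ratr (q n)) w @[n --> \oo] --> x u w by exact: cx.
apply: (@closed_cvg _ _ \oo _ (fun n => x (ratr (q n)) w) _ (@closed_le R K)) xq.
apply: nearW => n /=; rewrite leNgt; apply/negP => Kx.
have /andP[_ qn] := hq n.
have : hit w <= ratr (q n).
  by apply: hit_le; left; exists (q n) => //; split => //; rewrite -(ler0q R).
by apply/negP; rewrite -ltNge (lt_le_trans qn).
Unshelve. all: by end_near. Qed.

Lemma hit_path_ge : hit w <= T -> K <= x (hit w) w.
Proof.
move=> hT.
(* The cap by 1 excludes the artificial point T + 1, since the hitting time is at most T. *)
have /choice[u hu] (n : nat) : exists u : R,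
    [/\ 0 <= u, K < x u w & hit w <= u < hit w + Num.min 1 (n.+1%:R^-1)].
  have [|_ [[q [q0 qK] <-] qh|-> h]] :=
      @inf_lt _ (hits w) (hit w + Num.min 1 (n.+1%:R^-1)) (hits_neq0 w).
  - by rewrite ltrDl lt_min ltr01 invr_gt0 /= ltr0n.
  - exists (ratr q); split => //; first by rewrite ler0q.
    by rewrite qh andbT; apply: hit_le; left; exists q.
  - have : hit w + Num.min 1 (n.+1%:R^-1) <= T + 1 by rewrite lerD// ge_min lexx.
    by move=> /(lt_le_trans h); rewrite ltxx.
have uh : u n @[n --> \oo] --> hit w.
  apply/cvgrPdist_le => e e0; near=> n.
  have [_ _ /andP[h1 h2]] := hu n.
  rewrite distrC ger0_norm ?subr_ge0// lerBlDl (le_trans (ltW h2))// lerD2l.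
  rewrite ge_min; apply/orP; right.
  rewrite invf_ple ?posrE//; apply: (@le_trans _ _ n%:R); last by rewrite ler_nat.
  by near: n; exact: nbhs_infty_ger.
have xu : x (u n) w @[n --> \oo] --> x (hit w) w.
  by apply: cx => // n; have [] := hu n.
apply: (@closed_cvg _ _ \oo _ (fun n => x (u n) w) _ (@closed_ge R K)) xu.
by apply: nearW => n /=; have [_ /ltW] := hu n.
Unshelve. all: by end_near. Qed.

End hitting_time.

(** * Integrals over time intervals *)

Section time_integral.
Context {R : realType}.
Local Notation mu := (@lebesgue_measure R).
Implicit Types (f g : R -> R).

Lemma itv_measure (a b : R) : a <= b -> mu `]a, b] = (b - a)%:E.
Proof.
rewrite le_eqVlt => /predU1P[->|ab].
  by rewrite set_itv_ge ?bnd_simp// measure0 subrr.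
by rewrite lebesgue_measure_itv /= lte_fin ab.
Qed.

Lemma itvcc_measure_lty (a b : R) : (mu `[a, b] < +oo)%E.
Proof. by rewrite lebesgue_measure_itv /=; case: ifPn => _; rewrite -?EFinB ltry. Qed.

Lemma itvoc_measure_lty (a b : R) : (mu `]a, b] < +oo)%E.
Proof. by rewrite lebesgue_measure_itv /=; case: ifPn => _; rewrite -?EFinB ltry. Qed.

Lemma itv_integrable f (t c : R) : measurable_fun `[(0 : R), +oo[ f ->
  (forall s, 0 <= s <= t -> `|f s| <= c) ->
  mu.-integrable `[0, t] (EFin \o f).
Proof.
move=> mf fc; apply: measurable_bounded_integrable => //.
- exact: itvcc_measure_lty.
- apply: measurable_funS mf => //.
  by move=> s /=; rewrite !in_itv /= => /andP[->].
- exists c; split; first by rewrite num_real.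
  move=> M cM s; rewrite /= in_itv /= => st.
  by rewrite (le_trans (fc _ st))// ltW.
Qed.

Lemma integral_incr f (s t c : R) : measurable_fun `[(0 : R), +oo[ f ->
  (forall u, 0 <= u <= t -> `|f u| <= c) -> 0 <= s -> s <= t ->
  \int[mu]_(u in `[0, t]) f u - \int[mu]_(u in `[0, s]) f u =
  \int[mu]_(u in `]s, t]) f u.
Proof.
move=> mf fc s0 st; apply: Rintegral_itvB; first exact: itv_integrable fc.
- by rewrite bnd_simp.
- by rewrite bnd_simp.
Qed.

Lemma itvoc_integrable f (s t c : R) : measurable_fun `[(0 : R), +oo[ f ->
  (forall u, 0 <= u <= t -> `|f u| <= c) -> 0 <= s ->
  mu.-integrable `]s, t] (EFin \o f).
Proof.
move=> mf fc s0; apply: integrableS (itv_integrable mf fc) => //.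
move=> u /=; rewrite !in_itv /= => /andP[su ->].
by rewrite andbT (le_trans s0)// ltW.
Qed.

Lemma integral_incr_le f g (s t c c' : R) : measurable_fun `[(0 : R), +oo[ f ->
  measurable_fun `[(0 : R), +oo[ g ->
  (forall u, 0 <= u <= t -> `|f u| <= c) ->
  (forall u, 0 <= u <= t -> `|g u| <= c') -> 0 <= s -> s <= t ->
  (forall u, s < u <= t -> f u <= g u) ->
  \int[mu]_(u in `]s, t]) f u <= \int[mu]_(u in `]s, t]) g u.
Proof.
move=> mf mg fc gc s0 st fg.
have if_ := itvoc_integrable mf fc s0; have ig_ := itvoc_integrable mg gc s0.
by apply: le_Rintegral => // u; rewrite /= in_itv /=; exact: fg.
Qed.

Lemma integral_incr_norm f (s t c : R) : measurable_fun `[(0 : R), +oo[ f ->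
  (forall u, 0 <= u <= t -> `|f u| <= c) -> 0 <= s -> s <= t ->
  `|\int[mu]_(u in `]s, t]) f u| <= c * (t - s).
Proof.
move=> mf fc s0 st.
have if_ := itvoc_integrable mf fc s0.
apply: le_trans (le_normr_Rintegral _ if_) _ => //.
have -> : c * (t - s) = \int[mu]_(u in `]s, t]) c.
  rewrite Rintegral_cst//; congr (_ * _).
  by rewrite -[LHS]/(fine (t - s)%:E); congr fine; exact/esym/itv_measure.
apply: le_Rintegral => //.
- exact: integrable_norm.
- apply: measurable_bounded_integrable => //.
    exact: itvoc_measure_lty.
  exists `|c|; split; first by rewrite num_real.
  by move=> M cM u _ /=; exact: ltW.
- by move=> u; rewrite /= in_itv /= => /andP[su ut]; rewrite fc// (le_trans s0 (ltW su)).
Qed.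

(** Free of measurability, for use with the environment term, whose dependence on time enters only
    through its nonnegativity and its bound. *)
Lemma lower_integral_incr f (s t c : R) : 0 <= s -> s <= t -> 0 <= c ->
  (forall u, 0 <= u <= t -> 0 <= f u <= c) ->
  0 <= \int[mu]_(u in `[0, t]) f u - \int[mu]_(u in `[0, s]) f u <= c * (t - s).
Proof.
move=> s0 st c0 fc.
have t0 := le_trans s0 st.
have f0 u : `[0, t]%classic u -> (0 <= (f u)%:E)%E.
  by rewrite /= in_itv /= lee_fin => /fc /andP[].
have sub : `[0, s]%classic `<=` `[0, t]%classic.
  by apply: subset_itvl; rewrite bnd_simp.
have h1 := lower_integral_mono mu sub f0.
have h2 : (\int[mu]_(u in `[0%R, t]) (f u)%:E <=
    \int[mu]_(u in `[0%R, s]) (f u)%:E + c%:E * mu (`[0%R, t] `\` `[0%R, s]))%E.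
  apply: lower_integral_setU => // u; rewrite /= in_itv /= !lee_fin.
have h3 : (`[0, t] `\` `[0, s] = `]s, t])%classic.
  apply/seteqP; split => u /=; rewrite !in_itv /=.
    by move=> [/andP[u0 ->] /negP]; rewrite u0/= -ltNge => ->.
  move=> /andP[su ->]; split; first by rewrite (le_trans s0 (ltW su)).
  by apply/negP; rewrite negb_and -!ltNge su orbT.
have fs u : (0 <= u)%R -> (u <= t)%R -> (\int[mu]_(v in `[0%R, u]) (f v)%:E)%E \is a fin_num.
  move=> u0 ut; rewrite ge0_fin_numE; last first.
    apply: integral_ge0 => v; rewrite /= in_itv /= => /andP[v0 vu].
    by apply: f0; rewrite /= in_itv /= v0 (le_trans vu).
  have := @lower_integral_setU _ _ _ mu set0 `[0%R, u]%classic (EFin \o f) c.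
  rewrite integral_set0 add0e setD0 => h; apply: le_lt_trans (h _ _ _ _ _) _ => //.
    move=> v; rewrite /= in_itv /= !lee_fin => /andP[v0 vu].
    by apply: fc; rewrite v0 (le_trans vu).
  by apply: lte_mul_pinfty; rewrite ?lee_fin//; exact: itvcc_measure_lty.
have mst : mu (`]s, t]%classic) = (t - s)%:E by exact: itv_measure.
rewrite h3 mst in h2.
rewrite /Rintegral; apply/andP; split.
  by rewrite subr_ge0 fine_le// fs.
rewrite lerBlDl -lee_fin fineK ?fs// EFinD fineK ?fs//.
Qed.

End time_integral.

(** * The superprocess stopped when its mass passes K: bounds and martingales *)

Section superprocess_estimates.
Context {dO : measure_display} {Omega : measurableType dO} {R : realType}.
Context {d : nat}.
Variables (P : probability Omega R) (F : R -> set (set Omega)).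
Variables (g : 'rV[R]_d -> 'rV[R]_d -> R) (X : R -> Omega -> MF R d).
Hypothesis hX : superprocess_random_environment P F g X.
Hypothesis mg : measurable_fun setT (fun xy : 'rV[R]_d * 'rV[R]_d => g xy.1 xy.2).
Variable Cg : R.
Hypothesis gC : forall x y, `|g x y| <= Cg.
Hypothesis ncg : noise_covariance g.
Variable mu : MF R d.
Hypothesis hX0 : \forall w \ae P, forall A, measurable A -> X 0 w A = mu A.
Variables K T : R.
Hypothesis muK : fine (mu setT) <= K.
Hypothesis T0 : 0 <= T.

Let hF : complete_filtration P F := superprocess_filtration hX.
Local Notation leb := (@lebesgue_measure R).

Definition Xf (f : 'rV[R]_d -> R) (t : R) (w : Omega) : R := \int[X t w]_x f x.

Lemma Xf_adapted f : Cb f -> adapted F (Xf f).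
Proof.
move=> Cf t t0 B mB.
have -> : Xf f t @^-1` B = X t @^-1` ((fun nu : MF R d => \int[nu]_x f x) @^-1` B) by [].
apply: (superprocess_adapted hX t0).
by rewrite -[X in measurable X]setTI; exact: MF_eval_measurable.
Qed.

Lemma Xf_joint f : Cb f -> measurable_fun [set tw : R * Omega | 0 <= tw.1]
  (fun tw => Xf f tw.1 tw.2).
Proof.
move=> Cf; apply: (@measurableT_comp _ _ _ _ _ _ (fun nu : MF R d => \int[nu]_x f x)).
  exact: MF_eval_measurable.
exact: (superprocess_measurable hX).
Qed.

Let ge0_measurable : measurable [set tw : R * Omega | 0 <= tw.1].
Proof.
have -> : [set tw : R * Omega | 0 <= tw.1] = fst @^-1` `[(0 : R), +oo[%classic.
  by apply/seteqP; split => tw /=; rewrite in_itv /= andbT.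
by rewrite -[X in measurable X]setTI; apply: measurable_fst.
Qed.

Lemma Xf_time_measurable f w : Cb f -> measurable_fun `[(0 : R), +oo[ (Xf f ^~ w).
Proof.
move=> Cf; apply: (measurable_comp (F := [set tw : R * Omega | 0 <= tw.1])
  (f := fun tw => Xf f tw.1 tw.2) (g := fun t => (t, w))) => //.
- by move=> _ [t /= + <-]; rewrite in_itv /= andbT.
- exact: Xf_joint.
- by apply: measurable_funTS; exact: measurable_fun_pair.
Qed.

Let mass := Xf (fun=> 1).

Lemma massE t w : mass t w = fine (X t w setT).
Proof. by rewrite /mass /Xf Rintegral_cst// mul1r. Qed.

Let mass_ge0 t w : 0 <= mass t w.
Proof. by apply: bm_int_ge0. Qed.

Lemma Xf_le_mass f b t w : bm f -> (forall x, `|f x| <= b) ->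
  `|Xf f t w| <= b * mass t w.
Proof. by move=> bf fb; rewrite massE; exact: bm_int_norm_le. Qed.

Lemma M_phi_cst1 t w : M_phi X (fun=> 1) t w = mass t w - mass 0 w.
Proof.
transitivity (mass t w - mass 0 w - \int[leb]_(s in `[0, t]) (0 : R)); last first.
  by rewrite Rintegral_cst// mul0r subr0.
rewrite /M_phi; congr (_ - _); apply: eq_Rintegral => s _.
under eq_Rintegral do rewrite laplacian_cst mul0r.
by rewrite Rintegral_cst// mul0r.
Qed.

Definition regular : set Omega :=
  [set w | (forall A, measurable A -> X 0 w A = mu A) /\ cpath (mass ^~ w)].

(** For the test function 1 the drift vanishes, so the total mass is a continuous martingale plus
    its initial value. *)
Lemma regular_negligible : P.-negligible (~` regular).
Proof.
have := superprocess_continuous hX (Cb2_cst 1); rewrite /continuous_paths => cM.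
rewrite -[P.-negligible _]/(\forall w \ae P, regular w).
apply: filterS2 hX0 cM => w w0 /cpath_within cMw; split => //.
have -> : mass ^~ w = fun v => M_phi X (fun=> 1) v w + mass 0 w.
  by apply/funext => v; rewrite M_phi_cst1 subrK.
by move=> u_ u u0 uu; apply: cvgD; [exact: cMw|exact: cvg_cst].
Qed.

(** Up to this time the total mass is at most K, hence X_s(f) is bounded by K sup |f| for every
    bounded f. *)
Definition rho : Omega -> R := hit mass K T.

Let am : adapted F mass. Proof. exact/Xf_adapted/Cb_cst. Qed.

Lemma rho_ge0 w : 0 <= rho w. Proof. exact: hit_ge0. Qed.

Lemma rho_optional t : 0 <= t -> F t [set w | rho w < t].
Proof. exact: (hit_optional hF). Qed.

Lemma Xf0 f w : regular w -> bm f -> Xf f 0 w = \int[mu]_x f x.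
Proof.
move=> [w0 _] bf; rewrite /Xf /Rintegral; congr fine.
by apply: eq_measure_integral => A mA _; exact: w0.
Qed.

Let mass0 w : regular w -> mass 0 w <= K.
Proof. by move=> rw; rewrite massE; have [-> //] := rw. Qed.

Let K0 : 0 <= K. Proof. by apply: le_trans muK; exact: fine_ge0. Qed.

Lemma mass_le u w : regular w -> 0 <= u -> u <= rho w -> mass u w <= K.
Proof. by move=> rw; apply: hit_path_le => //; [have [] := rw|exact: mass0]. Qed.

Lemma Xf_bound f b u w : regular w -> bm f -> (forall x, `|f x| <= b) ->
  0 <= u -> u <= rho w -> `|Xf f u w| <= b * K.
Proof.
move=> rw bf fb u0 ur; apply: le_trans (Xf_le_mass _ _ bf fb) _.
apply: ler_wpM2l; first exact: le_trans (fb 0).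
exact: mass_le.
Qed.

Definition Xint f (t : R) (w : Omega) : R := \int[leb]_(s in `[0, t]) Xf f s w.

Lemma Xint_incr f b s t w : regular w -> Cb f -> (forall x, `|f x| <= b) ->
  0 <= s -> s <= t -> t <= rho w ->
  Xint f t w - Xint f s w = \int[leb]_(u in `]s, t]) Xf f u w.
Proof.
move=> rw Cf fb s0 st tr.
apply: (@integral_incr _ (Xf f ^~ w) s t (b * K)) => //.
  exact: Xf_time_measurable.
move=> u /andP[u0 ut]; apply: Xf_bound => //; first exact: Cb_bm.
exact: le_trans tr.
Qed.

Lemma Xint_incr_norm f b s t w : regular w -> Cb f -> (forall x, `|f x| <= b) ->
  0 <= s -> s <= t -> t <= rho w ->
  `|Xint f t w - Xint f s w| <= b * K * (t - s).
Proof.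
move=> rw Cf fb s0 st tr; rewrite (Xint_incr rw Cf fb)//.
apply: integral_incr_norm => //; first exact: Xf_time_measurable.
move=> u /andP[u0 ut]; apply: Xf_bound => //; first exact: Cb_bm.
exact: le_trans tr.
Qed.

Lemma Xint0 f w : Xint f 0 w = 0.
Proof.
by rewrite /Xint set_itv1 Rintegral_set1.
Qed.

Section one_test_function.
Variables (phi : 'rV[R]_d -> R) (b l : R).
Hypothesis Cphi : Cb2 phi.
Hypothesis phib : forall x, `|phi x| <= b.
Hypothesis phil : forall x, `|laplacian phi x| <= l.

Let Cbphi : Cb phi. Proof. by have [] := Cphi. Qed.
Let b0 : 0 <= b. Proof. exact: le_trans (phib 0). Qed.
Let l0 : 0 <= l. Proof. exact: le_trans (phil 0). Qed.

Let half (x : 'rV[R]_d) : R := laplacian phi x / 2.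

Let Chalf : Cb half.
Proof. by apply: CbM; [exact: Cb_laplacian|exact: Cb_cst]. Qed.

Let half_le x : `|half x| <= l / 2.
Proof. by rewrite /half normrM [X in _ * X]ger0_norm// ler_wpM2r. Qed.

Lemma M_phiE t w : M_phi X phi t w = Xf phi t w - Xf phi 0 w - Xint half t w.
Proof. by []. Qed.

Definition M_bound : R := 2 * b * K + l / 2 * K * T.

Lemma M_bound_ge0 : 0 <= M_bound.
Proof. by rewrite addr_ge0// !mulr_ge0// divr_ge0. Qed.

Lemma stop_M_le t w : regular w -> 0 <= t -> t <= T ->
  `|stop rho (M_phi X phi) t w| <= M_bound.
Proof.
move=> rw t0 tT; rewrite /stop; set u := Num.min t (rho w).
have u0 : 0 <= u by rewrite le_min t0 rho_ge0.
have ur : u <= rho w by rewrite ge_min lexx orbT.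
have uT : u <= T by rewrite (le_trans _ tT)// ge_min lexx.
rewrite M_phiE.
have h1 := Xf_bound rw (Cb_bm Cbphi) phib u0 ur.
have h2 := Xf_bound rw (Cb_bm Cbphi) phib (lexx 0) (rho_ge0 w).
have h3 := Xint_incr_norm rw Chalf half_le (lexx 0) u0 ur.
rewrite Xint0 !subr0 in h3.
have h4 : l / 2 * K * u <= l / 2 * K * T by rewrite ler_wpM2l// mulr_ge0// divr_ge0.
rewrite /M_bound (le_trans (ler_normB _ _))//.
have := ler_normB (Xf phi u w) (Xf phi 0 w); lra.
Qed.

Let G (x y : 'rV[R]_d) : R := g x y * phi x * phi y.
Let cov (nu : MF R d) : R := \int[nu]_v \int[nu]_u G u v.

Let GC x y : `|G x y| <= Cg * b ^+ 2.
Proof.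
rewrite /G !normrM -mulrA expr2; apply: ler_pM => //.
by apply: ler_pM.
Qed.

Let mG : measurable_fun setT (fun xy : 'rV[R]_d * 'rV[R]_d => G xy.1 xy.2).
Proof.
have mphi := Cb_measurable Cbphi.
apply: measurable_funM; last exact: (measurableT_comp mphi measurable_snd).
by apply: measurable_funM => //; exact: (measurableT_comp mphi measurable_fst).
Qed.

Let Gsym x y : G x y = G y x.
Proof. by rewrite /G (noise_covariance_psd ncg).1; ring. Qed.

(** The sign which makes the random environment help: it can only increase the quadratic variation,
    hence the Laplace functional. *)
Lemma cov_ge0 nu : 0 <= cov nu.
Proof.
rewrite /cov; apply: (@psd_integral_ge0 _ _ _ nu G _ mG GC Gsym) => s.
exact: (noise_covariance_psd ncg).2.
Qed.

Lemma cov_le u w : regular w -> 0 <= u -> u <= rho w ->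
  cov (X u w) <= Cg * b ^+ 2 * K ^+ 2.
Proof.
move=> rw u0 ur.
have CG0 : 0 <= Cg * b ^+ 2 by apply: le_trans (GC 0 0).
have mK : fine (X u w setT) <= K by rewrite -massE; exact: mass_le.
have f0 : 0 <= fine (X u w setT) by exact: fine_ge0.
have bJ := bm_int_section (X u w) mG GC Gsym.
have bG v : bm (fun u => G u v).
  split; last by exists (Cg * b ^+ 2).
  exact: (measurableT_comp (f := fun xy : 'rV[R]_d * 'rV[R]_d => G xy.1 xy.2)
     (g := fun u => (u, v))).
apply: (@le_trans _ _ (Cg * b ^+ 2 * K * fine (X u w setT))).
  apply: (@bm_int_le_cst _ _ _ (X u w) _ _ bJ) => v; apply: le_trans (ler_norm _) _.
  apply: (@le_trans _ _ (Cg * b ^+ 2 * fine (X u w setT))).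
    exact: (@bm_int_norm_le _ _ _ (X u w) _ _ (bG v)).
  exact: ler_wpM2l.
have -> : Cg * b ^+ 2 * K ^+ 2 = Cg * b ^+ 2 * K * K by ring.
by apply: ler_wpM2l => //; exact: mulr_ge0.
Qed.

Definition QV_rate : R := b ^+ 2 * K + Cg * b ^+ 2 * K ^+ 2.

Lemma QV_rate_ge0 : 0 <= QV_rate.
Proof.
have CG0 : 0 <= Cg * b ^+ 2 by apply: le_trans (GC 0 0).
by rewrite addr_ge0// mulr_ge0// sqr_ge0.
Qed.

Let phi2 (x : 'rV[R]_d) : R := phi x ^+ 2.
Let Cphi2 : Cb phi2. Proof. by rewrite /phi2; under eq_fun do rewrite expr2; exact: CbM. Qed.
Let phi2_le x : `|phi2 x| <= b ^+ 2.
Proof. by rewrite /phi2 normrX lerXn2r ?nnegrE. Qed.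

(** The lower bound drops the environment and keeps the branching part, for the drift inequality;
    the upper bound gives the Lipschitz rate behind the fourth moment estimate. *)
Lemma QV_incr s t w : regular w -> 0 <= s -> s <= t -> t <= rho w ->
  Xint phi2 t w - Xint phi2 s w <= QV_phi g X phi t w - QV_phi g X phi s w
  <= QV_rate * (t - s).
Proof.
move=> rw s0 st tr.
have CG0 : 0 <= Cg * b ^+ 2 * K ^+ 2.
  by apply: mulr_ge0; [exact: le_trans (GC 0 0)|exact: sqr_ge0].
have /andP[h1 h2] : 0 <= \int[leb]_(u in `[0, t]) cov (X u w) -
    \int[leb]_(u in `[0, s]) cov (X u w) <= Cg * b ^+ 2 * K ^+ 2 * (t - s).
  apply: lower_integral_incr => // u /andP[u0 ut].
  by rewrite cov_ge0 cov_le// (le_trans ut).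
have /ler_normlP[_ h3] := Xint_incr_norm rw Cphi2 phi2_le s0 st tr.
have e u : QV_phi g X phi u w = Xint phi2 u w + \int[leb]_(v in `[0, u]) cov (X v w).
  by [].
rewrite !e /QV_rate; apply/andP; split; lra.
Qed.

Variable O : set Omega.
Hypothesis nO : P.-negligible (~` O).
Hypothesis Oreg : O `<=` regular.
Hypothesis OM : forall w, O w -> cpath (M_phi X phi ^~ w).
Hypothesis OA : forall w, O w -> cpath (QV_phi g X phi ^~ w).

Let m := stop_on rho O (M_phi X phi).
Let q := stop_on rho O (QV_phi g X phi).

Let mmart : martingale P F (M_phi X phi) := superprocess_martingale hX Cphi.
Let aM : adapted F (M_phi X phi). Proof. by have [] := mmart. Qed.
Let hQV := superprocess_quadratic_variation hX Cphi.
Let aA : adapted F (QV_phi g X phi). Proof. by have [] := hQV. Qed.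

Let OP (Q : Omega -> Prop) : (forall w, O w -> Q w) -> \forall w \ae P, Q w.
Proof. by move=> OQ; apply: negligibleS nO; apply: subsetC. Qed.

Let itv t w : 0 <= t -> 0 <= Num.min t (rho w) <= rho w.
Proof. by move=> t0; rewrite le_min t0 rho_ge0 ge_min lexx orbT. Qed.

Lemma QV0 w : QV_phi g X phi 0 w = 0.
Proof. by rewrite /QV_phi set_itv1 !Rintegral_set1 addr0. Qed.

Lemma stop_QV_le t w : regular w -> 0 <= t -> t <= T ->
  `|stop rho (QV_phi g X phi) t w| <= QV_rate * T.
Proof.
move=> rw t0 tT; have /andP[u0 ur] := itv w t0.
have := QV_incr rw (lexx 0) u0 ur; rewrite QV0 Xint0 !subr0 => /andP[h1 h2].
have p0 : 0 <= Xint phi2 (Num.min t (rho w)) w.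
  apply: Rintegral_ge0 => v _; apply: bm_int_ge0 => x; exact: sqr_ge0.
rewrite /stop ger0_norm ?(le_trans p0 h1)//; apply: le_trans h2 _.
rewrite ler_wpM2l ?QV_rate_ge0//.
by apply: le_trans tT; rewrite ge_min lexx.
Qed.

Let stopM w : O w -> forall t, 0 <= t -> t <= T ->
  `|stop rho (M_phi X phi) t w| <= M_bound.
Proof. by move=> Ow t t0 tT; apply: stop_M_le => //; exact: Oreg. Qed.

Let stopA w : O w -> forall t, 0 <= t -> t <= T ->
  `|stop rho (QV_phi g X phi) t w| <= QV_rate * T.
Proof. by move=> Ow t t0 tT; apply: stop_QV_le => //; exact: Oreg. Qed.

Let QVT0 : 0 <= QV_rate * T. Proof. by rewrite mulr_ge0// QV_rate_ge0. Qed.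

Lemma m_fb t : 0 <= t -> t <= T -> fb F t (m t).
Proof. exact: (stop_on_fb hF rho_ge0 rho_optional nO M_bound_ge0 aM (@OM) (@stopM)). Qed.

Lemma m_le t w : 0 <= t -> t <= T -> `|m t w| <= M_bound.
Proof. exact: (stop_on_bound M_bound_ge0 (@stopM)). Qed.

Lemma q_fb t : 0 <= t -> t <= T -> fb F t (q t).
Proof. exact: (stop_on_fb hF rho_ge0 rho_optional nO QVT0 aA (@OA) (@stopA)). Qed.

Lemma m_weak_martingale : weak_martingale P F T m.
Proof.
apply: (stop_on_weak_martingale hF rho_ge0 rho_optional nO M_bound_ge0 aM (@OM) (@stopM)).
move=> s t H s0 st tT FH Hs.
apply: (optional_stopping hF rho_ge0 rho_optional s0 st M_bound_ge0 mmart (OP (@OM))) => //.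
apply: OP => w Ow _; apply: stop_M_le => //; first exact: Oreg.
exact: le_trans st.
Qed.

Let N t w := M_phi X phi t w ^+ 2 - QV_phi g X phi t w.
Let NB : R := M_bound ^+ 2 + QV_rate * T.

Let stop_N_le t w : regular w -> 0 <= t -> t <= T -> `|stop rho N t w| <= NB.
Proof.
move=> rw t0 tT; rewrite /stop /N (le_trans (ler_normB _ _))// lerD//.
  by rewrite normrX lerXn2r ?nnegrE ?M_bound_ge0//; exact: stop_M_le.
exact: stop_QV_le.
Qed.

Let cN w : O w -> cpath (N ^~ w).
Proof.
move=> Ow u_ u u0 uu; apply: cvgB; last exact: OA.
by under eq_cvg do rewrite expr2; rewrite expr2; apply: cvgM; exact: OM.
Qed.

Lemma mq_weak_martingale : weak_martingale P F T (fun t w => m t w ^+ 2 - q t w).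
Proof.
have NB0 : 0 <= NB by rewrite addr_ge0 ?sqr_ge0// mulr_ge0// QV_rate_ge0.
have -> : (fun t w => m t w ^+ 2 - q t w) = stop_on rho O N.
  apply/funext => t; apply/funext => w; rewrite /m /q.
  have [Ow|Ow] := pselect (O w); first by rewrite !stop_onE.
  by rewrite !stop_on_out// expr0n subrr.
have [_ _ _ _ lN] := hQV.
apply: (stop_on_weak_martingale hF rho_ge0 rho_optional nO NB0 _ (@cN)).
- by have [] := lN.
- by move=> w Ow t t0 tT; apply: stop_N_le => //; exact: Oreg.
move=> s t H s0 st tT FH Hs.
apply: (local_optional_stopping hF rho_ge0 rho_optional NB0 lN (OP (@cN)) s0 st) => //.
apply: OP => w Ow u u0 ut; apply: stop_N_le => //; first exact: Oreg.
exact: le_trans tT.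
Qed.

Lemma m_cpath w : cpath (m ^~ w).
Proof. exact: (stop_on_cpath rho_ge0 (@OM)). Qed.

Let min_incr s t w : s <= t -> Num.min s (rho w) <= Num.min t (rho w) /\
  Num.min t (rho w) - Num.min s (rho w) <= t - s.
Proof.
by move=> st; split; case: (leP s (rho w)) => h1; case: (leP t (rho w)) => h2; lra.
Qed.

Lemma q_lip s t w : 0 <= s -> s <= t -> t <= T ->
  q t w - q s w <= QV_rate * (t - s).
Proof.
move=> s0 st tT; have [Ow|Ow] := pselect (O w); last first.
  by rewrite /q !stop_on_out// subrr mulr_ge0 ?QV_rate_ge0// subr_ge0.
rewrite /q !stop_onE//; have /andP[a0 ar] := itv w s0.
have [ab ab_le] := min_incr w st; have /andP[_ br] := itv w (le_trans s0 st).
have /andP[_ h] := QV_incr (Oreg Ow) a0 ab br.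
by apply: le_trans h _; rewrite ler_wpM2l ?QV_rate_ge0.
Qed.

Lemma m_incr4 s t : 0 <= s -> s <= t -> t <= T ->
  \int[P]_w ((m t w - m s w) ^+ 4) <= 8 * (QV_rate * (t - s)) ^+ 2.
Proof.
apply: (fourth_moment hF m_fb q_fb m_le m_weak_martingale mq_weak_martingale q_lip).
  exact: QV_rate_ge0.
exact: @m_cpath.
Qed.

Lemma m_incr s t xi : 0 <= s -> s <= t -> t <= T -> fb F s xi ->
  \int[P]_w (xi w * (m t w - m s w)) = 0.
Proof. exact: (weak_martingale_incr hF m_fb m_weak_martingale). Qed.

Lemma m_incr2 s t xi : 0 <= s -> s <= t -> t <= T -> fb F s xi ->
  \int[P]_w (xi w * (m t w - m s w) ^+ 2) = \int[P]_w (xi w * (q t w - q s w)).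
Proof.
exact: (weak_martingale_incr2 hF m_fb q_fb m_weak_martingale mq_weak_martingale).
Qed.

End one_test_function.
End superprocess_estimates.

(** * Exchange of expectation and time integral for bounded functions *)

Section bounded_fubini.
Context {dO : measure_display} {Omega : measurableType dO} {R : realType}.
Variable P : probability Omega R.
Local Notation leb := (@lebesgue_measure R).
Variables (f : measurableTypeR R * Omega -> R) (a b c : R).
Hypothesis mf : measurable_fun setT f.
Hypothesis fc : forall x, `|f x| <= c.

Let c0 : 0 <= c. Proof. exact: le_trans (fc point). Qed.

Let A : set (measurableTypeR R * Omega) := fst @^-1` `]a, b]%classic.

Let mA : measurable A.
Proof. by rewrite /A -[X in measurable X]setTI; exact: measurable_fst. Qed.

Let h (x : measurableTypeR R * Omega) : \bar R := (\1_A x * f x)%:E.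

Let mh : measurable_fun setT h.
Proof.
by apply/measurable_EFinP; apply: measurable_funM.
Qed.

Let hE v w : h (v, w) = if v \in `]a, b]%classic then (f (v, w))%:E else 0%E.
Proof.
rewrite /h indicE (_ : ((v, w) \in A) = (v \in `]a, b]%classic)).
  by case: ifP => _; rewrite ?mul1r ?mul0r.
by apply/idP/idP => /set_mem ?; apply/mem_set.
Qed.

Let mhP v : measurable_fun setT (fun w => h (v, w)).
Proof. by apply: measurableT_comp mh _; exact: pair1_measurable. Qed.

Let ih : (leb \x P)%E.-integrable setT h.
Proof.
apply/(integrable12ltyP leb P mh).
pose I : set (measurableTypeR R) := `]a, b]%classic.
have mI0 : measurable I by exact: measurable_itv.
have mI : measurable_fun [set: measurableTypeR R] (EFin \o (\1_I : measurableTypeR R -> R)).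
  by apply/measurable_EFinP; exact: measurable_indic.
have mF : measurable_fun setT (fun x => \int[P]_y `|h (x, y)|)%E.
  apply: (@measurable_fun_fubini_tonelli_F _ _ _ _ _ P (abse \o h)).
    exact: measurableT_comp.
  by move=> x /=.
have lt_y : (\int[leb]_x (c%:E * (\1_I x)%:E) < +oo)%E.
  rewrite ge0_integralZl_EFin// integral_indic// setIT.
  by apply: lte_mul_pinfty; rewrite ?lee_fin//; exact: itvoc_measure_lty.
apply: le_lt_trans lt_y; apply: ge0_le_integral => //.
- by move=> x _; apply: integral_ge0 => y _.
- exact: measurable_funeM.
move=> x _; apply: (@le_trans _ _ (\int[P]_y (c%:E * (\1_I x)%:E))%E).
  apply: ge0_le_integral => //.
    by apply: measurableT_comp => //; exact: mhP.
  move=> y _; rewrite hE indicE /I; case: (x \in _); rewrite /= ?mule1 ?mule0 ?normr0//.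
  by rewrite lee_fin.
have P1 : P [set: Omega] = 1%E by exact: probability_setT.
by rewrite -EFinM integral_cst// [X in (_ * X)%E]P1 mule1.
Qed.

Let time_integralE w : \int[leb]_(v in `]a, b]) f (v, w) = fine (\int[leb]_v h (v, w))%E.
Proof.
rewrite /Rintegral integral_mkcond; congr fine; apply: eq_integral => v _.
by rewrite patchE hE.
Qed.

Let probability_integralE v : v \in `]a, b]%classic ->
  (\int[P]_w h (v, w) = (\int[P]_w f (v, w))%:E)%E.
Proof.
move=> vab.
have bf : bm (fun w => f (v, w)).
  split; last by exists c.
  by apply: measurableT_comp mf _; exact: pair1_measurable.
transitivity (\int[P]_w (f (v, w))%:E)%E.
  by apply: eq_integral => w _; rewrite hE vab.
by rewrite /Rintegral fineK//; apply: integrable_fin_num => //; exact: bm_integrable.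
Qed.

Lemma bounded_fubini_measurable :
  measurable_fun setT (fun w => \int[leb]_(v in `]a, b]) f (v, w)).
Proof.
under eq_fun do rewrite time_integralE.
by apply: (measurableT_comp (f := fine)) (measurable_fubini_G ih); exact: fine_measurable.
Qed.

Lemma bounded_fubini_integrable :
  leb.-integrable `]a, b] (EFin \o (fun v => \int[P]_w f (v, w))).
Proof.
have ii : leb.-integrable `]a, b] (fun v => \int[P]_w h (v, w))%E.
  by apply: integrableS (integrable_fubini_F ih).
have mab : measurable (`]a, b]%classic : set (measurableTypeR R)) by exact: measurable_itv.
apply: (@eq_integrable _ _ _ leb _ mab _ _ _ ii) => v vab.
by rewrite /= probability_integralE.
Qed.

Lemma bounded_fubini :
  \int[P]_w \int[leb]_(v in `]a, b]) f (v, w) =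
  \int[leb]_(v in `]a, b]) \int[P]_w f (v, w).
Proof.
have F := Fubini ih.
have e1 : (\int[P]_w (\int[leb]_(v in `]a, b]) f (v, w))%:E =
    \int[P]_w \int[leb]_v h (v, w))%E.
  apply: ae_eq_integral => //.
  - by apply/measurable_EFinP; exact: bounded_fubini_measurable.
  - exact: measurable_fubini_G ih.
  apply: filterS (ae_integrable2 ih) => w iw _.
  by rewrite time_integralE fineK//; apply: integrable_fin_num.
have e2 : (\int[leb]_(v in `]a, b]) (\int[P]_w f (v, w))%:E =
    \int[leb]_v \int[P]_w h (v, w))%E.
  rewrite integral_mkcond; apply: eq_integral => v _; rewrite patchE.
  case: ifPn => vab; first by rewrite probability_integralE.
  transitivity (\int[P]_w (0 : \bar R))%E; first by rewrite integral0.
  by apply: eq_integral => w _; rewrite hE (negbTE vab).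
by rewrite {1}/Rintegral e1 -F -e2.
Qed.

Lemma bounded_fubini_le C : a <= b ->
  (forall v, a < v <= b -> `|\int[P]_w f (v, w)| <= C) ->
  `|\int[P]_w \int[leb]_(v in `]a, b]) f (v, w)| <= C * (b - a).
Proof.
move=> ab hC; rewrite bounded_fubini; have ii := bounded_fubini_integrable.
apply: le_trans (le_normr_Rintegral _ ii) _ => //.
have -> : C * (b - a) = \int[leb]_(u in `]a, b]) C.
  rewrite Rintegral_cst//; congr (_ * _).
  by rewrite -[LHS]/(fine (b - a)%:E); congr fine; exact/esym/itv_measure.
have iC : leb.-integrable `]a, b] (EFin \o (fun=> C)).
  apply: measurable_bounded_integrable => //; first exact: itvoc_measure_lty.
  exists `|C|; split; first by rewrite num_real.
  by move=> M cM u _ /=; exact: ltW.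
by apply: le_Rintegral iC _ => //; exact: integrable_norm.
Qed.

End bounded_fubini.

(** Integrates the pathwise inequality of one time step term by term, with its ingredients kept
    abstract. *)
Lemma expectation_drift d0 (T : measurableType d0) (R : realType) (P : probability T R)
    (x xD2 xQ xD Z E S Y : T -> R) (a b k : R) :
  bm x -> bm xD2 -> bm xQ -> bm xD -> bm Z -> bm E -> bm S -> bm Y ->
  (forall w, x w + (2^-1 * xD2 w - 2^-1 * xQ w) + (a * Z w - xD w)
     - b * E w - k - S w <= Y w) ->
  \int[P]_w x w + 2^-1 * (\int[P]_w xD2 w - \int[P]_w xQ w)
    + (a * \int[P]_w Z w - \int[P]_w xD w) - b * \int[P]_w E w - k - \int[P]_w S w
  <= \int[P]_w Y w.
Proof.
move=> bx bxD2 bxQ bxD bZ' bE bS bY le.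
have bZ (c : R) (f : T -> R) : bm f -> bm (fun w => c * f w).
  by move=> bf; apply: bmM => //; exact: bm_cst.
have b1 := bmB (bZ 2^-1 _ bxD2) (bZ 2^-1 _ bxQ).
have b2 := bmB (bZ a _ bZ') bxD.
have b3 := bmD bx b1.
have b4 := bmD b3 b2.
have b5 := bmB b4 (bZ b _ bE).
have b6 := bmB b5 (bm_cst k).
apply: le_trans (bm_le P (bmB b6 bS) bY le).
rewrite (bm_intB P b6 bS) (bm_intB P b5 (bm_cst k)) (bm_intB P b4 (bZ b _ bE)).
rewrite (bm_intD P b3 b2) (bm_intD P bx b1) (bm_intB P (bZ a _ bZ') bxD).
rewrite (bm_intB P (bZ 2^-1 _ bxD2) (bZ 2^-1 _ bxQ)).
rewrite Rintegral_cst// (congr1 fine (probability_setT P)) mulr1.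
rewrite (bm_intZ P a bZ') (bm_intZ P b bE) (bm_intZ P _ bxD2) (bm_intZ P _ bxQ).
by rewrite -mulrBr.
Qed.

(** * The submartingale inequality over one time step *)

Section log_laplace.
Context {dO : measure_display} {Omega : measurableType dO} {R : realType}.
Context {d : nat}.
Variables (P : probability Omega R) (F : R -> set (set Omega)).
Variables (g : 'rV[R]_d -> 'rV[R]_d -> R) (X : R -> Omega -> MF R d).
Hypothesis hX : superprocess_random_environment P F g X.
Hypothesis mg : measurable_fun setT (fun xy : 'rV[R]_d * 'rV[R]_d => g xy.1 xy.2).
Variable Cg : R.
Hypothesis gC : forall x y, `|g x y| <= Cg.
Hypothesis ncg : noise_covariance g.
Variable mu : MF R d.
Hypothesis hX0 : \forall w \ae P, forall A, measurable A -> X 0 w A = mu A.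
Variables K T : R.
Hypothesis muK : fine (mu setT) <= K.
Hypothesis T0 : 0 <= T.

Let hF : complete_filtration P F := superprocess_filtration hX.
Local Notation leb := (@lebesgue_measure R).
Local Notation rho := (rho X K T).

Let K0 : 0 <= K. Proof. by apply: le_trans muK; exact: fine_ge0. Qed.

Let r0 w : 0 <= rho w. Proof. exact: rho_ge0. Qed.

Lemma rho_measurable : measurable_fun setT (rho : Omega -> R).
Proof.
apply: (@measurability _ _ _ _ setT _ (@RGenInftyO.G R)).
  exact: (RGenInftyO.measurableE R).
move=> _ [_ [x ->] <-]; rewrite setTI.
have -> : rho @^-1` `]-oo, x[ = [set w | rho w < x].
  by apply/seteqP; split => w /=; rewrite in_itv.
have [x0|x0] := leP 0 x.
  exact: (F_measurable hF x0 (rho_optional hX K T0 x0)).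
rewrite (_ : [set w | _] = set0)//; apply/seteqP; split => w //= rx.
by have := lt_trans rx x0; rewrite ltNge r0.
Qed.

Lemma Xf_stop_joint f : Cb f -> measurable_fun setT
  (fun vw : measurableTypeR R * Omega =>
    Xf X f (Num.min (Num.max vw.1 0) (rho vw.2)) vw.2).
Proof.
move=> Cf; apply: (measurable_comp (F := [set tw : R * Omega | 0 <= tw.1])
  (f := fun tw => Xf X f tw.1 tw.2)
  (g := fun vw : measurableTypeR R * Omega =>
     (Num.min (Num.max vw.1 0) (rho vw.2), vw.2))) => //.
- have -> : [set tw : R * Omega | 0 <= tw.1] = fst @^-1` `[(0 : R), +oo[%classic.
    by apply/seteqP; split => tw /=; rewrite in_itv /= andbT.
  by rewrite -[X in measurable X]setTI; apply: measurable_fst.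
- move=> _ [vw _ <-] /=; rewrite le_min r0 andbT le_max lexx orbT//.
- exact: (Xf_joint hX Cf).
apply: measurable_fun_pair; last exact: measurable_snd.
apply: measurable_minr; first by apply: measurable_maxr => //; exact: measurable_fst.
by apply: measurableT_comp; [exact: rho_measurable|exact: measurable_snd].
Qed.

Variable O : set Omega.
Hypothesis nO : P.-negligible (~` O).
Hypothesis Oreg : O `<=` regular X mu.

Let FO t : 0 <= t -> F t O.
Proof.
by move=> t0; rewrite -(setCK O); apply: (F_setC hF) => //; exact: (F_negligible hF).
Qed.

Let mO : measurable O. Proof. exact: (F_measurable hF (lexx 0) (FO (lexx 0))). Qed.

(** Clipping the time at 0 and stopping at rho gives a bounded function, jointly measurable on the
    whole line times [Omega], as Fubini requires. *)
Let Xs f v w : R := \1_O w * Xf X f (Num.min (Num.max v 0) (rho w)) w.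

Let XsE f v w : O w -> 0 <= v -> Xs f v w = Xf X f (Num.min v (rho w)) w.
Proof. by move=> Ow v0; rewrite /Xs indicE mem_set// mul1r (max_idPl v0). Qed.

Let Xs_out f v w : ~ O w -> Xs f v w = 0.
Proof. by move=> Ow; rewrite /Xs indicE memNset// mul0r. Qed.

Let Xs_joint f : Cb f -> measurable_fun setT
  (fun vw : measurableTypeR R * Omega => Xs f vw.1 vw.2).
Proof.
move=> Cf; apply: measurable_funM; last exact: Xf_stop_joint.
exact: (measurableT_comp (f := \1_O : Omega -> R)).
Qed.

Let Xs_le f c v w : Cb f -> (forall x, `|f x| <= c) -> `|Xs f v w| <= c * K.
Proof.
move=> Cf fc; have [Ow|Ow] := pselect (O w); last first.
  by rewrite Xs_out// normr0 mulr_ge0// (le_trans _ (fc 0)).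
rewrite /Xs indicE mem_set// mul1r; apply: (Xf_bound muK T0 (Oreg Ow)) => //.
- exact: Cb_bm.
- by rewrite le_min r0 andbT le_max lexx orbT.
- by rewrite ge_min lexx orbT.
Qed.

Let Xs_bm f v : Cb f -> bm (Xs f v).
Proof.
move=> Cf; have [_ [c fc]] := Cf; split; last by exists (c * K) => w; exact: Xs_le.
exact: (measurableT_comp (Xs_joint Cf) (pair1_measurable (v : measurableTypeR R))).
Qed.

Let Xs_time f w : Cb f -> measurable_fun setT (fun v : measurableTypeR R => Xs f v w).
Proof.
move=> Cf.
exact: (measurableT_comp (Xs_joint Cf) (pair2_measurable (T1 := measurableTypeR R) w)).
Qed.

Let alive (s : R) : set Omega := ~` [set w | rho w < s].

Let aliveP s w : alive s w <-> s <= rho w.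
Proof. by rewrite /alive /= leNgt; split=> [/negP|/negP]. Qed.

Let Falive s : 0 <= s -> F s (alive s).
Proof. by move=> s0; apply: (F_setC hF) => //; exact: (rho_optional hX K T0 s0). Qed.

Let indic01 (A : set Omega) w : 0 <= (\1_A w : R) <= 1.
Proof. by rewrite indicE; case: (w \in A); rewrite ?lexx ?ler01. Qed.

(** The Laplace functional restricted to paths not yet stopped at time s: a weight in [0, 1],
    measurable in [F s], against which the next increments are tested. *)
Let xi s psi w : R := \1_O w * (\1_(alive s) w * expR (- Xf X psi s w)).

Definition laplace_alive s psi : R := \int[P]_w xi s psi w.

Let E1 s s' w : R := \1_O w * (\1_(alive s) w * \1_[set w | rho w < s'] w).

Definition exit_prob s s' : R := \int[P]_w E1 s s' w.

Let xi_in s psi w : O w -> s <= rho w -> xi s psi w = expR (- Xf X psi s w).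
Proof. by move=> Ow /aliveP sr; rewrite /xi !indicE !mem_set// !mul1r. Qed.

Let xi_out s psi w : ~ (O w /\ s <= rho w) -> xi s psi w = 0.
Proof.
move=> h; have [Ow|Ow] := pselect (O w); last by rewrite /xi indicE memNset// mul0r.
have ns : ~ alive s w by move=> /aliveP sr; apply: h.
by rewrite /xi [\1_(alive s) w]indicE memNset// mul0r mulr0.
Qed.

Let xi_fb s psi : 0 <= s -> Cb psi -> (forall x, 0 <= psi x) -> fb F s (xi s psi).
Proof.
move=> s0 Cp p0; apply: bmM; first by apply: (fb_indic hF s0); exact: FO.
apply: bmM; first by apply: (fb_indic hF s0); exact: Falive.
have X0 w : 0 <= Xf X psi s w by apply: bm_int_ge0.
split; last by exists 1 => w; rewrite ger0_norm ?expR_ge0// -expR0 ler_expR oppr_le0.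
apply: measurableT_comp => //; apply: measurableT_comp => //.
exact: ((fmP hF _ s0).2 (Xf_adapted hX Cp s0)).
Qed.

Let xi_itv s psi w : (forall x, 0 <= psi x) -> 0 <= xi s psi w <= 1.
Proof.
move=> p0; have X0 : 0 <= Xf X psi s w by apply: bm_int_ge0.
have [[Ow sr]|h] := pselect (O w /\ s <= rho w); last by rewrite xi_out// lexx ler01.
by rewrite xi_in// expR_ge0/= -expR0 ler_expR oppr_le0.
Qed.

Let E1_bm s s' : 0 <= s -> 0 <= s' -> bm (E1 s s').
Proof.
move=> s0 s0'; apply: bmM; first exact: bm_indic.
by apply: bmM; apply: bm_indic; [exact: (F_measurable hF s0 (Falive s0))|
  exact: (F_measurable hF s0' (rho_optional hX K T0 s0'))].
Qed.

Section one_step.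
Variables (phi psi : 'rV[R]_d -> R) (b l lam C1 e s : R).
Let h : R := e ^+ 2.
Let s' : R := s + h.
Let chi (x : 'rV[R]_d) : R := psi x - phi x.
Hypotheses (e0 : 0 < e) (e1 : e <= 1) (s0 : 0 <= s) (sT : s' <= T).
Hypotheses (Cphi : Cb2 phi) (Cpsi : Cb2 psi).
Hypotheses (phi0 : forall x, 0 <= phi x) (psi0 : forall x, 0 <= psi x).
Hypotheses (phib : forall x, phi x <= b) (phil : forall x, `|laplacian phi x| <= l).
Hypotheses (lam0 : 0 <= lam) (C10 : 0 <= C1).
Hypothesis chi_le : forall x, `|chi x| <= lam * h.
Hypothesis lap_chi_le : forall x, `|laplacian chi x| <= lam * h.
Hypothesis supersol : forall x,
  h * (laplacian phi x / 2 - phi x ^+ 2 / 2) - C1 * h ^+ 2 <= chi x.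
Hypothesis OMphi : forall w, O w -> cpath (M_phi X phi ^~ w).
Hypothesis OAphi : forall w, O w -> cpath (QV_phi g X phi ^~ w).
Hypothesis OMchi : forall w, O w -> cpath (M_phi X chi ^~ w).

Let h0 : 0 < h. Proof. by rewrite exprn_gt0. Qed.
Let ss : s <= s'. Proof. by rewrite lerDl ltW. Qed.
Let s0' : 0 <= s'. Proof. exact: le_trans ss. Qed.
Let Cchi : Cb2 chi. Proof. exact: Cb2B. Qed.
Let Cbphi : Cb phi. Proof. by have [] := Cphi. Qed.
Let Cbpsi : Cb psi. Proof. by have [] := Cpsi. Qed.
Let Cbchi : Cb chi. Proof. by have [] := Cchi. Qed.
Let phib' x : `|phi x| <= b. Proof. by rewrite ger0_norm. Qed.
Let b0 : 0 <= b. Proof. exact: le_trans (phib 0). Qed.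
Let l0 : 0 <= l. Proof. exact: le_trans (phil 0). Qed.
Let c : R := lam * h.
Let c0 : 0 <= c. Proof. by rewrite mulr_ge0// ltW. Qed.

Let m := stop_on rho O (M_phi X phi).
Let q := stop_on rho O (QV_phi g X phi).
Let mchi := stop_on rho O (M_phi X chi).
Let L : R := QV_rate Cg K b.
Let L0 : 0 <= L. Proof. exact: (QV_rate_ge0 gC muK phib'). Qed.
Let x_ : Omega -> R := xi s psi.
Let xfb : fb F s x_. Proof. exact: xi_fb. Qed.
Let xbm : bm x_. Proof. exact: (fb_bm hF s0 xfb). Qed.
Let x01 w : 0 <= x_ w <= 1. Proof. exact: xi_itv. Qed.

Let D w : R := m s' w - m s w.

Let half_chi (x : 'rV[R]_d) : R := laplacian chi x / 2.
Let Chalf_chi : Cb half_chi.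
Proof. by apply: CbM; [exact: Cb_laplacian|exact: Cb_cst]. Qed.
Let half_chi_le x : `|half_chi x| <= c / 2.
Proof. by rewrite /half_chi normrM [X in _ * X]ger0_norm// ler_wpM2r. Qed.

Let itv w v : 0 <= v -> 0 <= Num.min v (rho w) <= rho w.
Proof. by move=> v0; rewrite le_min v0 r0 ge_min lexx orbT. Qed.

Let mchi_bm v : 0 <= v -> v <= T -> bm (mchi v).
Proof.
move=> v0 vT; apply: (fb_bm hF v0).
exact: (m_fb hX muK T0 Cchi chi_le lap_chi_le nO Oreg (@OMchi) v0 vT).
Qed.

(* The stopped martingale part drops out and only the drift of [chi] remains. *)
Let mean_chi v : s < v <= s' ->
  `|\int[P]_w (x_ w * (Xs chi s w - Xs chi v w))| <= c / 2 * K * h.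
Proof.
move=> /andP[/ltW sv vs]; have v0 := le_trans s0 sv; have vT := le_trans vs sT.
have sT' := le_trans sv vT.
pose r w := x_ w * (Xs chi v w - Xs chi s w - (mchi v w - mchi s w)).
have br : bm r.
  apply: bmM => //; apply: bmB; first by apply: bmB; exact: Xs_bm.
  by apply: bmB; exact: mchi_bm.
have e0' : \int[P]_w (x_ w * (mchi v w - mchi s w)) = 0.
  exact: (m_incr hX muK T0 Cchi chi_le lap_chi_le nO Oreg (@OMchi) s0 sv vT xfb).
have bmx : bm (fun w => x_ w * (mchi v w - mchi s w)).
  by apply: bmM => //; apply: bmB; exact: mchi_bm.
have -> : \int[P]_w (x_ w * (Xs chi s w - Xs chi v w)) = - \int[P]_w r w.
  rewrite -[RHS]subr0 -e0' -[- \int[P]_w r w]mulN1r -bm_intZ// -bm_intB//; last first.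
    by apply: bmM => //; exact: bm_cst.
  by apply: eq_Rintegral => w _; rewrite /r; ring.
rewrite normrN; have P1 : fine (P setT) = 1 by rewrite probability_setT.
have -> : c / 2 * K * h = c / 2 * K * h * fine (P setT) by rewrite P1 mulr1.
apply: bm_int_norm_le => // w.
have CKh : 0 <= c / 2 * K * h.
  by apply: mulr_ge0 (ltW h0); apply: mulr_ge0 K0; exact: divr_ge0.
have [[Ow sr]|nw] := pselect (O w /\ s <= rho w); last first.
  by rewrite /r /x_ xi_out// mul0r normr0.
have /andP[x0 x1] := x01 w.
rewrite /r normrM ger0_norm//; apply: le_trans (_ : 1 * (c / 2 * K * h) <= _); last by rewrite mul1r.
apply: ler_pM => //.
rewrite !XsE// /mchi !stop_onE// /stop (min_idPl sr).
have /andP[u0 ur] := itv w v0; have su : s <= Num.min v (rho w) by rewrite le_min sv.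
rewrite !M_phiE; set u := Num.min v (rho w).
have -> : Xf X chi u w - Xf X chi s w -
   (Xf X chi u w - Xf X chi 0 w - Xint X half_chi u w -
     (Xf X chi s w - Xf X chi 0 w - Xint X half_chi s w)) =
   Xint X half_chi u w - Xint X half_chi s w by ring.
apply: le_trans (Xint_incr_norm hX muK T0 (Oreg Ow) Chalf_chi half_chi_le s0 su ur) _.
apply: ler_wpM2l; first by apply: mulr_ge0 K0; exact: divr_ge0.
rewrite lerBlDl; apply: le_trans vs; by rewrite ge_min lexx.
Qed.

Let Zf (vw : measurableTypeR R * Omega) : R :=
  x_ vw.2 * (Xs chi s vw.2 - Xs chi vw.1 vw.2).

Let mZf : measurable_fun setT Zf.
Proof.
apply: measurable_funM.
  by apply: (measurableT_comp (f := x_)) => //; exact: bm_measurable.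
apply: measurable_funB; last exact: Xs_joint.
by apply: (measurableT_comp (f := Xs chi s)) => //; apply: bm_measurable; exact: Xs_bm.
Qed.

Let Zf_le vw : `|Zf vw| <= 2 * (c * K).
Proof.
have /andP[x0 x1] := x01 vw.2.
rewrite /Zf normrM ger0_norm// -[leRHS]mul1r; apply: ler_pM => //.
rewrite (le_trans (ler_normB _ _))// mulr_natl mulr2n lerD//; exact: Xs_le.
Qed.

(** Error made by replacing X_s(chi) by its time average over the step, weighted by [x_]. Pathwise
    it is only controlled by 2 c K h, but by [mean_chi] its mean is of order c h^2, which is
    negligible after division by h. *)
Let Z w : R := \int[leb]_(v in `]s, s']) Zf (v, w).

Let Z_le w : `|Z w| <= 2 * (c * K) * h.
Proof.
have -> : h = s' - s by rewrite /s'; ring.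
apply: integral_incr_norm => //.
apply: measurable_funTS; exact: (measurableT_comp mZf (pair2_measurable (T1 := measurableTypeR R) w)).
Qed.

Let Z_bm : bm Z.
Proof.
split; last by exists (2 * (c * K) * h).
exact: (bounded_fubini_measurable P s s' mZf Zf_le).
Qed.

Let EZ : - (c / 2 * K * h * h) <= \int[P]_w Z w.
Proof.
have := bounded_fubini_le mZf Zf_le ss mean_chi.
have -> : s' - s = h by rewrite /s'; ring.
by move=> /ler_normlP[+ _]; rewrite lerNl.
Qed.

Section path.
Variable w : Omega.
Hypotheses (Ow : O w) (sr : s <= rho w).

Let rw : regular X mu w. Proof. exact: Oreg. Qed.
Let u : R := Num.min s' (rho w).
Let ur : u <= rho w. Proof. by rewrite ge_min lexx orbT. Qed.
Let us : u <= s'. Proof. by rewrite ge_min lexx. Qed.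
Let su : s <= u. Proof. by rewrite le_min ss. Qed.
Let u0 : 0 <= u. Proof. exact: le_trans su. Qed.

Let inc f : R := \int[leb]_(v in `]s, u]) Xf X f v w.

Let XfB f a v : Cb f -> (forall x, `|f x| <= a) -> 0 <= v <= u ->
  `|Xf X f v w| <= a * K.
Proof.
move=> Cf fa /andP[v0 vu]; apply: (Xf_bound muK T0 rw) => //; first exact: Cb_bm.
exact: le_trans ur.
Qed.

Let inc_integrable f : Cb f -> leb.-integrable `]s, u] (EFin \o (fun v => Xf X f v w)).
Proof.
move=> Cf; have [_ [a fa]] := Cf; apply: itvoc_integrable => //.
  exact: (Xf_time_measurable hX).
by move=> v vu; apply: XfB vu.
Qed.

Let incD f f' : Cb f -> Cb f' -> inc (fun x => f x + f' x) = inc f + inc f'.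
Proof.
move=> Cf Cf'; rewrite /inc -RintegralD//; [|exact: inc_integrable..].
by apply: eq_Rintegral => v _; rewrite /Xf bm_intD//; exact: Cb_bm.
Qed.

Let incZ a f : Cb f -> inc (fun x => a * f x) = a * inc f.
Proof.
move=> Cf; rewrite /inc -RintegralZl//; last exact: inc_integrable.
by apply: eq_Rintegral => v _; rewrite /Xf bm_intZ//; exact: Cb_bm.
Qed.

Let inc_norm f a : Cb f -> (forall x, `|f x| <= a) -> `|inc f| <= a * K * (u - s).
Proof.
move=> Cf fa; apply: integral_incr_norm => //.
  exact: (Xf_time_measurable hX).
by move=> v vu; apply: XfB vu.
Qed.

Let half (x : 'rV[R]_d) : R := laplacian phi x / 2.
Let phi2 (x : 'rV[R]_d) : R := phi x ^+ 2.
Let Chalf : Cb half.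
Proof. by apply: CbM; [exact: Cb_laplacian|exact: Cb_cst]. Qed.
Let Cphi2 : Cb phi2.
Proof. by rewrite /phi2; under eq_fun do rewrite expr2; exact: CbM. Qed.
Let half_le x : `|half x| <= l / 2.
Proof. by rewrite /half normrM [X in _ * X]ger0_norm// ler_wpM2r. Qed.
Let phi2_le x : `|phi2 x| <= b ^+ 2.
Proof. by rewrite /phi2 normrX lerXn2r ?nnegrE. Qed.

Let uh : u - s <= h.
Proof. by rewrite lerBlDl. Qed.

Let uh0 : 0 <= u - s. Proof. by rewrite subr_ge0. Qed.

(** The supersolution inequality integrated against X_v over the part of the step before rho. *)
Let inc_supersol :
  - (h^-1 * inc chi) - C1 * K * h ^+ 2 <= 2^-1 * inc phi2 - inc half.
Proof.
(* The hypothesis [supersol] divided by h, as one nonnegative function; the factor 1 is kept so that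
   the last term is again a test function. *)
pose f1 (x : 'rV[R]_d) : R := 2^-1 * phi2 x + (-1 * half x + (h^-1 * chi x + C1 * h * 1)).
have CZ (a : R) (f : 'rV[R]_d -> R) : Cb f -> Cb (fun x => a * f x) by move=> Cf; apply: CbM => //; exact: Cb_cst.
have C1' := @Cb_cst R d 1.
have f10 x : 0 <= f1 x.
  have := supersol x; rewrite -subr_ge0 => hs.
  have -> : f1 x = h^-1 * (chi x - (h * (laplacian phi x / 2 - phi x ^+ 2 / 2) - C1 * h ^+ 2)).
    by rewrite /f1 /phi2 /half; field; rewrite gt_eqF.
  by rewrite mulr_ge0// invr_ge0 ltW.
have : 0 <= inc f1.
  by apply: Rintegral_ge0 => v _; apply: bm_int_ge0.
have D1 := CbD (CZ h^-1 _ Cbchi) (CZ (C1 * h) _ C1').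
have D2 := CbD (CZ (-1) _ Chalf) D1.
rewrite /f1 (incD (CZ 2^-1 _ Cphi2) D2) (incD (CZ (-1) _ Chalf) D1).
rewrite (incD (CZ h^-1 _ Cbchi) (CZ (C1 * h) _ C1')) !incZ//.
have n1 (x : 'rV[R]_d) : `|1 : R| <= 1 by rewrite normr1.
have := inc_norm C1' n1; clear n1.
rewrite mul1r => /ler_normlP[_ h1].
have h2 : C1 * h * inc (fun=> 1) <= C1 * h * (K * h).
  apply: ler_wpM2l; first by rewrite mulr_ge0// ltW.
  by apply: le_trans h1 _; exact: ler_wpM2l.
have -> : C1 * K * h ^+ 2 = C1 * h * (K * h) by ring.
move: h2; move: (h^-1 * inc chi) (C1 * h * inc _) (C1 * h * (K * h)) (inc phi2) (inc half).
by move=> *; lra.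
Qed.

(** The finite-variation part of the change from X_s(psi) to X_u(phi): Laplacian drift plus change
    of test function. *)
Let V : R := Xint X half u w - Xint X half s w - Xf X chi s w.

Let V0 : R := K * (l / 2 + lam).

Let V_le : `|V| <= V0 * e ^+ 2.
Proof.
have h1 := Xint_incr_norm hX muK T0 rw Chalf half_le s0 su ur.
have h2 := Xf_bound muK T0 rw (Cb_bm Cbchi) chi_le s0 sr.
rewrite /V (le_trans (ler_normB _ _))// /V0 -/h.
have h3 : l / 2 * K * (u - s) <= l / 2 * K * h.
  by apply: ler_wpM2l => //; rewrite mulr_ge0// divr_ge0.
lra.
Qed.

Let decomposition : Xf X phi u w = Xf X psi s w + (D w + V).
Proof.
rewrite /D /m !stop_onE// /stop (min_idPl sr) -/u !M_phiE /V.
have -> : Xf X chi s w = Xf X psi s w - Xf X phi s w.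
  by rewrite /Xf /chi bm_intB//; exact: Cb_bm.
by rewrite /half; ring.
Qed.

(** The core of the submartingale property: half the bracket increment dominates the drift, up to
    the averaging error, the exit event and a term of order h^2. *)
Let drift_le : h^-1 * (\int[leb]_(v in `]s, s']) (Xs chi s w - Xs chi v w))
    - 4 * (c * K) * \1_[set w | rho w < s'] w - C1 * K * h ^+ 2
  <= (q s' w - q s w) / 2 - V.
Proof.
have hq : inc phi2 <= q s' w - q s w.
  rewrite /q !stop_onE// /stop (min_idPl sr) -/u /inc.
  rewrite -(Xint_incr hX muK T0 rw Cphi2 phi2_le s0 su ur).
  by have /andP[] := QV_incr hX mg gC ncg muK T0 Cphi phib' rw s0 su ur.
have hV : V = inc half - Xf X chi s w.
  by rewrite /V (Xint_incr hX muK T0 rw Chalf half_le s0 su ur).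
have hs := inc_supersol.
have iXs : leb.-integrable `]s, s'] (EFin \o (fun v => Xs chi v w)).
  apply: (itvoc_integrable (c := c * K)) => //.
    apply: measurable_funTS; exact: (Xs_time w Cbchi).
  by move=> v _; exact: Xs_le.
have iX0 : leb.-integrable `]s, s'] (EFin \o (fun=> Xs chi s w)).
  apply: (itvoc_integrable (c := c * K)) => //.
  by move=> v _; exact: Xs_le.
have zE : \int[leb]_(v in `]s, s']) (Xs chi s w - Xs chi v w) =
    h * Xf X chi s w - \int[leb]_(v in `]s, s']) Xs chi v w.
  rewrite RintegralB// Rintegral_cst// XsE// (min_idPl sr) mulrC; congr (_ * _ - _).
  have -> : h = fine ((s' - s)%:E) by rewrite /s' /=; ring.
  by congr fine; exact: itv_measure.
(* If the path stops within the step, the averages over the whole step and over its living part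
   differ; each term is bounded crudely by c K and charged to the exit event. *)
rewrite zE mulrBr mulKf ?gt_eqF// indicE; have [rs|rs] := ltP (rho w) s'.
  have h1 := Xf_bound muK T0 rw (Cb_bm Cbchi) chi_le s0 sr.
  have h2 : `|h^-1 * \int[leb]_(v in `]s, s']) Xs chi v w| <= c * K.
    rewrite normrM ger0_norm ?invr_ge0 ?(ltW h0)// ler_pdivrMl//.
    have {1}-> : h = s' - s by rewrite /s'; ring.
    rewrite mulrC; apply: integral_incr_norm => //.
      apply: measurable_funTS; exact: (Xs_time w Cbchi).
    by move=> v _; exact: Xs_le.
  have h3 : `|h^-1 * inc chi| <= c * K.
    rewrite normrM ger0_norm ?invr_ge0 ?(ltW h0)// ler_pdivrMl// mulrC.
    apply: le_trans (inc_norm Cbchi chi_le) _.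
    by apply: ler_wpM2l => //; rewrite mulr_ge0.
  rewrite mem_set//= mulr1.
  have cK : 0 <= c * K by rewrite mulr_ge0.
  move: h2 h3 h1 hs hq cK => /ler_normlP[+ +] /ler_normlP[+ +] /ler_normlP[+ +].
  rewrite hV; move: (h^-1 * _) (h^-1 * inc chi) (C1 * K * _) (c * K) (inc phi2) (inc half).
  by move: (Xf X chi s w) (q s' w - q s w)=> *; lra.
rewrite memNset/= ?mulr0; last by apply/negP; rewrite -leNgt.
have -> : \int[leb]_(v in `]s, s']) Xs chi v w = inc chi.
  rewrite /inc (_ : u = s'); last by apply/min_idPl.
  apply: eq_Rintegral => v /set_mem /=; rewrite in_itv /= => /andP[/ltW sv vs].
  by rewrite XsE ?(le_trans s0)// (min_idPl _)// (le_trans vs).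
move: hs hq; rewrite hV.
move: (h^-1 * inc chi) (C1 * K * _) (inc phi2) (inc half) (Xf X chi s w) (q s' w - q s w).
by move=> *; lra.
Qed.

Let ZE : Z w = x_ w * \int[leb]_(v in `]s, s']) (Xs chi s w - Xs chi v w).
Proof.
rewrite /Z /Zf /= RintegralZl//.
apply: (itvoc_integrable (c := 2 * (c * K))) => //.
  apply: measurable_funTS; apply: measurable_funB => //.
  exact: (Xs_time w Cbchi).
move=> v _; rewrite (le_trans (ler_normB _ _))// mulr_natl mulr2n lerD//; exact: Xs_le.
Qed.

(** The Taylor remainder of [expRN_drift] as a function of the martingale increment. *)
Definition step_err (x : R) : R :=
  V0 * (e ^+ 3 + e * x ^+ 2) + e * x ^+ 2 + x ^+ 4 / e + V0 ^+ 3 * e ^+ 3.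

Lemma step_err_ge0 x : 0 <= step_err x.
Proof.
have V00 : 0 <= V0 by rewrite mulr_ge0// addr_ge0// divr_ge0.
have e3 : 0 <= e ^+ 3 by rewrite exprn_ge0// ltW.
have ex : 0 <= e * x ^+ 2 by rewrite mulr_ge0 ?sqr_ge0// ltW.
rewrite /step_err !addr_ge0//.
- by rewrite mulr_ge0// addr_ge0.
- by rewrite divr_ge0 ?(ltW e0)// (_ : 4 = 2 * 2)%N// exprM sqr_ge0.
- by rewrite mulr_ge0 ?exprn_ge0// ltW.
Qed.

Lemma path_step :
  x_ w * (1 - D w + D w ^+ 2 / 2 - (q s' w - q s w) / 2) + h^-1 * Z w
    - 4 * (c * K) * E1 s s' w - C1 * K * h ^+ 2 - step_err (D w)
  <= expR (- Xf X phi u w).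
Proof.
have V00 : 0 <= V0 by rewrite mulr_ge0// addr_ge0// divr_ge0.
have err0 := step_err_ge0 (D w).
have h1 := expRN_drift (D w) e0 e1 V00 V_le.
rewrite -/(step_err (D w)) in h1.
rewrite decomposition [- (Xf _ _ _ _ + _)]opprD expRD.
have xE : x_ w = expR (- Xf X psi s w) by rewrite /x_ xi_in.
have /andP[x0 x1] := x01 w.
have E1E : E1 s s' w = \1_[set w | rho w < s'] w.
  by rewrite /E1 [\1_O w]indicE mem_set// [\1_(alive s) w]indicE mem_set ?mul1r//; exact/aliveP.
rewrite E1E ZE -xE.
have h2 := drift_le.
set z := \int[leb]_(_ in _) _ in h2 *; set i := \1_[set _ | _] w in h2 *.
have i0 : 0 <= i by have /andP[] := indic01 [set w | rho w < s'] w.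
set E := step_err (D w) in h1 err0 *; set Q := q s' w - q s w in h2 *.
have h3 : x_ w * (1 - (D w + V) + D w ^+ 2 / 2 - E) <= x_ w * expR (- (D w + V)).
  exact: ler_wpM2l.
apply: le_trans h3.
have h4 : x_ w * (h^-1 * z - 4 * (c * K) * i - C1 * K * h ^+ 2) <= x_ w * (Q / 2 - V).
  exact: ler_wpM2l.
have h5 : x_ w * E <= E by rewrite ler_piMl.
have h6 : x_ w * (4 * (c * K) * i) <= 4 * (c * K) * i.
  rewrite ler_piMl//; apply: mulr_ge0 i0; apply: mulr_ge0 => //; exact: mulr_ge0.
have h7 : x_ w * (C1 * K * h ^+ 2) <= C1 * K * h ^+ 2.
  by rewrite ler_piMl// mulr_ge0 ?sqr_ge0// mulr_ge0.
lra.
Qed.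

End path.

(** Stopped version of [xi s' phi] that keeps the paths stopping within the step; since it is at
    most 1, these cost at most the exit probability, see [Y_le]. *)
Let Y w : R := \1_O w * (\1_(alive s) w * expR (- Xs phi s' w)).

Let Y_bm : bm Y.
Proof.
apply: bmM; first exact: bm_indic.
apply: bmM; first exact: (bm_indic (F_measurable hF s0 (Falive s0))).
by apply: bm_expN; exact: Xs_bm.
Qed.

Let Y_le w : Y w <= xi s' phi w + E1 s s' w.
Proof.
have Xf0' f : (forall x, 0 <= f x) -> expR (- Xf X f s' w) <= 1.
  by move=> f0; rewrite -expR0 ler_expR oppr_le0; exact: bm_int_ge0.
have [Ow|Ow] := pselect (O w); last first.
  by rewrite /Y /xi /E1 indicE memNset// !mul0r addr0.
have [sr|sr] := leP s (rho w); last first.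
  rewrite /Y /E1 [\1_(alive s) w]indicE memNset; last by move/aliveP; rewrite leNgt sr.
  by rewrite !(mul0r, mulr0) addr0; have /andP[] := @xi_itv s' phi w phi0.
have E : \1_(alive s) w = 1 :> R by rewrite indicE mem_set//; exact/aliveP.
rewrite /Y /E1 E indicE mem_set// !mul1r XsE// indicE.
have [rs|rs] := ltP (rho w) s'.
  rewrite mem_set//=; have /andP[h1 _] := @xi_itv s' phi w phi0.
  rewrite -[leLHS]add0r; apply: lerD => //.
  by rewrite -expR0 ler_expR oppr_le0; exact: bm_int_ge0.
by rewrite xi_in// lerDl ler0n.
Qed.

Let pathwise w : x_ w + (2^-1 * (x_ w * D w ^+ 2) - 2^-1 * (x_ w * (q s' w - q s w)))
  + (h^-1 * Z w - x_ w * D w) - 4 * (c * K) * E1 s s' w - C1 * K * h ^+ 2 - step_err (D w)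
  <= Y w.
Proof.
have [[Ow sr]|nw] := pselect (O w /\ s <= rho w).
  have := path_step Ow sr; rewrite /Y indicE mem_set// [\1_(alive s) w]indicE.
  rewrite mem_set; last exact/aliveP.
  rewrite !mul1r XsE//; apply: le_trans.
  move: (x_ w) (D w) (q s' w - q s w) (h^-1 * Z w) (4 * (c * K) * _) (C1 * K * _) (step_err _).
  by move=> *; lra.
have x0 : x_ w = 0 by exact: xi_out.
have Zw : Z w = 0.
  by rewrite /Z; under eq_Rintegral do rewrite /Zf /= x0 mul0r; rewrite Rintegral_cst// mul0r.
have h1 := step_err_ge0 (D w).
have h2 : 0 <= 4 * (c * K) * E1 s s' w.
  apply: mulr_ge0; first by apply: mulr_ge0 => //; exact: mulr_ge0.
  by rewrite /E1 !mulr_ge0//; case/andP: (indic01 _ w).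
have h3 : 0 <= C1 * K * h ^+ 2 by rewrite mulr_ge0 ?sqr_ge0// mulr_ge0.
have h4 : 0 <= Y w by rewrite /Y !mulr_ge0 ?expR_ge0//; case/andP: (indic01 _ w).
rewrite x0 Zw; move: h1 h2 h3 h4.
move: (4 * (c * K) * _) (C1 * K * _) (step_err _) (Y w)=> *; lra.
Qed.

(** In expectation the first-order martingale term vanishes, half its square cancels half the
    bracket increment, and everything else is O(e^3) by the second and fourth moments and [EZ]. The
    rest is the price of stopping within the step. *)
Lemma one_step : laplace_alive s psi
    - (K * (l / 2 + lam) * (1 + L) + L + 8 * L ^+ 2 + (K * (l / 2 + lam)) ^+ 3
       + K * (C1 + lam / 2)) * e ^+ 3 - (1 + 4 * (c * K)) * exit_prob s s'
  <= laplace_alive s' phi.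
Proof.
have sT' : s <= T := le_trans ss sT.
have mb v : 0 <= v -> v <= T -> bm (m v).
  move=> v0 vT; apply: (fb_bm hF v0).
  exact: (m_fb hX muK T0 Cphi phib' phil nO Oreg (@OMphi) v0 vT).
have qb v : 0 <= v -> v <= T -> bm (q v).
  move=> v0 vT; apply: (fb_bm hF v0).
  exact: (q_fb hX mg gC ncg muK T0 Cphi phib' nO Oreg (@OAphi) v0 vT).
have bD : bm D by apply: bmB; exact: mb.
have bQ : bm (fun w => q s' w - q s w) by apply: bmB; exact: qb.
have bE1 := E1_bm s0 s0'.
have bxD : bm (fun w => x_ w * D w) by exact: bmM.
have bxD2 : bm (fun w => x_ w * D w ^+ 2) by apply: bmM => //; exact: bmX.
have bxQ : bm (fun w => x_ w * (q s' w - q s w)) by exact: bmM.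
have bZ (a : R) (f : Omega -> R) : bm f -> bm (fun w => a * f w).
  by move=> bf; apply: bmM => //; exact: bm_cst.
have Ecst (a : R) : \int[P]_w a = a.
  by rewrite Rintegral_cst// (congr1 fine (probability_setT P)) mulr1.
have shE : s' - s = h by rewrite /s'; ring.
have ExD : \int[P]_w (x_ w * D w) = 0.
  exact: (m_incr hX muK T0 Cphi phib' phil nO Oreg (@OMphi) s0 ss sT xfb).
have ExD2 : \int[P]_w (x_ w * D w ^+ 2) = \int[P]_w (x_ w * (q s' w - q s w)).
  exact: (m_incr2 hX mg gC ncg muK T0 Cphi phib' phil nO Oreg (@OMphi) (@OAphi) s0 ss sT xfb).
have ED2 : \int[P]_w (D w ^+ 2) <= L * h.
  have fb1 : fb F s (fun=> 1 : R) by exact: bm_cst.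
  have := m_incr2 hX mg gC ncg muK T0 Cphi phib' phil nO Oreg (@OMphi) (@OAphi) s0 ss sT fb1.
  under eq_Rintegral do rewrite mul1r; move=> ->.
  under eq_Rintegral do rewrite mul1r; rewrite -(Ecst (L * h)).
  apply: bm_le => //; first exact: bm_cst.
  by move=> w; rewrite -shE; exact: (q_lip hX mg gC ncg muK T0 Cphi phib' Oreg).
have ED4 : \int[P]_w (D w ^+ 4) <= 8 * (L * h) ^+ 2.
  rewrite -shE.
  exact: (m_incr4 hX mg gC ncg muK T0 Cphi phib' phil nO Oreg (@OMphi) (@OAphi) s0 ss sT).
pose V0 : R := K * (l / 2 + lam).
have V00 : 0 <= V0 by rewrite mulr_ge0// addr_ge0// divr_ge0.
pose k : R := V0 * e ^+ 3 + V0 ^+ 3 * e ^+ 3.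
have errE : (fun w => step_err (D w)) =
    (fun w => (V0 + 1) * e * D w ^+ 2 + (e^-1 * D w ^+ 4 + k)).
  apply/funext => w; rewrite /step_err -/V0 /k.
  by move: (V0) (D w) => a x; field; rewrite gt_eqF.
have bD4 : bm (fun w => e^-1 * D w ^+ 4 + k).
  by apply: bmD; [apply: bZ; exact: bmX|exact: bm_cst].
have bD2 : bm (fun w => (V0 + 1) * e * D w ^+ 2) by apply: bZ; exact: bmX.
have berr : bm (fun w => step_err (D w)) by rewrite errE; exact: bmD.
have Eerr : \int[P]_w step_err (D w) <= (V0 * (1 + L) + L + 8 * L ^+ 2 + V0 ^+ 3) * e ^+ 3.
  rewrite errE bm_intD// bm_intD; [|by apply: bZ; exact: bmX|exact: bm_cst].
  rewrite !bm_intZ ?Ecst; [|exact: bmX..].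
  have h1 : (V0 + 1) * e * \int[P]_w (D w ^+ 2) <= (V0 + 1) * e * (L * h).
    by apply: ler_wpM2l => //; apply: mulr_ge0 (ltW e0); exact: addr_ge0.
  have h2 : e^-1 * \int[P]_w (D w ^+ 4) <= e^-1 * (8 * (L * h) ^+ 2).
    by apply: ler_wpM2l => //; rewrite invr_ge0 ltW.
  apply: le_trans (lerD h1 (lerD h2 (lexx k))) _.
  have -> : e^-1 * (8 * (L * h) ^+ 2) = 8 * L ^+ 2 * e ^+ 3.
    by rewrite /h; move: (L) => a; field; rewrite gt_eqF.
  by rewrite /h /k; move: (L) (V0) => a b'; lra.
have h4 : h ^+ 2 <= e ^+ 3.
  have -> : h ^+ 2 = e * e ^+ 3 by rewrite /h; ring.
  by rewrite ler_piMl// exprn_ge0// ltW.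
have bx' := fb_bm hF s0' (xi_fb s0' Cbphi phi0).
have key : \int[P]_w Y w <= \int[P]_w xi s' phi w + \int[P]_w E1 s s' w.
  rewrite -(bm_intD P bx' bE1); exact: (bm_le P Y_bm (bmD bx' bE1) Y_le).
have h5 := expectation_drift P xbm bxD2 bxQ bxD Z_bm bE1 berr Y_bm pathwise.
rewrite ExD ExD2 subrr mulr0 addr0 subr0 in h5.
have h6 : - (c / 2 * K * h) <= h^-1 * \int[P]_w Z w.
  by rewrite ler_pdivlMl// mulrN (mulrC h).
have h7 : C1 * K * h ^+ 2 <= C1 * K * e ^+ 3.
  by apply: ler_wpM2l => //; exact: mulr_ge0.
have h8 : c / 2 * K * h <= K * (lam / 2) * e ^+ 3.
  have -> : c / 2 * K * h = K * (lam / 2) * h ^+ 2 by rewrite /c; ring.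
  by apply: ler_wpM2l => //; apply: mulr_ge0 => //; exact: divr_ge0.
rewrite -/V0 -[laplace_alive s psi]/(\int[P]_w x_ w).
rewrite -[laplace_alive s' phi]/(\int[P]_w xi s' phi w) -[exit_prob s s']/(\int[P]_w E1 s s' w).
move: h5 h6 h7 h8 Eerr key.
move: (c / 2 * K * h) (h^-1 * _) (C1 * K * h ^+ 2) (e ^+ 3) (\int[P]_w step_err _).
move: (\int[P]_w Y w) (\int[P]_w x_ w) (\int[P]_w xi s' phi w) (\int[P]_w E1 s s' w).
move: (c * K) (V0) (L) => *; lra.
Qed.




End one_step.

Definition hit_prob t : R := \int[P]_w (\1_O w * \1_[set w | rho w < t] w).

Let hit_bm t : 0 <= t -> bm (fun w => \1_O w * \1_[set w | rho w < t] w : R).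
Proof.
move=> t0; apply: bmM; first exact: bm_indic.
exact: (bm_indic (F_measurable hF t0 (rho_optional hX K T0 t0))).
Qed.

Lemma hit_prob0 : hit_prob 0 = 0.
Proof.
rewrite /hit_prob; under eq_Rintegral => w _.
  rewrite [\1_[set _ | _] w]indicE memNset ?mulr0; last by rewrite /= ltNge r0.
  over.
by rewrite Rintegral_cst// mul0r.
Qed.

(** This makes the stopping costs of the successive steps telescope. *)
Lemma exit_probE s s' : 0 <= s -> s <= s' ->
  exit_prob s s' = hit_prob s' - hit_prob s.
Proof.
move=> s0 ss; have s0' := le_trans s0 ss.
rewrite /hit_prob -bm_intB; [|exact: hit_bm..].
apply: eq_Rintegral => w _; rewrite /E1 -mulrBr; congr (_ * _).
rewrite /alive !indicE in_setC; have [rs|rs] := ltP (rho w) s.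
  by rewrite (mem_set (A := [set w0 | rho w0 < s]))// mem_set/= ?subrr ?mul0r// (lt_le_trans rs).
rewrite (memNset (A := [set w0 | rho w0 < s])) ?mul1r ?subr0//=.
by apply/negP; rewrite -leNgt.
Qed.

(** Maximal inequality for the total mass: the stopped mass has constant mean mu(1), and it is at
    least K on the event that rho < t. *)
Lemma hit_prob_le t : 0 <= t -> t <= T -> (forall w, O w -> cpath (M_phi X (fun=> 1) ^~ w)) ->
  K * hit_prob t <= fine (mu setT).
Proof.
move=> t0 tT OM1; pose m := stop_on rho O (M_phi X (fun=> 1)).
have C1 := @Cb2_cst R d 1.
have n1 (x : 'rV[R]_d) : `|1 : R| <= 1 by rewrite normr1.
have l1 (x : 'rV[R]_d) : `|laplacian (fun=> 1) x| <= 0 :> R by rewrite laplacian_cst normr0.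
have fb1 : fb F 0 (fun=> 1 : R) by exact: bm_cst.
have mb v : 0 <= v -> v <= T -> bm (m v).
  move=> v0 vT; apply: (fb_bm hF v0).
  exact: (m_fb hX muK T0 C1 n1 l1 nO Oreg OM1 v0 vT).
have bmt : bm (fun w => 1 * (m t w - m 0 w)).
  by apply: bmM; [exact: bm_cst|apply: bmB; exact: mb].
have E0 := m_incr hX muK T0 C1 n1 l1 nO Oreg OM1 (lexx 0) t0 tT fb1.
rewrite /hit_prob -bm_intZ; last exact: hit_bm.
have -> : fine (mu setT) =
    \int[P]_w (fine (mu setT) + 1 * (m t w - m 0 w)).
  rewrite bm_intD//; last exact: bm_cst.
  by rewrite E0 addr0 Rintegral_cst// (congr1 fine (probability_setT P)) mulr1.
apply: bm_le.
- by apply: bmM; [exact: bm_cst|exact: hit_bm].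
- by apply: bmD => //; exact: bm_cst.
move=> w; rewrite mul1r; have [Ow|Ow] := pselect (O w); last first.
  rewrite /m !stop_on_out// subrr addr0 indicE memNset// mul0r mulr0.
  exact: fine_ge0.
rewrite /m !stop_onE// /stop !M_phi_cst1 (min_idPl (r0 w)) subrr subr0.
have rw := Oreg Ow.
rewrite (Xf0 rw (bm_cst 1)) Rintegral_cst// mul1r.
rewrite addrC subrK indicE mem_set// mul1r indicE.
have [rt|rt] := ltP (rho w) t; last first.
  rewrite memNset ?mulr0; first exact: bm_int_ge0.
  by apply/negP; rewrite -leNgt.
rewrite mem_set// mulr1; apply: hit_path_ge => //; first by have [] := rw.
by rewrite (le_trans (ltW rt)).
Qed.

Lemma laplace_alive0 psi : Cb psi -> P O = 1%E ->
  laplace_alive 0 psi = expR (- \int[mu]_x psi x).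
Proof.
move=> Cp PO; rewrite /laplace_alive.
transitivity (\int[P]_w (expR (- \int[mu]_x psi x) * \1_O w)).
  apply: eq_Rintegral => w _; have [Ow|Ow] := pselect (O w); last first.
    by rewrite xi_out ?indicE ?memNset ?mulr0//; case.
  by rewrite xi_in// indicE mem_set// mulr1 (Xf0 (Oreg Ow))//; exact: Cb_bm.
rewrite bm_intZ; last exact: bm_indic.
by rewrite (int_indic P mO) (congr1 fine PO) mulr1.
Qed.

Lemma laplace_alive_le t psi : 0 <= t -> Cb psi -> (forall x, 0 <= psi x) ->
  laplace_alive t psi <= \int[P]_w expR (- Xf X psi t w).
Proof.
move=> t0 Cp p0; have X0 w : 0 <= Xf X psi t w by exact: bm_int_ge0.
apply: bm_le; first exact: (fb_bm hF t0 (xi_fb t0 Cp p0)).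
  split; last by exists 1 => w; rewrite ger0_norm ?expR_ge0// -expR0 ler_expR oppr_le0.
  apply: measurableT_comp => //; apply: measurableT_comp => //.
  exact: (fm_measurable hF t0 ((fmP hF _ t0).2 (Xf_adapted hX Cp t0))).
move=> w; have [[Ow sr]|h] := pselect (O w /\ t <= rho w); first by rewrite xi_in.
by rewrite xi_out// expR_ge0.
Qed.

End log_laplace.

(** * Summing the steps: the log-Laplace inequality for supersolutions *)

Section log_laplace_bound.
Context {dO : measure_display} {Omega : measurableType dO} {R : realType}.
Context {d : nat}.
Variables (P : probability Omega R) (F : R -> set (set Omega)).
Variables (g : 'rV[R]_d -> 'rV[R]_d -> R) (X : R -> Omega -> MF R d).
Hypothesis hX : superprocess_random_environment P F g X.
Hypothesis mg : measurable_fun setT (fun xy : 'rV[R]_d * 'rV[R]_d => g xy.1 xy.2).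
Variable Cg : R.
Hypothesis gC : forall x y, `|g x y| <= Cg.
Hypothesis ncg : noise_covariance g.
Variable mu : MF R d.
Hypothesis hX0 : \forall w \ae P, forall A, measurable A -> X 0 w A = mu A.
Variables (t b l lam C1 : R) (V : R -> 'rV[R]_d -> R).
Hypothesis t0 : 0 < t.
Hypotheses (lam0 : 0 <= lam) (C10 : 0 <= C1).
Hypothesis VC : forall s, 0 <= s -> s <= t -> Cb2 (V s).
Hypothesis V0 : forall s x, 0 <= s -> s <= t -> 0 <= V s x.
Hypothesis Vb : forall s x, 0 <= s -> s <= t -> V s x <= b.
Hypothesis Vl : forall s x, 0 <= s -> s <= t -> `|laplacian (V s) x| <= l.
Hypothesis V_lip : forall s s' x, 0 <= s -> s <= s' -> s' <= t ->
  `|V s x - V s' x| <= lam * (s' - s).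
Hypothesis V_lap_lip : forall s s' x, 0 <= s -> s <= s' -> s' <= t ->
  `|laplacian (fun x => V s x - V s' x) x| <= lam * (s' - s).
Hypothesis V_supersol : forall s s' x, 0 <= s -> s <= s' -> s' <= t ->
  (s' - s) * (laplacian (V s') x / 2 - V s' x ^+ 2 / 2) - C1 * (s' - s) ^+ 2
    <= V s x - V s' x.

Let hF : complete_filtration P F := superprocess_filtration hX.
Local Notation mass_mu := (fine (mu setT)).

Section grid.
Variables (K : R) (N : nat).
Hypotheses (K0 : 0 < K) (muK : mass_mu <= K) (N0 : (0 < N)%N).
Let h : R := t / N%:R.
Let e : R := Num.sqrt h.
Hypothesis e1 : e <= 1.
Let Nr : 0 < N%:R :> R. Proof. by rewrite ltr0n. Qed.
Let h0 : 0 < h. Proof. by rewrite divr_gt0. Qed.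
Let e0 : 0 < e. Proof. by rewrite sqrtr_gt0. Qed.
Let eh : e ^+ 2 = h. Proof. by rewrite sqr_sqrtr// ltW. Qed.
Let node (k : nat) : R := k%:R * h.
Let node0 k : 0 <= node k. Proof. by rewrite mulr_ge0// ltW. Qed.
Let nodeS k : node k.+1 = node k + e ^+ 2.
Proof. by rewrite eh /node mulrSr mulrDl mul1r. Qed.
Let nodeN : node N = t. Proof. by rewrite /node mulrC divfK// gt_eqF. Qed.
Let node_le k : (k <= N)%N -> node k <= t.
Proof. by move=> kN; rewrite -nodeN ler_wpM2r ?ler_nat// ltW. Qed.
Let node_incr k : node k <= node k.+1.
Proof. by rewrite nodeS lerDl sqr_ge0. Qed.

(** One full-measure set for all steps at once; it depends on the grid, which is finite. *)
Let O : set Omega := [set w | [/\ regular X mu w, cpath (M_phi X (fun=> 1) ^~ w) &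
  forall k : nat, (k < N)%N -> [/\ cpath (M_phi X (V (node k.+1)) ^~ w),
    cpath (QV_phi g X (V (node k.+1)) ^~ w) &
    cpath (M_phi X (fun x => V (node k) x - V (node k.+1) x) ^~ w)]]].

Let aeM phi : Cb2 phi -> \forall w \ae P, cpath (M_phi X phi ^~ w).
Proof.
move=> Cp; have := superprocess_continuous hX Cp.
by apply: filterS => w; exact: cpath_within.
Qed.

Let nO : P.-negligible (~` O).
Proof.
rewrite -[P.-negligible _]/(\forall w \ae P, O w).
have h1 : \forall w \ae P, forall k : nat, (k < N)%N ->
  [/\ cpath (M_phi X (V (node k.+1)) ^~ w),
    cpath (QV_phi g X (V (node k.+1)) ^~ w) &
    cpath (M_phi X (fun x => V (node k) x - V (node k.+1) x) ^~ w)].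
  apply: ae_foralln => k; have [kN|kN] := boolP (k < N)%N; last exact: aeW.
  have C1' := VC (node0 k.+1) (node_le kN).
  have C2 := VC (node0 k) (node_le (ltnW kN)).
  have [_ cA _ _ _] := superprocess_quadratic_variation hX C1'.
  apply: filterS3 (aeM C1') cA (aeM (Cb2B C2 C1')) => w ? wA ? _; split => //.
  exact: cpath_within.
have h2 : \forall w \ae P, regular X mu w := regular_negligible hX hX0.
by apply: filterS3 h2 (aeM (@Cb2_cst R d 1)) h1.
Qed.

Let Oreg : O `<=` regular X mu. Proof. by move=> w []. Qed.

Let PO : P O = 1%E.
Proof.
have FO : F 0 O.
  by rewrite -(setCK O); apply: (F_setC hF) => //; exact: (F_negligible hF).
have mO := F_measurable hF (lexx 0) FO.
have := probability_setC P (measurableC mO); rewrite setCK => ->.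
by rewrite (measure_negligible (measurableC mO) nO) sube0.
Qed.

Let err : R := K * (l / 2 + lam) * (1 + QV_rate Cg K b) + QV_rate Cg K b
  + 8 * QV_rate Cg K b ^+ 2 + (K * (l / 2 + lam)) ^+ 3 + K * (C1 + lam / 2).

Let chain k : (k <= N)%N -> expR (- \int[mu]_x V 0 x)
   - k%:R * err * e ^+ 3 - (1 + 4 * (lam * h * K)) * hit_prob P X K t O (node k)
  <= laplace_alive P X K t O (node k) (V (node k)).
Proof.
elim: k => [|k ih] kN.
  have -> : node 0 = 0 by rewrite /node mul0r.
  rewrite (hit_prob0 P X K (ltW t0) O) mulr0 !mul0r !subr0.
  have [Cb0 _ _] := VC (lexx 0) (ltW t0).
  by rewrite (laplace_alive0 hX K (ltW t0) nO Oreg Cb0 PO).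
have kN' := ltnW kN; have tk := node_le kN'; have tk' := node_le kN.
have OM w : O w -> cpath (M_phi X (V (node k.+1)) ^~ w).
  by move=> [_ _ /(_ _ kN)[]].
have OA w : O w -> cpath (QV_phi g X (V (node k.+1)) ^~ w).
  by move=> [_ _ /(_ _ kN)[]].
have OC w : O w -> cpath (M_phi X (fun x => V (node k) x - V (node k.+1) x) ^~ w).
  by move=> [_ _ /(_ _ kN)[]].
have dk : node k.+1 - node k = e ^+ 2 by rewrite nodeS; ring.
have sT : node k + e ^+ 2 <= t by rewrite -nodeS.
have lc x : `|V (node k) x - V (node k.+1) x| <= lam * e ^+ 2.
  by rewrite -dk; exact: V_lip.
have ll x : `|laplacian (fun x => V (node k) x - V (node k.+1) x) x| <= lam * e ^+ 2.
  by rewrite -dk; exact: V_lap_lip.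
have ls x : e ^+ 2 * (laplacian (V (node k.+1)) x / 2 - V (node k.+1) x ^+ 2 / 2)
    - C1 * (e ^+ 2) ^+ 2 <= V (node k) x - V (node k.+1) x.
  by rewrite -dk; exact: V_supersol.
have := one_step hX mg gC ncg muK (ltW t0) nO Oreg e0 e1 (node0 k) sT
  (VC (node0 k.+1) tk') (VC (node0 k) tk) (fun x => V0 x (node0 k.+1) tk')
  (fun x => V0 x (node0 k) tk) (fun x => Vb x (node0 k.+1) tk')
  (fun x => Vl x (node0 k.+1) tk') lam0 C10 lc ll ls OM OA OC.
rewrite -/err -nodeS (exit_probE hX K (ltW t0) nO (node0 k) (node_incr k)).
apply: le_trans; rewrite eh -natr1.
have := ih kN'.
move: (expR _) (hit_prob P X K t O (node k)) (hit_prob P X K t O (node k.+1)).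
move: (laplace_alive _ _ _ _ _ _ _) (e ^+ 3) (lam * h * K) (err) (k%:R : R).
by move=> *; lra.
Qed.

Lemma log_laplace_grid : expR (- \int[mu]_x V 0 x)
    - t * err * e - (1 + 4 * (lam * h * K)) * (mass_mu / K)
  <= \int[P]_w expR (- Xf X (V t) t w).
Proof.
have [Cbt _ _] := VC (ltW t0) (lexx t).
apply: le_trans (laplace_alive_le hX K (ltW t0) nO (ltW t0) Cbt _); last first.
  by move=> x; apply: V0 => //; exact: ltW.
have := chain (leqnn N); rewrite nodeN; apply: le_trans.
(* N steps of length e^2 make up t, so the total error is of order e. *)
have -> : N%:R * err * e ^+ 3 = t * err * e.
  have -> : t = N%:R * e ^+ 2 by rewrite eh -nodeN.
  by move: (err) => a; ring.
rewrite lerD2l lerN2; apply: ler_wpM2l.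
  by rewrite addr_ge0// mulr_ge0// mulr_ge0 ?(ltW K0)// mulr_ge0// ltW.
rewrite ler_pdivlMr// mulrC; apply: (hit_prob_le hX muK (ltW t0) nO Oreg) => //.
- exact: ltW.
- by move=> w [].
Qed.

End grid.

(** The level K is sent to infinity after the mesh. The order matters, since the error constant of
    the grid grows with K while the hitting probability needs K large. *)
Lemma log_laplace_le :
  expR (- \int[mu]_x V 0 x) <= \int[P]_w expR (- Xf X (V t) t w).
Proof.
apply/ler_addgt0Pr => eta eta0.
have m0 : 0 <= mass_mu by exact: fine_ge0.
(* Makes the hitting term mu(1) / K at most eta / 2. *)
pose K : R := mass_mu + 1 + 2 * mass_mu / eta.
have q0 : 0 <= 2 * mass_mu / eta by rewrite divr_ge0 ?mulr_ge0// ltW.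
have K0 : 0 < K by rewrite ltr_pwDl// ltr_wpDl.
have muK : mass_mu <= K by rewrite /K -addrA lerDl addr_ge0.
have mKe : mass_mu / K <= eta / 2.
  rewrite ler_pdivrMr//.
  have -> : eta / 2 * K = mass_mu + eta / 2 * (mass_mu + 1).
    by rewrite /K; field; rewrite gt_eqF.
  by rewrite lerDl mulr_ge0 ?addr_ge0// divr_ge0// ltW.
pose err : R := K * (l / 2 + lam) * (1 + QV_rate Cg K b) + QV_rate Cg K b
  + 8 * QV_rate Cg K b ^+ 2 + (K * (l / 2 + lam)) ^+ 3 + K * (C1 + lam / 2).
pose a : R := t * `|err| + 4 * lam * mass_mu + 1.
have a0 : 0 < a.
  by rewrite ltr_wpDl// addr_ge0// mulr_ge0// ?(ltW t0)// mulr_ge0.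
(* Upper limit for e = sqrt(t / N): then e <= 1 and all discretisation errors, at most a e, are
   below eta / 2. *)
pose r : R := Num.min 1 (eta / 2 / a).
have r0 : 0 < r by rewrite lt_min ltr01 !divr_gt0.
pose N := (Num.truncn (t / r ^+ 2)).+1.
have N0 : (0 < N)%N by [].
have Nr : 0 < N%:R :> R by rewrite ltr0n.
have tN : t / N%:R <= r ^+ 2.
  rewrite ler_pdivrMr// mulrC -ler_pdivrMr ?exprn_gt0// ltW//.
  exact: truncnS_gt.
have er : Num.sqrt (t / N%:R) <= r.
  by rewrite -[r](ger0_norm (ltW r0)) -sqrtr_sqr ler_wsqrtr.
have e1 : Num.sqrt (t / N%:R) <= 1 by rewrite (le_trans er)// ge_min lexx.
have e0 : 0 <= Num.sqrt (t / N%:R) by exact: sqrtr_ge0.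
have h0 : 0 <= t / N%:R by rewrite divr_ge0 ?(ltW t0)// ltW.
have he : t / N%:R <= Num.sqrt (t / N%:R).
  by rewrite -{1}(sqr_sqrtr h0) expr2 ler_piMl.
rewrite -lerBlDr; apply: le_trans (log_laplace_grid K0 muK N0 e1).
rewrite -/err; set e := Num.sqrt _ in e0 e1 er he *; set h := t / _ in h0 he *.
have ea : a * e <= eta / 2.
  rewrite mulrC -ler_pdivlMr//; apply: le_trans er _.
  by rewrite ge_min lexx orbT.
have h1 : t * err * e <= t * `|err| * e.
  by rewrite ler_wpM2r// ler_wpM2l ?ler_norm// ltW.
have h2 : 4 * (lam * h * K) * (mass_mu / K) <= 4 * lam * mass_mu * e.
  have -> : 4 * (lam * h * K) * (mass_mu / K) = 4 * lam * mass_mu * h.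
    by field; rewrite gt_eqF.
  by rewrite ler_wpM2l// mulr_ge0// mulr_ge0.
have h3 : a * e = t * `|err| * e + 4 * lam * mass_mu * e + e by rewrite /a; ring.
have h4 : (1 + 4 * (lam * h * K)) * (mass_mu / K) =
  mass_mu / K + 4 * (lam * h * K) * (mass_mu / K) by rewrite mulrDl mul1r.
rewrite h4; move: h1 h2 h3 ea mKe e0; clear h4.
move: (4 * (lam * h * K) * _); move: (expR _) (t * err * e) (t * `|err| * e) (mass_mu / K).
by move=> *; lra.
Qed.

End log_laplace_bound.

(** * Laplace bounds for concentrated bumps *)

Section superprocess_test_functions.
Context {dO : measure_display} {Omega : measurableType dO} {R : realType}.
Context {d : nat}.
Variables (P : probability Omega R) (F : R -> set (set Omega)).
Variables (g : 'rV[R]_d -> 'rV[R]_d -> R) (X : R -> Omega -> MF R d).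
Hypothesis hX : superprocess_random_environment P F g X.
Hypothesis mg : measurable_fun setT (fun xy : 'rV[R]_d * 'rV[R]_d => g xy.1 xy.2).
Variable Cg : R.
Hypothesis gC : forall x y, `|g x y| <= Cg.
Hypothesis ncg : noise_covariance g.
Variable mu : MF R d.
Hypothesis hX0 : \forall w \ae P, forall A, measurable A -> X 0 w A = mu A.
Variables (i0 i1 : 'I_d).
Hypothesis i01 : i0 != i1.

Definition super_gauss (c delta : R) (p : R * R) (s : R) : 'rV[R]_d -> R :=
  gauss i0 i1 p (super_amp c delta s) (super_rate delta s).

Section log_laplace_super.
Variables (c delta eps t : R) (p : R * R).
Hypotheses (c0 : 0 < c) (delta0 : 0 < delta) (delta1 : delta < 1).
Hypotheses (eps0 : 0 < eps) (t0 : 0 < t).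
Variable T : R.
Hypothesis tT : eps + t <= T.
Hypothesis hc : 4 * delta <= c * expR (- (delta * ln T) - 2).

Let V (s : R) : 'rV[R]_d -> R := super_gauss c delta p (eps + (t - s)).

Let time (s : R) : 0 <= s -> s <= t -> eps <= eps + (t - s) <= T.
Proof.
move=> s0 st; rewrite lerDl subr_ge0 st /=.
by apply: le_trans tT; rewrite lerD2l gerBl.
Qed.

Let timeS (s s' : R) : s <= s' -> eps + (t - s') <= eps + (t - s).
Proof. by move=> ss; rewrite lerD2l lerD2l lerN2. Qed.

Let epsT : eps <= T. Proof. by apply: le_trans tT; rewrite lerDl ltW. Qed.

Let rate0 (s : R) : eps <= s -> 0 < super_rate delta s.
Proof. by move=> es; apply: super_rate_gt0 => //; exact: lt_le_trans es. Qed.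

Let lapE (s : R) (x : 'rV[R]_d) : eps <= s ->
  laplacian (super_gauss c delta p s) x = super_lap c delta s (sqdist i0 i1 p x).
Proof. by move=> es; rewrite laplacian_gauss// rate0. Qed.

Let VC2 (s : R) : eps <= s -> Cb2 (super_gauss c delta p s).
Proof. by move=> es; apply: gauss_Cb2 => //; exact: rate0. Qed.

(** [log_laplace_le] for the supersolution run backwards in time, from age eps + t at time 0 down to
    age eps at time t. *)
Lemma log_laplace_super :
  expR (- \int[mu]_x super_gauss c delta p (eps + t) x)
  <= \int[P]_w expR (- Xf X (super_gauss c delta p eps) t w).
Proof.
have z0 := sqdist_ge0 i0 i1 p.
have T0 : 0 < T := lt_le_trans eps0 epsT.
have Lip0 := super_lipschitz_ge0 delta T c0 eps0.
have V0E : V 0 = super_gauss c delta p (eps + t) by rewrite /V subr0.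
have VtE : V t = super_gauss c delta p eps by rewrite /V subrr addr0.
rewrite -V0E -VtE.
(* A bound on the Laplacian at age T; other ages follow by Lipschitz continuity in time. *)
have [_ [l0 hl0]] := Cb_laplacian (VC2 epsT).
set Lip := super_lipschitz c delta T eps in Lip0.
apply: (log_laplace_le hX mg gC ncg hX0 (b := super_bound c delta T eps)
  (l := l0 + Lip * T) (lam := Lip) (C1 := Lip * (1 + super_bound c delta T eps))) => //.
- apply: mulr_ge0 => //; apply: addr_ge0 => //.
  apply: le_trans (super_bounded c0 delta0 delta1 eps0 epsT (lexx eps) epsT (lexx 0)).
  by rewrite ltW// super_gt0.
- by move=> s s0 st; apply: VC2; have /andP[] := time s0 st.
- by move=> s x s0 st; rewrite ltW// super_gt0.
- move=> s x s0 st; have /andP[h1 h2] := time s0 st.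
  exact: (super_bounded c0 delta0 delta1 eps0 epsT h1 h2 (z0 x)).
- move=> s x s0 st; have /andP[h1 h2] := time s0 st.
  have h3 := super_lap_lip c0 delta0 delta1 eps0 epsT h1 h2 (lexx T) (z0 x).
  have := hl0 x; rewrite (lapE x epsT) /V (lapE x h1) => h4.
  have h5 : Lip * (T - (eps + (t - s))) <= Lip * T.
    by rewrite ler_wpM2l// gerBl (le_trans _ h1)// ltW.
  rewrite -[super_lap _ _ (eps + _) _](subKr (super_lap c delta T (sqdist i0 i1 p x))).
  by rewrite (le_trans (ler_normB _ _))// lerD// (le_trans h3).
- move=> s s' x s0 ss st; have /andP[h1 _] := time (le_trans s0 ss) st.
  have /andP[_ h2] := time s0 (le_trans ss st).
  have := super_lip c0 delta0 delta1 eps0 epsT h1 (timeS ss) h2 (z0 x).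
  by rewrite (_ : eps + (t - s) - (eps + (t - s')) = s' - s); last by ring.
- move=> s s' x s0 ss st; have /andP[h1 _] := time (le_trans s0 ss) st.
  have /andP[h3 h2] := time s0 (le_trans ss st).
  rewrite laplacianB ?lapE//; [|exact: VC2..].
  have := super_lap_lip c0 delta0 delta1 eps0 epsT h1 (timeS ss) h2 (z0 x).
  by rewrite (_ : eps + (t - s) - (eps + (t - s')) = s' - s); last by ring.
- move=> s s' x s0 ss st; have /andP[h1 _] := time (le_trans s0 ss) st.
  have /andP[h3 h2] := time s0 (le_trans ss st).
  rewrite [laplacian (V s') x]lapE//.
  have := super_step c0 delta0 delta1 eps0 hc epsT h1 (timeS ss) h2 (z0 x).
  by rewrite (_ : eps + (t - s) - (eps + (t - s')) = s' - s); last by ring.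
Qed.

End log_laplace_super.

(* The peak height [c eps^(-1-delta)] of the supersolution equals [1 / eps] for
   [eps = c^(1/delta)], whereas at time [t] its height is at most [c t^(-2)]. *)
Lemma laplace_test (eta tau : R) : 0 < eta -> 0 < tau -> tau <= 1 ->
  exists (eps : R) (phi : R * R -> 'rV[R]_d -> R), [/\ 0 < eps <= 1,
    forall p, Cb (phi p), forall p x, 0 <= phi p x,
    forall p x, sqdist i0 i1 p x <= 2 * eps -> expR (-1) / eps <= phi p x &
    forall p t, tau <= t -> t <= tau^-1 ->
      \int[P]_w (1 - expR (- Xf X (phi p) t w)) <= eta].
Proof.
move=> eta0 tau0 tau1; have m0 : 0 <= fine (mu setT) by exact: fine_ge0.
pose T : R := tau^-1 + 1.
have T1 : 1 <= T by rewrite lerDr invr_ge0 ltW.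
have T0 : 0 < T := lt_le_trans ltr01 T1.
(* Upper limit for c: the second entry gives c tau^(-2) mu(1) <= eta, the first keeps c and delta
   below 1. *)
pose a : R := Num.min (2^-1) (eta * tau ^+ 2 / (fine (mu setT) + 1)).
have a0 : 0 < a.
  rewrite lt_min invr_gt0 ltr0n /= divr_gt0//; first by rewrite mulr_gt0// exprn_gt0.
  by rewrite ltr_wpDl.
have a1 : a <= 2^-1 by rewrite ge_min lexx.
(* Chosen so that 4 delta exp(2) T = a; as T^delta <= T, the constant c below is then at most a. *)
pose delta : R := a / (4 * expR 2 * T).
have e2 : 1 <= expR 2 :> R by rewrite -[leLHS]expR0 ler_expR.
have D0 : 0 < 4 * expR 2 * T by rewrite !mulr_gt0// expR_gt0.
have delta0 : 0 < delta by rewrite divr_gt0.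
have D1 : 1 <= 4 * expR 2 * T.
  by rewrite -[leLHS]mul1r ler_pM// -[leLHS]mul1r ler_pM// ler1n.
have deltaa : delta <= a by rewrite ler_pdivrMr// ler_peMr// ltW.
have delta1 : delta < 1 by rewrite (le_lt_trans deltaa)// (le_lt_trans a1)// invf_lt1// ltr1n.
(* The smallest c allowed by the supersolution condition, which becomes an equality. *)
pose c : R := 4 * delta * expR (delta * ln T + 2).
have c0 : 0 < c by apply: mulr_gt0 (expR_gt0 _); exact: mulr_gt0.
have hc : 4 * delta <= c * expR (- (delta * ln T) - 2).
  by rewrite /c -mulrA -expRD -opprD subrr expR0 mulr1.
have lT : 0 <= ln T by rewrite ln_ge0.
have ca : c <= a.
  have -> : a = 4 * delta * (T * expR 2).
    rewrite /delta; field; rewrite !gt_eqF ?expR_gt0//.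
  rewrite /c ler_pM2l; last by rewrite mulr_gt0.
  rewrite expRD ler_pM2r ?expR_gt0//.
  rewrite -[leRHS]lnK ?posrE// ler_expR ler_piMl// ltW//.
pose eps : R := expR (ln c / delta).
have eps0 : 0 < eps by exact: expR_gt0.
have c1 : c <= 1 by rewrite (le_trans ca)// (le_trans a1)// invf_le1// ler1n.
have eps1 : eps <= 1.
  rewrite -expR0 ler_expR mulr_le0_ge0 ?invr_ge0 ?(ltW delta0)//.
  exact: ln_le0.
have ampE : super_amp c delta eps = eps^-1.
  rewrite /super_amp /eps expRK -expRN -{1}(lnK c0) -expRD; congr expR.
  by field; rewrite gt_eqF.
exists eps, (fun p => super_gauss c delta p eps); split.
- by rewrite eps0.
- by move=> p; apply: gauss_Cb => //; exact: super_rate_gt0.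
- by move=> p x; apply: gauss_ge0; rewrite ltW// super_amp_gt0.
- move=> p x xp; rewrite /super_gauss /gauss ampE mulrC ler_pM2l ?invr_gt0// ler_expR lerN2.
  rewrite /super_rate mulrAC ler_pdivrMr ?mulr_gt0// mul1r.
  apply: le_trans (_ : 1 * sqdist i0 i1 p x <= _); last by rewrite mul1r.
  by apply: ler_wpM2r; [exact: sqdist_ge0|rewrite gerBl ltW].
move=> p t tau_t t_tau; have t0 : 0 < t := lt_le_trans tau0 tau_t.
have tT : eps + t <= T by rewrite addrC lerD.
have Cp : Cb (super_gauss c delta p eps).
  by apply: gauss_Cb => //; exact: super_rate_gt0.
have Cpt : Cb (super_gauss c delta p (eps + t)).
  by apply: gauss_Cb => //; apply: super_rate_gt0 => //; exact: addr_gt0.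
have X0 w : 0 <= Xf X (super_gauss c delta p eps) t w.
  by apply: bm_int_ge0 => x; apply: gauss_ge0; rewrite ltW// super_amp_gt0.
have bX : bm (fun w => expR (- Xf X (super_gauss c delta p eps) t w)).
  split; last by exists 1 => w; rewrite ger0_norm ?expR_ge0// -expR0 ler_expR oppr_le0.
  apply: measurableT_comp => //; apply: measurableT_comp => //.
  have hF := superprocess_filtration hX.
  exact: (fm_measurable hF (ltW t0) ((fmP hF _ (ltW t0)).2 (Xf_adapted hX Cp (ltW t0)))).
rewrite (bm_intB P (bm_cst 1) bX) Rintegral_cst// (congr1 fine (probability_setT P)) mulr1.
have := log_laplace_super p c0 delta0 delta1 eps0 t0 tT hc.
set E := \int[P]_w _; set I := \int[mu]_x _ => hE.
have hI : I <= super_amp c delta (eps + t) * fine (mu setT).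
  apply: bm_int_le_cst; first exact: Cb_bm.
  move=> x; apply: gauss_le; first by rewrite ltW// super_amp_gt0.
  by rewrite ltW// super_rate_gt0// addr_gt0.
(* Uses eps + t >= tau and, since tau <= 1 and delta < 1, tau^(-1-delta) <= tau^(-2). *)
have hA : super_amp c delta (eps + t) <= c * tau ^- 2.
  rewrite /super_amp ler_pM2l//.
  have -> : tau ^- 2 = expR (- (2 * ln tau)).
    by rewrite expRN expRM_natl lnK ?posrE.
  rewrite ler_expR lerN2.
  have et : ln tau <= ln (eps + t).
    by rewrite ler_ln ?posrE ?addr_gt0// (le_trans tau_t)// lerDr ltW.
  have lt0 : ln tau <= 0 by exact: ln_le0.
  have h1 : (1 + delta) * ln tau <= (1 + delta) * ln (eps + t).
    by rewrite ler_wpM2l// addr_ge0// ltW.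
  apply: le_trans h1; rewrite ler_wnM2r//.
  by have d1 := delta1; lra.
have hIe : I <= eta.
  apply: le_trans hI _; apply: le_trans (ler_wpM2r m0 hA) _.
  have : c <= eta * tau ^+ 2 / (fine (mu setT) + 1).
    by rewrite (le_trans ca)// ge_min lexx orbT.
  rewrite ler_pdivlMr; last by rewrite ltr_wpDl.
  move=> h1; rewrite mulrAC ler_pdivrMr ?exprn_gt0//; apply: le_trans h1.
  by rewrite ler_pM2l// lerDl.
have h2 : 1 - I <= expR (- I) by rewrite -[1 - I]/(1 + - I) expR_ge1Dx.
by have h3 := hE; lra.
Qed.

End superprocess_test_functions.

(** * Tiles of small planar side and the density of a measure on them *)

Lemma measure_big_setU_le d (T : measurableType d) (R : realType)
    (m : {measure set T -> \bar R}) (I : Type) (s : seq I) (p : pred I)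
    (A : I -> set T) : (forall i, measurable (A i)) ->
  (m (\big[setU/set0]_(i <- s | p i) A i) <= \sum_(i <- s | p i) m (A i))%E.
Proof.
move=> mA; elim: s => [|i s ih]; first by rewrite !big_nil measure0.
rewrite !big_cons; case: ifPn => // _; apply: le_trans (measureU2 _ (mA i) _) _.
  exact: bigsetU_measurable.
exact: leeD2l.
Qed.

Lemma lebesgue_itvco (R : realType) (x y : R) : x <= y ->
  @lebesgue_measure R `[x, y[%classic = (y - x)%:E.
Proof.
move=> xy; rewrite lebesgue_measure_itv /= lte_fin -EFinD.
by have [//|yx] := ltP x y; rewrite (le_anti (introT andP (conj xy yx))) subrr.
Qed.

Lemma le_of_deficit (R : realType) (z theta : R) : 0 <= z -> theta <= 2^-1 ->
  1 - expR (- z) <= theta -> z <= 2 * theta.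
Proof.
move=> z0 t2 ht; have h1 : 1 + z <= expR z by exact: expR_ge1Dx.
have h2 : (1 - theta) * expR z <= 1.
  by rewrite -[leRHS](expRxMexpNx_1 z) mulrC ler_pM2l ?expR_gt0//; lra.
have h3 : (1 - theta) * (1 + z) <= (1 - theta) * expR z.
  by rewrite ler_wpM2l// subr_ge0 (le_trans t2)// invf_le1// ler1n.
have h4 : 0 <= z * (2^-1 - theta) by rewrite mulr_ge0// subr_ge0.
by lra.
Qed.

Section tiling.
Context {R : realType} {d : nat}.
Variables (i0 i1 : 'I_d).
Hypothesis i01 : i0 != i1.
Variables (n : nat) (a : R).
Hypotheses (a0 : 0 < a) (a1 : a <= 1).

Definition box : set 'rV[R]_d := [set x | forall k, - n%:R <= x 0 k < n%:R].

Let M : nat := (Num.truncn (n%:R / a)).+1.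
Definition tiles : nat := M.*2.
Definition corner (k : nat) : R := (k%:R - M%:R) * a.

(** Side a in the two chosen coordinates, full width of the box in the others. Half-open sides let
    the tiles cover the box. *)
Definition tile (ij : 'I_tiles * 'I_tiles) : set 'rV[R]_d :=
  [set x | forall k, (if k == i0 then `[corner ij.1, corner ij.1 + a[%classic
    else if k == i1 then `[corner ij.2, corner ij.2 + a[%classic
    else `[- n%:R, n%:R[%classic) (x 0 k)].

Let Ma : n%:R <= M%:R * a.
Proof. by rewrite -ler_pdivrMr// ltW// truncnS_gt. Qed.

Let Ma1 : M%:R * a <= n%:R + 1.
Proof.
have h : (Num.truncn (n%:R / a))%:R <= n%:R / a.
  by rewrite truncn_le divr_ge0// ltW.
by rewrite /M -natr1 mulrDl mul1r lerD// -ler_pdivlMr.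
Qed.

(** Uniform in a <= 1: the covering exceeds the box by at most one unit on each side. *)
Lemma tiles_area : (tiles ^ 2)%:R * a ^+ 2 <= (2 * n%:R + 2) ^+ 2.
Proof.
rewrite natrX -exprMn lerXn2r ?nnegrE//.
- by rewrite mulr_ge0// ltW.
- by have h := Ma1; rewrite /tiles -muln2 natrM; lra.
Qed.

Lemma tile_measurable ij : measurable (tile ij).
Proof.
rewrite (_ : tile ij = \bigcap_(k in [set: 'I_d]) (fun x : 'rV[R]_d => x 0 k) @^-1`
  (if k == i0 then `[corner ij.1, corner ij.1 + a[%classic
    else if k == i1 then `[corner ij.2, corner ij.2 + a[%classic
    else `[- n%:R, n%:R[%classic)); last first.
  by apply/seteqP; split => x h k; [move=> _|]; exact: h.
apply: fin_bigcap_measurable => // k _.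
rewrite -[X in measurable X]setTI; apply: measurable_coord => //.
by case: ifP => _; [|case: ifP => _]; exact: measurable_itv.
Qed.

Lemma box_measurable : measurable box.
Proof.
rewrite (_ : box = \bigcap_(k in [set: 'I_d])
    (fun x : 'rV[R]_d => x 0 k) @^-1` `[- n%:R, n%:R[%classic); last first.
  by apply/seteqP; split => x h k; [move=> _|have := h k I]; rewrite /= in_itv//; exact: h.
apply: fin_bigcap_measurable => // k _.
by rewrite -[X in measurable X]setTI; apply: measurable_coord => //; exact: measurable_itv.
Qed.

Definition cross_section : R := \prod_(k < d | (k != i0) && (k != i1)) (2 * n%:R).

Lemma cross_section_ge0 : 0 <= cross_section.
Proof. by apply: prodr_ge0 => k _; rewrite mulr_ge0. Qed.

Lemma tile_lebesgue ij : lebesgue_rV R d (tile ij) = (a ^+ 2 * cross_section)%:E.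
Proof.
pose side (k : 'I_d) : set (measurableTypeR R) :=
  if k == i0 then `[corner ij.1, corner ij.1 + a[%classic
  else if k == i1 then `[corner ij.2, corner ij.2 + a[%classic
  else `[- n%:R, n%:R[%classic.
have mside k : measurable (side k).
  by rewrite /side; case: ifP => _; [|case: ifP => _]; exact: measurable_itv.
transitivity (\prod_k @lebesgue_measure R (side k))%E; first exact: (lebesgue_rV_box mside).
have ca k : corner k <= corner k + a by rewrite lerDl ltW.
transitivity (\prod_(k < d) (if k == i0 then a else if k == i1 then a else 2 * n%:R)%:E)%E.
  apply: eq_bigr => k _; rewrite /side; case: ifP => _.
    by rewrite lebesgue_itvco// addrC addKr.
  case: ifP => _; first by rewrite lebesgue_itvco// addrC addKr.
  rewrite lebesgue_itvco ?opprK ?mulr_natl ?mulr2n//.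
  by apply: le_trans (ler0n _ n); rewrite oppr_le0.
rewrite -(big_morph EFin (@EFinM R) (erefl _)); congr EFin.
rewrite (bigD1 i0)//= eqxx (bigD1 i1) 1?eq_sym//= eqxx (negbTE i01) mulrA -expr2.
congr (_ * _); apply: eq_bigr => k /andP[k0 k1].
by rewrite (negbTE k0) (negbTE k1).
Qed.

Lemma box_tile x : box x -> exists ij, tile ij x.
Proof.
move=> bx.
have cover y : - n%:R <= y < n%:R -> exists k : 'I_tiles, corner k <= y < corner k + a.
  move=> /andP[ny yn]; pose z := y / a + M%:R.
  have z0 : 0 <= z.
    rewrite -lerBlDr sub0r ler_pdivlMr// mulNr (le_trans _ ny)//.
    by rewrite lerN2.
  have kM : (Num.truncn z < tiles)%N.
    rewrite -(ltr_nat R); apply: (@le_lt_trans _ _ z); first by rewrite truncn_le.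
    rewrite /tiles -addnn natrD ltrD2r ltr_pdivrMr//.
    exact: lt_le_trans Ma.
  exists (Ordinal kM); rewrite /corner /=; have /andP[h1 h2] := truncn_itv z0.
  have ya : y = (z - M%:R) * a by rewrite /z addrK divfK// gt_eqF.
  rewrite ya ler_pM2r// lerD2r h1 /=.
  rewrite -[X in _ < _ + X]mul1r -mulrDl ltr_pM2r//.
  by move: h2; rewrite -natr1 => h2; lra.
have [i hi] := cover _ (bx i0); have [j hj] := cover _ (bx i1).
exists (i, j) => k /=; case: eqP => [->|_]; first by rewrite /= in_itv.
case: eqP => [->|_]; first by rewrite /= in_itv.
by rewrite /= in_itv; exact: bx.
Qed.

Lemma tile_sqdist ij x : tile ij x ->
  sqdist i0 i1 (corner ij.1, corner ij.2) x <= 2 * a ^+ 2.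
Proof.
move=> tx; have := tx i0; have := tx i1.
rewrite !eqxx [i1 == i0]eq_sym (negbTE i01) /= !in_itv /= => /andP[h1 h2] /andP[h3 h4].
rewrite /sqdist /= mulr_natl mulr2n.
have sq (u v : R) : u <= v -> v < u + a -> (v - u) ^+ 2 <= a ^+ 2.
  by move=> uv vu; rewrite lerXn2r ?nnegrE ?subr_ge0// ?(ltW a0)// lerBlDl ltW.
by apply: lerD; exact: sq.
Qed.

Variable phi : R * R -> 'rV[R]_d -> R.
Hypotheses (Cphi : forall p, Cb (phi p)) (phi0 : forall p x, 0 <= phi p x).
Hypothesis phi_ge : forall p x, sqdist i0 i1 p x <= 2 * a ^+ 2 ->
  expR (-1) / a ^+ 2 <= phi p x.

Let test (ij : 'I_tiles * 'I_tiles) := phi (corner ij.1, corner ij.2).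

(** Soft count of the area of tiles where [nu] has noticeable planar density. Its expectation for
    X_t is what the Laplace bound controls. *)
Definition score (nu : MF R d) : R :=
  \sum_ij a ^+ 2 * (1 - expR (- \int[nu]_x test ij x)).

Let deficit (nu : MF R d) ij : R := 1 - expR (- \int[nu]_x test ij x).

Let deficit_ge0 nu ij : 0 <= deficit nu ij.
Proof.
rewrite subr_ge0 -expR0 ler_expR oppr_le0; apply: bm_int_ge0 => x; exact: phi0.
Qed.

(** The bump is at least exp(-1) / a^2 on its tile, so a small deficit means a mass small compared
    with the area a^2. *)
Let light_tile (nu : MF R d) ij theta : theta <= 2^-1 -> deficit nu ij <= theta ->
  (nu (tile ij) <= (2 * expR 1 * theta * a ^+ 2)%:E)%E.
Proof.
move=> t2 /le_of_deficit h; have mt := tile_measurable ij.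
have z0 : 0 <= \int[nu]_x test ij x by apply: bm_int_ge0 => x; exact: phi0.
have := h z0 t2 => zt.
have a20 : 0 < a ^+ 2 by rewrite exprn_gt0.
have h1 : expR (-1) / a ^+ 2 * fine (nu (tile ij)) <= \int[nu]_x test ij x.
  rewrite -(int_indic nu mt) -bm_intZ; last exact: bm_indic.
  apply: bm_le; [by apply: bmM; [exact: bm_cst|exact: bm_indic]|exact/Cb_bm/Cphi|].
  move=> x; rewrite indicE; have [tx|tx] := pselect (tile ij x).
    by rewrite mem_set// mulr1; apply: phi_ge; exact: tile_sqdist.
  by rewrite memNset// mulr0; exact: phi0.
rewrite -[nu _]fineK ?lee_fin; last exact: fin_num_measure.
have := le_trans h1 zt; rewrite expRN mulrAC ler_pdivrMr// mulrC ler_pdivrMr ?expR_gt0//.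
by move=> h2; rewrite (le_trans h2)// le_eqVlt; apply/orP; left; apply/eqP; ring.
Qed.

(** [A] is the union of the tiles with deficit above theta: Markov's inequality for the sum over
    tiles bounds its Lebesgue measure, and [light_tile] with [tiles_area] bounds the mass
    elsewhere. *)
Lemma score_le (nu : MF R d) theta kappa : 0 < theta -> theta <= 2^-1 ->
    score nu <= kappa ->
  exists A, [/\ measurable A,
    (lebesgue_rV R d A <= (cross_section * kappa / theta)%:E)%E &
    (nu (box `\` A) <= ((2 * n%:R + 2) ^+ 2 * (2 * expR 1 * theta))%:E)%E].
Proof.
move=> th0 th2 sk; pose bad := [pred ij | theta < deficit nu ij].
have mt := tile_measurable.
exists (\big[setU/set0]_(ij | bad ij) tile ij); split.
- exact: bigsetU_measurable.
- apply: le_trans (measure_big_setU_le _ _ _ mt) _.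
  rewrite (eq_bigr _ (fun ij _ => tile_lebesgue ij)) sumEFin lee_fin.
  have c0 := cross_section_ge0.
  apply: (@le_trans _ _ (cross_section * score nu / theta)); last first.
    by rewrite ler_pM2r ?invr_gt0// ler_wpM2l.
  rewrite ler_pdivlMr// mulr_suml /score mulr_sumr.
  rewrite [leRHS](bigID bad)/= -[leLHS]addr0; apply: lerD.
    apply: ler_sum => ij /ltW h.
    have -> : a ^+ 2 * cross_section * theta = cross_section * (a ^+ 2 * theta) by ring.
    apply: ler_wpM2l => //; apply: ler_wpM2l => //; exact: sqr_ge0.
  by apply: sumr_ge0 => ij _; rewrite mulr_ge0// mulr_ge0 ?sqr_ge0//; exact: deficit_ge0.
have sub : box `\` \big[setU/set0]_(ij | bad ij) tile ij `<=`
    \big[setU/set0]_(ij | ~~ bad ij) tile ij.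
  move=> x [/box_tile[ij tx] nbad].
  have [b|nb] := boolP (bad ij).
    by case: nbad; rewrite (bigD1 ij)//; left.
  by rewrite (bigD1 ij)//; left.
apply: le_trans (le_measure _ _ _ sub) _; rewrite ?inE.
- by apply: measurableD; [exact: box_measurable|exact: bigsetU_measurable].
- exact: bigsetU_measurable.
apply: le_trans (measure_big_setU_le _ _ _ mt) _.
apply: (@le_trans _ _ (\sum_(ij : 'I_tiles * 'I_tiles) (2 * expR 1 * theta * a ^+ 2)%:E)%E).
  rewrite [leRHS](bigID bad)/= -[leLHS]add0e; apply: leeD.
    apply: sume_ge0 => ij _; rewrite lee_fin; apply: mulr_ge0 (sqr_ge0 _).
    by apply: mulr_ge0 (ltW th0); rewrite mulr_ge0// expR_ge0.
  apply: lee_sum => ij; rewrite /= -leNgt => h; exact: light_tile.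
rewrite sumEFin lee_fin sumr_const card_prod !card_ord [leRHS]mulrC.
have h0 : 0 <= 2 * expR 1 * theta.
  by apply: mulr_ge0 (ltW th0); rewrite mulr_ge0// expR_ge0.
apply: le_trans (ler_wpM2l h0 tiles_area).
rewrite -[leLHS]mulr_natr -mulnn natrM.
by rewrite le_eqVlt; apply/orP; left; apply/eqP; ring.
Qed.

End tiling.

(** * Borel-Cantelli, Tonelli, and a criterion for singularity *)

Section lim_sup_set.
Context d (T : measurableType d) (R : realType).

Lemma lim_sup_set_measurable (E : nat -> set T) :
  (forall n, measurable (E n)) -> measurable (lim_sup_set E).
Proof.
move=> mE; apply: bigcapT_measurable => n; exact: bigcup_measurable.
Qed.

Lemma lim_sup_set_null (m : {measure set T -> \bar R}) (E : nat -> set T) (N : nat) :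
  (forall n, measurable (E n)) ->
  (forall n, (N <= n)%N -> (m (E n) <= (1 / (2 ^ n.+1)%:R)%:E)%E) ->
  m (lim_sup_set E) = 0%E.
Proof.
move=> mE Em; pose G n := if (N <= n)%N then E n else set0.
have mG n : measurable (G n) by rewrite /G; case: ifP.
have Gm n : (m (G n) <= (1 / (2 ^ n.+1)%:R)%:E)%E.
  by rewrite /G; case: ifP => [|_]; [exact: Em|rewrite measure0 lee_fin divr_ge0].
have G0 : m (lim_sup_set G) = 0%E.
  apply: lim_sup_set_cvg0 => //.
  apply: (@le_lt_trans _ _ 1%:E%E); last exact: ltry.
  apply: le_trans (epsilon_trick0 xpredT (ler01 : (0 : R) <= 1)).
  by apply: lee_nneseries => // n _; exact: Gm.
apply: (@subset_measure0 _ _ _ m _ (lim_sup_set G)) => //; try exact: lim_sup_set_measurable.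
move=> x xE n _; have [k /= nk xk] := xE (maxn n N) I.
exists k => /=; first exact: leq_trans (leq_maxl _ _) nk.
by rewrite /G (leq_trans (leq_maxr _ _) nk).
Qed.

End lim_sup_set.

(** Tonelli: if each time section is almost surely avoided, then almost surely the set of bad times
    is Lebesgue-null. *)
Lemma null_ysection dO (Omega : measurableType dO) (R : realType)
    (P : probability Omega R) (D : set (measurableTypeR R * Omega)) :
  measurable D -> (forall t, P (xsection D t) = 0%E) ->
  \forall w \ae P, @lebesgue_measure R (ysection D w) = 0%E.
Proof.
move=> mD D0.
have h1 : (@lebesgue_measure R \x P)%E D = 0%E.
  by rewrite /product_measure1; apply: integral0_eq => t _ /=; exact: D0.
have h2 : (@lebesgue_measure R \x^ P)%E D = 0%E.
  rewrite -h1; apply/esym; apply: product_measure_unique => // A B mA mB.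
  exact: product_measure2E.
have mf := @measurable_fun_ysection _ _ _ _ _ (@lebesgue_measure R) D mD.
have e0 : (\int[P]_w `|(@lebesgue_measure R \o ysection D) w| = 0)%E.
  by rewrite -[RHS]h2; apply: eq_integral => w _ /=; rewrite gee0_abs.
by apply: filterS ((ae_eq_integral_abs P measurableT mf).1 e0) => w; exact.
Qed.

(** The limsup of the sets [A n] is Lebesgue-null by Borel-Cantelli. A point outside it lies in box
    n minus [A n] for all large n, and these tails are null for [nu]. *)
Lemma singular_of_boxes (R : realType) (d : nat) (nu : MF R d) (N : nat) :
  (forall n, (N <= n)%N -> exists A, [/\ measurable A,
     (lebesgue_rV R d A <= (1 / (2 ^ n.+1)%:R)%:E)%E &
     (nu (box n `\` A) <= (1 / (2 ^ n.+1)%:R)%:E)%E]) ->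
  mutually_singular nu (lebesgue_rV R d).
Proof.
move=> hA; have /choice[A hA'] (n : nat) : exists A, measurable A /\ ((N <= n)%N ->
    (lebesgue_rV R d A <= (1 / (2 ^ n.+1)%:R)%:E)%E /\
    (nu (box n `\` A) <= (1 / (2 ^ n.+1)%:R)%:E)%E).
  have [/hA[A [mA A1 A2]]|nN] := boolP (N <= n)%N; first by exists A.
  by exists set0; split.
have mA n : measurable (A n) by have [] := hA' n.
have mS := lim_sup_set_measurable mA.
exists (~` lim_sup_set A); split; first exact: measurableC; last first.
  rewrite setCK; apply: (lim_sup_set_null (N := N)) => // n nN.
  by have [_ /(_ nN)[]] := hA' n.
pose C (m : nat) := \bigcap_(n in [set n | (m <= n)%N]) (box n `\` A n).
have mbA n : measurable (box n `\` A n).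
  by apply: measurableD => //; exact: box_measurable.
have mC m : measurable (C m) by apply: bigcap_measurable => //; exists m => /=.
have C0 m : nu (C m) = 0%E.
  apply/eqP; rewrite eq_le measure_ge0 andbT; apply/lee_addgt0Pr => e e0; rewrite add0e.
  (* Large enough for 2^(-n-1) <= e, for the bounds to hold, and for [C m] to lie in box n minus
     [A n]. *)
  pose n := maxn (maxn m N) (Num.truncn e^-1).
  have Cn : C m `<=` box n `\` A n.
    by move=> x; apply; rewrite /= /n -maxnA leq_maxl.
  apply: le_trans (le_measure _ _ _ Cn) _; rewrite ?inE//.
  have [_ []] := hA' n; first by rewrite /n leq_max leq_maxr.
  move=> _ /le_trans; apply; rewrite lee_fin div1r -[leRHS]invrK lef_pV2 ?posrE ?invr_gt0//.
    rewrite ltW// (lt_le_trans (truncnS_gt _))// ler_nat.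
    apply: (@leq_trans n.+1); first by rewrite ltnS /n leq_maxr.
    by rewrite ltnW// ltn_expl.
apply: measure_negligible; first exact: measurableC.
have nC m : nu.-negligible (C m) by exists (C m); split.
apply: (negligibleS _ (negligible_bigcup nC)).
move=> x nx; have [m hm] : exists m : nat, forall n, (m <= n)%N -> ~ A n x.
  apply: contrapT => h; apply: nx => m _.
  apply: contrapT => h'; apply: h; exists m => n mn An; apply: h'; by exists n.
have [k xk] : exists k : nat, box k x.
  pose s := \sum_(i < d) `|x 0 i|; exists (Num.truncn s).+1 => i.
  have h : `|x 0 i| <= s by rewrite /s (bigD1 i)//= lerDl sumr_ge0.
  have hs : `|x 0 i| < (Num.truncn s).+1%:R by rewrite (le_lt_trans h)// truncnS_gt.
  by move: hs; rewrite ltr_norml => /andP[/ltW -> ->].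
exists (maxn m k) => // n /=; rewrite geq_max => /andP[mn kn]; split; last exact: hm.
move=> i; have /andP[h1 h2] := xk i; apply/andP; split.
  by apply: le_trans h1; rewrite lerN2 ler_nat.
by rewrite (lt_le_trans h2)// ler_nat.
Qed.

(** * Singularity of the superprocess at almost every time *)

Section singularity.
Context {dO : measure_display} {Omega : measurableType dO} {R : realType}.
Context {d : nat}.
Variables (P : probability Omega R) (F : R -> set (set Omega)).
Variables (g : 'rV[R]_d -> 'rV[R]_d -> R) (X : R -> Omega -> MF R d).
Hypothesis hX : superprocess_random_environment P F g X.
Hypothesis mg : measurable_fun setT (fun xy : 'rV[R]_d * 'rV[R]_d => g xy.1 xy.2).
Variable Cg : R.
Hypothesis gC : forall x y, `|g x y| <= Cg.
Hypothesis ncg : noise_covariance g.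
Variable mu : MF R d.
Hypothesis hX0 : \forall w \ae P, forall A, measurable A -> X 0 w A = mu A.
Variables (i0 i1 : 'I_d).
Hypothesis i01 : i0 != i1.

Let hF : complete_filtration P F := superprocess_filtration hX.

(** At scale n the window of times, the box and the tolerance r = 2^(-n-1) are fixed first; the tile
    size then comes from [laplace_test], so that exceeding kappa has probability at most r by
    Markov. *)
Lemma score_at_scale (n : nat) : exists (f : R -> Omega -> R) (kappa : R), [/\ 0 < kappa,
  measurable_fun [set tw : R * Omega | 0 <= tw.1] (fun tw => f tw.1 tw.2),
  forall t w, 0 <= f t w,
  forall t, n.+1%:R^-1 <= t -> t <= n.+1%:R ->
    bm (f t) /\ \int[P]_w f t w <= kappa * (1 / (2 ^ n.+1)%:R) &
  forall t w, f t w <= kappa -> exists A, [/\ measurable A,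
     (lebesgue_rV R d A <= (1 / (2 ^ n.+1)%:R)%:E)%E &
     (X t w (box n `\` A) <= (1 / (2 ^ n.+1)%:R)%:E)%E]].
Proof.
pose r : R := 1 / (2 ^ n.+1)%:R; rewrite -/r.
have r0 : 0 < r by rewrite divr_gt0// ltr0n expn_gt0.
have r1 : r <= 2^-1.
  by rewrite /r div1r lef_pV2 ?posrE ?ltr0n ?expn_gt0// ler_nat expnS leq_pmulr// expn_gt0.
pose S : R := (2 * n%:R + 2) ^+ 2.
have S1 : 1 <= S.
  rewrite /S expr_ge1// ?addr_ge0// ?mulr_ge0//.
  by rewrite -[leLHS]add0r lerD ?mulr_ge0// ler1n.
have S0 : 0 < S := lt_le_trans ltr01 S1.
have e1 : 1 <= 2 * expR 1 :> R.
  by rewrite -[leLHS]mul1r ler_pM// ?ler1n// -[leLHS]expR0 ler_expR.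
have E0 : 0 < 2 * expR 1 :> R := lt_le_trans ltr01 e1.
(* Makes the mass bound of [score_le] equal to r. *)
pose theta : R := r / (S * (2 * expR 1)).
have SE1 : 1 <= S * (2 * expR 1) by rewrite -[leLHS]mul1r ler_pM.
have th0 : 0 < theta by rewrite divr_gt0// mulr_gt0.
have th2 : theta <= 2^-1.
  by apply: le_trans r1; rewrite ler_pdivrMr ?mulr_gt0// ler_peMr// ltW.
have c0 : 0 <= cross_section i0 i1 n :> R := cross_section_ge0 i0 i1 n.
(* Makes the Lebesgue bound of [score_le] at most r. *)
pose kappa : R := theta * r / (cross_section i0 i1 n + 1).
have c1 : 0 < cross_section i0 i1 n + 1 :> R by rewrite ltr_wpDl.
have k0 : 0 < kappa by rewrite divr_gt0// mulr_gt0.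
(* The bound asked for each bump; the total area of the tiles is at most S, so the mean score is at
   most kappa r. *)
have eta0 : 0 < kappa * r / S by rewrite divr_gt0// mulr_gt0.
have n1 : (0 : R) < n.+1%:R^-1 by rewrite invr_gt0 ltr0n.
have n2 : n.+1%:R^-1 <= 1 :> R by rewrite invf_le1 ?ltr0n// ler1n.
have [eps [phi [/andP[eps0 eps1] Cphi phi0 phi_ge phiE]]] :=
  laplace_test hX mg gC ncg hX0 i01 eta0 n1 n2.
pose a : R := Num.sqrt eps.
have a0 : 0 < a by rewrite sqrtr_gt0.
have a2 : a ^+ 2 = eps by rewrite sqr_sqrtr// ltW.
have a1 : a <= 1 by rewrite -sqrtr1 ler_wsqrtr.
have tile_ge p x : sqdist i0 i1 p x <= 2 * a ^+ 2 -> expR (-1) / a ^+ 2 <= phi p x.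
  by rewrite a2; exact: phi_ge.
have X0 p t w : 0 <= Xf X (phi p) t w by apply: bm_int_ge0 => x; exact: phi0.
have bX p t : 0 <= t -> bm (fun w => 1 - expR (- Xf X (phi p) t w)).
  move=> t0; apply: bmB; first exact: bm_cst.
  split; last by exists 1 => w; rewrite ger0_norm ?expR_ge0// -expR0 ler_expR oppr_le0.
  apply: measurableT_comp => //; apply: measurableT_comp => //.
  exact: (fm_measurable hF t0 ((fmP hF _ t0).2 (Xf_adapted hX (Cphi p) t0))).
exists (fun t w => score n a phi (X t w)), kappa; split => //.
- apply: measurable_sum => ij; apply: measurable_funM => //.
  apply: measurable_funB => //; apply: measurableT_comp => //; apply: measurableT_comp => //.
  exact: (Xf_joint hX (Cphi _)).
- move=> t w; apply: sumr_ge0 => ij _; rewrite mulr_ge0 ?sqr_ge0// subr_ge0.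
  by rewrite -expR0 ler_expR oppr_le0; exact: X0.
- move=> t nt tn; have t0 : 0 <= t := le_trans (ltW n1) nt.
  have bXa (ij : 'I_(tiles n a) * 'I_(tiles n a)) :
      bm (fun w => a ^+ 2 * (1 - expR (- Xf X (phi (corner n a ij.1, corner n a ij.2)) t w))).
    by apply: bmM; [exact: bm_cst|exact: bX].
  split; first exact: bm_sum.
  rewrite bm_int_sum//.
  apply: (@le_trans _ _ (\sum_(ij : 'I_(tiles n a) * 'I_(tiles n a)) a ^+ 2 * (kappa * r / S))).
    apply: ler_sum => ij _; rewrite bm_intZ; last exact: bX.
    by rewrite ler_wpM2l ?sqr_ge0//; apply: phiE => //; rewrite invrK.
  rewrite sumr_const card_prod !card_ord -[leLHS]mulr_natr mulnn.
  have := ler_wpM2l (ltW eta0) (tiles_area n a0 a1).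
  rewrite -/S divfK ?gt_eqF//; apply: le_trans.
  move: (kappa * r / S) ((_ ^ 2)%:R : R) => x y.
  by rewrite le_eqVlt; apply/orP; left; apply/eqP; ring.
move=> t w /(score_le i01 a0 a1 Cphi phi0 tile_ge th0 th2)[A [mA A1 A2]].
exists A; split => //.
  apply: le_trans A1 _; rewrite lee_fin ler_pdivrMr// /kappa mulrA ler_pdivrMr//.
  have h := mulr_ge0 (ltW th0) (ltW r0).
  by move: (theta) (r) (cross_section i0 i1 n) h => x y z h; lra.
apply: le_trans A2 _; rewrite lee_fin -/S /theta.
rewrite le_eqVlt; apply/orP; left; apply/eqP; field.
by rewrite !gt_eqF// ?expR_gt0.
Qed.

Lemma superprocess_singular :
  \forall w \ae P, \forall t \ae (@lebesgue_measure R),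
    0 < t -> mutually_singular (X t w) (lebesgue_rV R d).
Proof.
have /choice[f /choice[kappa hf]] := score_at_scale.
(* Bad pairs of time and sample point at scale n. Outside their limsup the criterion
   [singular_of_boxes] applies. *)
pose D (n : nat) : set (measurableTypeR R * Omega) :=
  [set tw | 0 < tw.1 /\ kappa n < f n tw.1 tw.2].
have mD n : measurable (D n).
  have [_ mf _ _ _] := hf n.
  have -> : D n = (fst @^-1` `]0, +oo[%classic) `&`
      ([set tw : R * Omega | 0 <= tw.1] `&`
       (fun tw => f n tw.1 tw.2) @^-1` `]kappa n, +oo[%classic).
    apply/seteqP; split => -[t w]; rewrite /D /= !in_itv /= !andbT.
      by move=> [t0 k]; split => //; split => //; exact: ltW.
    by move=> [t0 [_ k]].
  apply: measurableI.
    by rewrite -[X in measurable X]setTI; apply: measurable_fst.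
  apply: mf => //.
  have -> : [set tw : R * Omega | 0 <= tw.1] = fst @^-1` `[(0 : R), +oo[%classic.
    by apply/seteqP; split => tw /=; rewrite in_itv /= andbT.
  by rewrite -[X in measurable X]setTI; apply: measurable_fst.
have mS := lim_sup_set_measurable mD.
have S0 (t : R) : P (xsection (lim_sup_set D) t) = 0%E.
  have -> : xsection (lim_sup_set D) t = lim_sup_set (fun n => xsection (D n) t).
    apply/seteqP; split => w.
      move=> /xsectionP h n _; have [k nk Dk] := h n I; exists k => //.
      exact/xsectionP.
    move=> h; apply/xsectionP => n _; have [k nk /xsectionP Dk] := h n I; by exists k.
  have mDt n : measurable (xsection (D n) t) by exact: measurable_xsection.
  have [t0|t0] := ltP 0 t; last first.
    apply: (lim_sup_set_null (N := 0)) => // n _.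
    rewrite (_ : xsection _ _ = set0) ?measure0 ?lee_fin ?divr_ge0//.
    by apply/seteqP; split => w // /xsectionP[/=]; rewrite ltNge t0.
  (* From this scale on, the fixed time t lies in the window [1 / (n + 1), n + 1]. *)
  apply: (lim_sup_set_null (N := maxn (Num.truncn t) (Num.truncn t^-1))) => // n.
  rewrite geq_max => /andP[tn tn'].
  have h1 : t <= n.+1%:R.
    by rewrite ltW// (lt_le_trans (truncnS_gt _))// ler_nat ltnS.
  have h2 : n.+1%:R^-1 <= t.
    rewrite -[leRHS]invrK lef_pV2 ?posrE ?invr_gt0// ?ltr0n// ltW//.
    by rewrite (lt_le_trans (truncnS_gt _))// ler_nat ltnS.
  have [k0 _ f0 /(_ t h2 h1)[bf Ef] _] := hf n.
  have key : kappa n * \int[P]_w \1_(xsection (D n) t) w <= \int[P]_w f n t w.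
    rewrite -bm_intZ; last exact: bm_indic.
    apply: bm_le => //; first by apply: bmM; [exact: bm_cst|exact: bm_indic].
    move=> w; rewrite indicE; have [/xsectionP[_ /= h]|h] := pselect (xsection (D n) t w).
      by rewrite mem_set ?mulr1 ?ltW//; apply/xsectionP; split.
    by rewrite memNset// mulr0.
  have := le_trans key Ef; rewrite ler_pM2l// (int_indic P (mDt n)) => h.
  move: h; rewrite -lee_fin; apply: le_trans.
  by rewrite (fineK (fin_num_measure P _ (mDt n))).
apply: filterS (null_ysection mS S0) => w w0.
have mY : measurable (ysection (lim_sup_set D) w) by exact: measurable_ysection.
exists (ysection (lim_sup_set D) w); split => // t /= nt; apply/ysectionP.
apply: contrapT => h; apply: nt => t0.
have [m hm] : exists m : nat, forall n, (m <= n)%N -> ~ D n (t, w).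
  apply: contrapT => h'; apply: h => m _.
  apply: contrapT => h2; apply: h'; exists m => n mn Dn; apply: h2; by exists n.
apply: (singular_of_boxes (N := m)) => n mn; have [_ _ _ _] := hf n; apply.
by rewrite leNgt; apply/negP => k; apply: (hm _ mn).
Qed.

End singularity.

Theorem theorem1p1 (R : realType) (d : nat) (hd : (2 <= d)%N)
  (g : 'rV[R]_d -> 'rV[R]_d -> R)
  (g_measurable : measurable_fun setT
     (fun xy : 'rV[R]_d * 'rV[R]_d => g xy.1 xy.2))
  (g_bounded : exists C : R, forall x y, `|g x y| <= C)
  (g_covariance : noise_covariance g)
  (mu : MF R d)
  (dO : measure_display) (Omega : measurableType dO) (P : probability Omega R)
  (F : R -> set (set Omega)) (X : R -> Omega -> MF R d)
  (hX : superprocess_random_environment P F g X)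
  (hX0 : \forall w \ae P, forall A, measurable A -> X 0 w A = mu A) :
  \forall w \ae P, \forall t \ae (@lebesgue_measure R),
    0 < t -> mutually_singular (X t w) (lebesgue_rV R d).
Proof.
have [C gC] := g_bounded.
have d0 : (0 < d)%N by exact: leq_trans hd.
(* Since d >= 2 there are two distinct coordinates, namely 0 and 1, which span the plane of the test
   functions. *)
have i01 : Ordinal d0 != Ordinal hd by [].
exact: (superprocess_singular hX g_measurable gC g_covariance hX0 i01).
Qed.
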